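(* Let $G=\mathbb T^\ell$ be a torus acting linearly and in a Hamiltonian fashion on $\mathbb C^n$ with weight matrix $A=(a_{ij})\in\mathbb Z^{\ell\times n}$, and let $J=(J_1,\dots,J_\ell):\mathbb C^n\to\mathbb R^\ell\cong\mathfrak g^*$ be a (not necessarily homogeneous quadratic) moment map for this action, so that for some constants $c_1,\dots,c_\ell\in\mathbb R$ $$J_i(z,\overline z)=\sum_{j=1}^n a_{ij}\,z_j\overline z_j+c_i,\qquad i=1,\dots,\ell .$$ If the action is effective, then the Koszul complex $K_\bullet(\mathcal C^\infty(\mathbb C^n),J)$ on $J$ over the ring $\mathcal C^\infty(\mathbb C^n)$ is acyclic, i.e. its homology vanishes in all degrees $\geq 1$.
   Context: Let $\mathbb K$ be $\mathbb R$ or $\mathbb C$, and let $\mathcal C^\infty(\mathbb C^n)$ be the ring of smooth $\mathbb K$-valued functions on $\mathbb C^n\cong\mathbb R^{2n}$. Linear Hamiltonian torus actions. $\mathbb T^\ell$ is the $\ell$-fold product of circles, with Lie algebra $\mathfrak g\cong\mathbb R^\ell$ with basis $e_1,\dots,e_\ell$ and dual basis $e^1,\dots,e^\ell$. Every linear Hamiltonian $\mathbb T^\ell$-action can be written as an action on $(\mathbb C^n,-2\omega_0)$, $\omega_0=\frac{\mathrm i}{2}\sum_j dz_j\wedge d\overline z_j$, given by an integer weight matrix $A=(a_{ij})\in\mathbb Z^{\ell\times n}$: the element $(e^{2\pi \mathrm i\xi^1},\dots,e^{2\pi \mathrm i\xi^\ell})$ acts by $z_j\mapsto e^{-2\pi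 \mathrm i\sum_i a_{ij}\xi^i}z_j$ for $j=1,\dots,n$. A moment map is unique up to an additive constant in $\mathfrak g^*\cong\mathbb R^\ell$, and the homogeneous quadratic one has components $\sum_j a_{ij}z_j\overline z_j$. Effectiveness. The action is called effective if no one-parameter subgroup of $G$ acts trivially; equivalently, $\operatorname{rank}_{\mathbb Q}A=\ell$. Koszul complex. $K_\bullet=K_\bullet(\mathcal C^\infty(\mathbb C^n),J):=\wedge^\bullet\mathfrak g\otimes\mathcal C^\infty(\mathbb C^n)$ (with $\mathfrak g$ complexified if $\mathbb K=\mathbb C$), with $\mathcal C^\infty(\mathbb C^n)$-linear differential $\partial=\sum_{i=1}^\ell J_i\,\iota(e^i):K_\bullet\to K_{\bullet-1}$, where $\iota(e^i)$ denotes contraction with $e^i$. *)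

(* Defs.v *)
From HB Require Import structures.
From mathcomp Require Import all_boot all_order all_algebra.
From mathcomp Require Import all_classical all_reals all_analysis.
From mathcomp Require Import complex.
Set Implicit Arguments.
Unset Strict Implicit.
Unset Printing Implicit Defensive.
Import Order.TTheory GRing.Theory Num.Theory.
Import numFieldNormedType.Exports.
Local Open Scope classical_set_scope.
Local Open Scope ring_scope.

Section Ck.
Context {R : realType} {m : nat}.
Implicit Types f g : 'rV[R]_m -> R.

Fixpoint Ck (k : nat) (f : 'rV[R]_m -> R) : Prop :=
  if k is k'.+1 then
    [/\ continuous f,
        forall (i : 'I_m) x, derivable f x (delta_mx 0 i) &
        forall i : 'I_m, Ck k' ('D_(delta_mx 0 i) f)]
  else continuous f.

Lemma CkW k f : Ck k.+1 f -> Ck k f.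
Proof.
elim: k f => [|k IH] f [cf df Df]//=.
by split => // i; exact/IH/Df.
Qed.

Lemma Ck_cst k (a : R) : Ck k (cst a).
Proof.
elim: k a => [|k IH] a /=; first exact: cst_continuous.
split; [exact: cst_continuous | by move=> i x; exact: derivable_cst | move=> i].
rewrite (_ : 'D_ _ _ = cst 0); first exact: IH.
by apply/funext => x; rewrite derive_cst.
Qed.

Lemma CkB k f g : Ck k f -> Ck k g -> Ck k (f - g).
Proof.
elim: k f g => [|k IH] f g /=.
  by move=> cf cg x; apply: continuousB; [exact: cf|exact: cg].
move=> [cf df Df] [cg dg Dg]; split.
- by move=> x; apply: continuousB; [exact: cf|exact: cg].
- by move=> i x; apply: derivableB.
- move=> i; rewrite (_ : 'D_ _ _ = 'D_(delta_mx 0 i) f - 'D_(delta_mx 0 i) g).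
    exact: IH.
  by apply/funext => x; rewrite deriveB.
Qed.

Lemma CkD k f g : Ck k f -> Ck k g -> Ck k (f + g).
Proof.
move=> hf hg; rewrite -[g]opprK -[- g]sub0r.
by apply: CkB => //; apply: CkB => //; exact: (@Ck_cst k 0).
Qed.

Lemma CkM k f g : Ck k f -> Ck k g -> Ck k (f * g).
Proof.
elim: k f g => [|k IH] f g.
  by move=> cf cg x; apply: continuousM; [exact: cf|exact: cg].
move=> hf hg; have [cf df Df] := hf; have [cg dg Dg] := hg; split.
- by move=> x; apply: continuousM; [exact: cf|exact: cg].
- by move=> i x; apply: derivableM.
- move=> i; rewrite (_ : 'D_ _ _ =
      f * 'D_(delta_mx 0 i) g + g * 'D_(delta_mx 0 i) f).
    by apply: CkD; apply: IH;
      [exact: CkW hf | exact: Dg | exact: CkW hg | exact: Df].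
  by apply/funext => x; rewrite deriveM.
Qed.

Lemma Ck_coord k (j : 'I_m) : Ck k (fun x : 'rV[R]_m => x 0 j).
Proof.
pose p : 'rV[R]_m -> R := fun x => x 0 j.
have pL : linear p by move=> a u v; rewrite /p !mxE.
pose M := GRing.isLinear.Build _ _ _ _ _ pL.
pose pl : {linear 'rV[R]_m -> R} := HB.pack p M.
have dp x : differentiable p x by exact: differentiable_coord.
have D i : 'D_(delta_mx 0 i) p = cst (p (delta_mx 0 i)).
  apply/funext => x; rewrite deriveE//.
  by have -> := @diff_lin _ _ _ pl x (@coord_continuous _ _ _ _ _).
case: k => [|k] /=; first exact: coord_continuous.
split; first exact: coord_continuous.
  by move=> i x; exact: diff_derivable.
by move=> i; rewrite D; exact: Ck_cst.
Qed.

End Ck.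

(* C^n is identified with R^(2n) by z_j = x_j + i y_j. *)
Definition of_real_coords {R : realType} {n : nat} (w : 'rV[R]_(n + n)) :
    'rV[R[i]]_n :=
  \row_j (w 0 (lshift n j) +i* w 0 (rshift n j))%C.

Definition smooth {R : realType} {n : nat} (f : 'rV[R[i]]_n -> R) : Prop :=
  forall k, Ck k (f \o of_real_coords).

Definition csmooth {R : realType} {n : nat} (f : 'rV[R[i]]_n -> R[i]) : Prop :=
  smooth (@complex.Re R \o f) /\ smooth (@complex.Im R \o f).

Section smooth_ring.
Context {R : realType} {n : nat}.
Implicit Types (f g : 'rV[R[i]]_n -> R) (F G : 'rV[R[i]]_n -> R[i]).

Lemma smooth_cst (a : R) : smooth (fun _ : 'rV[R[i]]_n => a).
Proof. by move=> k; exact: Ck_cst. Qed.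

Lemma smoothB f g : smooth f -> smooth g -> smooth (f - g).
Proof. by move=> hf hg k; exact: CkB (hf k) (hg k). Qed.

Lemma smoothD f g : smooth f -> smooth g -> smooth (f + g).
Proof. by move=> hf hg k; exact: CkD (hf k) (hg k). Qed.

Lemma smoothM f g : smooth f -> smooth g -> smooth (f * g).
Proof. by move=> hf hg k; exact: CkM (hf k) (hg k). Qed.

Lemma smooth_Re (j : 'I_n) :
  smooth (fun z : 'rV[R[i]]_n => complex.Re (z 0 j)).
Proof.
move=> k; rewrite (_ : _ \o _ = fun w : 'rV[R]_(n + n) => w 0 (lshift n j)).
  exact: Ck_coord.
by apply/funext => w /=; rewrite mxE.
Qed.

Lemma smooth_Im (j : 'I_n) :
  smooth (fun z : 'rV[R[i]]_n => complex.Im (z 0 j)).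
Proof.
move=> k; rewrite (_ : _ \o _ = fun w : 'rV[R]_(n + n) => w 0 (rshift n j)).
  exact: Ck_coord.
by apply/funext => w /=; rewrite mxE.
Qed.

Definition smooth_pred : {pred 'rV[R[i]]_n -> R} := fun f => `[< smooth f >].

Definition csmooth_pred : {pred 'rV[R[i]]_n -> R[i]} :=
  fun F => `[< csmooth F >].

Lemma smooth_subring_closed : subring_closed smooth_pred.
Proof.
split=> [|f g /asboolP hf /asboolP hg|f g /asboolP hf /asboolP hg];
  apply/asboolP.
- exact: smooth_cst.
- exact: smoothB.
- exact: smoothM.
Qed.

Lemma csmooth_subring_closed : subring_closed csmooth_pred.
Proof.
split=> [|F G /asboolP[rF iF] /asboolP[rG iG]
         |F G /asboolP[rF iF] /asboolP[rG iG]]; apply/asboolP; split.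
- exact: smooth_cst.
- exact: smooth_cst.
- rewrite (_ : _ \o _ = (@complex.Re R \o F) - (@complex.Re R \o G)).
    exact: smoothB.
  by apply/funext => z /=; rewrite !fctE; case: (F z) (G z) => [? ?] [].
- rewrite (_ : _ \o _ = (@complex.Im R \o F) - (@complex.Im R \o G)).
    exact: smoothB.
  by apply/funext => z /=; rewrite !fctE; case: (F z) (G z) => [? ?] [].
- rewrite (_ : _ \o _ = (@complex.Re R \o F) * (@complex.Re R \o G)
                       - (@complex.Im R \o F) * (@complex.Im R \o G)).
    by apply: smoothB; exact: smoothM.
  by apply/funext => z /=; rewrite !fctE /=; case: (F z) (G z) => [? ?] [].
- rewrite (_ : _ \o _ = (@complex.Re R \o F) * (@complex.Im R \o G)
                       + (@complex.Im R \o F) * (@complex.Re R \o G)).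
    by apply: smoothD; exact: smoothM.
  by apply/funext => z /=; rewrite !fctE /=; case: (F z) (G z) => [? ?] [].
Qed.

HB.instance Definition _ :=
  GRing.isSubringClosed.Build _ smooth_pred smooth_subring_closed.
HB.instance Definition _ :=
  GRing.isSubringClosed.Build _ csmooth_pred csmooth_subring_closed.

End smooth_ring.

Record smooth_fun (R : realType) (n : nat) := SmoothFun {
  smooth_val :> 'rV[R[i]]_n -> R;
  smooth_valP : smooth_val \in smooth_pred }.

Record csmooth_fun (R : realType) (n : nat) := CsmoothFun {
  csmooth_val :> 'rV[R[i]]_n -> R[i];
  csmooth_valP : csmooth_val \in csmooth_pred }.

Section smooth_fun_ring.
Context (R : realType) (n : nat).

HB.instance Definition _ := [isSub of smooth_fun R n for @smooth_val R n].
HB.instance Definition _ := [Choice of smooth_fun R n by <:].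
HB.instance Definition _ := GRing.SubChoice_isSubComPzRing.Build _ _
  (smooth_fun R n) smooth_subring_closed.

HB.instance Definition _ := [isSub of csmooth_fun R n for @csmooth_val R n].
HB.instance Definition _ := [Choice of csmooth_fun R n by <:].
HB.instance Definition _ := GRing.SubChoice_isSubComPzRing.Build _ _
  (csmooth_fun R n) csmooth_subring_closed.

Lemma complexify_subproof (f : smooth_fun R n) :
  (fun z => (f z)%:C%C) \in @csmooth_pred R n.
Proof.
by apply/asboolP; split; [exact/asboolP/(smooth_valP f) | exact: smooth_cst].
Qed.

Definition complexify (f : smooth_fun R n) : csmooth_fun R n :=
  CsmoothFun (complexify_subproof f).

End smooth_fun_ring.

Section torus_action.
Context {R : realType} {l n : nat}.
Implicit Types (A : 'M[int]_(l, n)) (xi : 'rV[R]_l) (z : 'rV[R[i]]_n).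

Definition expi (x : R) : R[i] := (cos x +i* sin x)%C.

Definition torus_exp xi : 'rV[R[i]]_l := \row_i expi (2 * pi * xi 0 i).

Definition torus_act A (g : 'rV[R[i]]_l) z : 'rV[R[i]]_n :=
  \row_j ((\prod_i g 0 i ^ (- A i j)) * z 0 j).

(* t |-> torus_exp (t *: xi) is the one-parameter subgroup of direction xi; it
   is a nontrivial subgroup exactly when xi != 0. *)
Definition effective A : Prop :=
  forall xi, xi != 0 ->
    ~ (forall (t : R) z, torus_act A (torus_exp (t *: xi)) z = z).

Lemma expiD x y : expi (x + y) = expi x * expi y.
Proof.
rewrite /expi cosD sinD; apply/eqP; rewrite eq_complex /= eqxx/=.
by rewrite addrC [cos x * _]mulrC [sin x * cos y]mulrC mulrC eqxx.
Qed.

Lemma expi0 : expi 0 = 1.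
Proof. by rewrite /expi cos0 sin0. Qed.

Lemma expiN x : expi (- x) = (expi x)^-1.
Proof.
have e : expi (- x) * expi x = 1 by rewrite -expiD addNr expi0.
have nz : expi x != 0.
  by apply: contra_eq_neq e => ->; rewrite mulr0 eq_sym oner_neq0.
by apply: (mulIf nz); rewrite e mulVf.
Qed.

Lemma expi_exprz x (m : int) : expi x ^ m = expi (m%:~R * x).
Proof.
have N k : expi x ^+ k = expi (k%:R * x).
  elim: k => [|k IH]; first by rewrite mul0r expi0.
  by rewrite exprS IH -expiD mulrSr mulrDl mul1r addrC.
case: m => k; first exact: N.
by rewrite NegzE -exprz_inv exprz_inv mulrNz mulNr expiN -N -exprnN.
Qed.

Lemma torus_act_exp A xi z : torus_act A (torus_exp xi) z =
  \row_j (expi (- (2 * pi * \sum_i (A i j)%:~R * xi 0 i)) * z 0 j).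
Proof.
apply/rowP => j; rewrite !mxE; congr (_ * _).
rewrite mulr_sumr -sumrN (big_morph expi expiD expi0).
apply: eq_bigr => i _; rewrite mxE expi_exprz.
by rewrite mulrNz mulNr mulrCA.
Qed.

Lemma moment_map_exists A (c : 'I_l -> R) :
  exists J : 'I_l -> smooth_fun R n, forall i z,
    (J i z)%:C%C = \sum_j (A i j)%:~R * (z 0 j * (z 0 j)^*) + (c i)%:C%C.
Proof.
pose rj j := SmoothFun (introT (asboolP _) (@smooth_Re R n j)).
pose ij j := SmoothFun (introT (asboolP _) (@smooth_Im R n j)).
pose k i := SmoothFun (introT (asboolP _) (@smooth_cst R n (c i))).
exists (fun i => \sum_j (rj j * rj j + ij j * ij j) *~ A i j + k i) => i z.
pose ev (f : smooth_fun R n) : R[i] := (f z)%:C%C.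
have evD : {morph ev : f g / f + g} by move=> f g; rewrite /ev rmorphD.
have ev0 : ev 0 = 0 by [].
have evN f : ev (- f) = - ev f by rewrite /ev rmorphN.
have evMn f p : ev (f *+ p) = ev f *+ p.
  by elim: p => [//|p IH]; rewrite !mulrSr evD IH.
have evMz f p : ev (f *~ p) = ev f *~ p.
  by case: p => p; [exact: evMn | rewrite NegzE !mulrNz evN evMn].
rewrite -/(ev _) evD (big_morph ev evD ev0); congr (_ + _).
apply: eq_bigr => j _; rewrite evMz mulrzl; congr (_ *~ _).
rewrite /ev /= !fctE; case: (z 0 j) => [a b] /=; apply/eqP.
by rewrite eq_complex /= !mulrN opprK eqxx mulrC addNr eqxx.
Qed.

End torus_action.

Section koszul.
Context {S : comPzRingType} {l : nat}.

(* The exterior algebra of g tensored with S, with g of basis e_1, ..., e_l, is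
   the free S-module on the e_T: w : {ffun {set 'I_l} -> S} stands for the
   sum over T of w(T) e_T, where e_T = e_t1 /\ ... /\ e_tk for T = {t1 < ... < tk}. *)
Definition koszul_deg (k : nat) (w : {ffun {set 'I_l} -> S}) : Prop :=
  forall T : {set 'I_l}, w T != 0 -> #|T| = k.

(* iota(e^i) e_U = (-1)^#{j in U, j < i} e_(U minus i) if i is in U, else 0;
   the coefficient of e_T comes from U = T + i. *)
Definition contraction (i : 'I_l) (w : {ffun {set 'I_l} -> S}) :
    {ffun {set 'I_l} -> S} :=
  [ffun T : {set 'I_l} => if i \in T then 0
     else (-1) ^+ #|[set j in T | (j < i)%N]| * w (i |: T)].

Definition koszul_diff (x : 'I_l -> S) (w : {ffun {set 'I_l} -> S}) :
    {ffun {set 'I_l} -> S} :=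
  [ffun T => \sum_i x i * contraction i w T].

(* The homology is ker / im of koszul_diff in each degree k >= 1; that im is
   contained in ker is koszul_diff_diff below. *)
Definition koszul_acyclic (x : 'I_l -> S) : Prop :=
  forall (k : nat) (w : {ffun {set 'I_l} -> S}), (0 < k)%N ->
    koszul_deg k w -> koszul_diff x w = 0 ->
    exists2 v, koszul_deg k.+1 v & koszul_diff x v = w.

Lemma koszul_diff_deg (x : 'I_l -> S) k w :
  koszul_deg k.+1 w -> koszul_deg k (koszul_diff x w).
Proof.
move=> hw T; apply: contra_neq_eq => hT; rewrite ffunE big1// => i _.
rewrite ffunE; case: ifPn => iT; first by rewrite mulr0.
have [->|/hw] := eqVneq (w (i |: T)) 0; first by rewrite !mulr0.
by rewrite cardsU1 iT add1n => -[] /eqP; rewrite (negbTE hT).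
Qed.

Lemma koszul_diff_diff (x : 'I_l -> S) w : koszul_diff x (koszul_diff x w) = 0.
Proof.
apply/ffunP => T; rewrite !ffunE.
pose s i := #|[set j in T | (j < i)%N]|.
pose F i j := if [|| i \in T, j \in T | i == j] then 0 else
  x i * x j * ((-1) ^+ (s i + s j + (i < j)%N) * w (j |: (i |: T))).
transitivity (\sum_i \sum_j F i j).
  apply: eq_bigr => i _; rewrite ffunE /F; case: ifPn => iT /=.
    by rewrite mulr0 big1.
  rewrite ffunE !mulr_sumr; apply: eq_bigr => j _; rewrite ffunE in_setU1.
  rewrite orbC [j == i]eq_sym; case: ifPn => [_|]; first by rewrite !mulr0.
  rewrite negb_or => /andP[jT ij].
  have -> : #|[set k in i |: T | (k < j)%N]| = (s j + (i < j)%N)%N.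
    rewrite addnC /s; case: (ltnP i j) => lij.
      rewrite (_ : [set k in i |: T | _] = i |: [set k in T | (k < j)%N]).
        by rewrite cardsU1 inE (negbTE iT).
      by apply/setP => k; rewrite !inE; case: eqVneq => // ->; rewrite lij.
    have ijF : (i < j)%N = false by rewrite ltnNge lij.
    congr #|pred_of_set _|; apply/setP => k; rewrite !inE.
    by case: eqVneq => [->|_] //=; rewrite ijF andbF.
  by rewrite -addnA !exprD -/(s i) -!mulrA; congr (_ * _); exact: mulrCA.
have FN i j : F j i = - F i j.
  rewrite /F orbCA [j == i]eq_sym; case: ifPn => [_|]; first by rewrite oppr0.
  rewrite !negb_or => /and3P[_ _ ij].
  rewrite finset.setUCA [x j * _]mulrC -mulrN -mulNr; congr (_ * (_ * _)).
  rewrite [(s j + _)%N]addnC !(exprD _ (s i + s j)) -mulrN; congr (_ * _).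
  by case: (ltngtP i j) ij => [||/val_inj ->]; rewrite ?eqxx// expr0 expr1 ?opprK.
have F0 i : F i i = 0 by rewrite /F eqxx !orbT.
rewrite pair_big /= (bigID (fun p : 'I_l * 'I_l => (p.1 < p.2)%N)) /=.
rewrite [X in _ + X](bigID (fun p : 'I_l * 'I_l => p.1 == p.2)) /=.
rewrite [X in _ + (X + _)]big1 ?add0r; last first.
  by move=> [i j] /= /andP[_ /eqP ->]; exact: F0.
pose sw (p : 'I_l * 'I_l) := (p.2, p.1).
have swK : involutive sw by case.
rewrite [X in _ + X](reindex_inj (inv_inj swK)) /=.
rewrite -[X in X + _]opprK -sumrN addrC; apply/eqP; rewrite subr_eq0; apply/eqP.
apply: eq_big => [[i j]|[i j] _] /=; last exact: FN.
by rewrite -leqNgt [RHS]ltn_neqAle andbC eq_sym.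
Qed.

End koszul.

(* Main.v *)
Require Import Defs.
From mathcomp Require Import all_boot all_order all_algebra.
From mathcomp Require Import all_classical all_reals all_analysis.
From mathcomp Require Import complex ring lra.
Set Implicit Arguments.
Unset Strict Implicit.
Unset Printing Implicit Defensive.
Import Order.TTheory GRing.Theory Num.Theory.
Import numFieldNormedType.Exports.
Local Open Scope classical_set_scope.
Local Open Scope ring_scope.

(* Effectiveness means that A has rank l, so some l columns of A, indexed by
   p, form an invertible matrix alpha.  Writing x_i for the real part of
   z_(p i), the entries of alpha^-1 J have the form x_i^2 - h_i, where h_i is
   a polynomial in the remaining real coordinates.  Cycles split into parts
   even and odd in each x_i, and odd ones are x_i times even ones, so consider
   a cycle w even in every x_i.  By Whitney's theorem on even functions
   (proved with Seeley's extension) w = W(x_1^2, ..., x_l^2, ...), where W is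
   smooth also for negative values t_i of its first l arguments.

   The functions t_i - h_i are shifted coordinates, so their Koszul complex has
   a homotopy made of divided differences, whence W = d V + E, where E is
   obtained from d W by dividing differences and substituting t_i = h_i.  Since
   w is a cycle, d W vanishes when all t_i >= 0, hence to infinite order there,
   and after t_i = x_i^2 the remainder E is a cycle that is O(|x^2 - h|^N) for
   every N: the points at which d W is evaluated have coordinates between
   x_i^2 >= 0 and h_i.  A cycle e that is flat in this sense is the boundary of
   the product of e with the vector (x^2 - h) / |x^2 - h|^2, which is again
   smooth. *)

(** * Substitutions in one coordinate and mean values *)

(** The obstacle is that x_i^2 = h_i has no real solution where h_i < 0, so no substitution in the x
    coordinates realises the quotient by x_i^2 - h_i. In the variables t_i the substitution t_i =
    h_i is always possible but leaves the orthant t >= 0, where the extension W is arbitrary and the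
    cycle condition is lost; the flat remainder is the price. It is controlled because x_i^2 >= 0
    and because -h_i <= x_i^2 - h_i, so that the depth outside the orthant is bounded by |x^2 - h|.
    Imaginary parts, unselected coordinates and the constants c_i are never eliminated: they are
    carried along inside h_i.

    Smoothness means iterated continuous partial derivatives, so the nontrivial smoothness proofs
    exhibit a family of functions whose partial derivatives are combinations of members of the
    family. Functions given by different formulas on the two sides of x_a = 0 are shown to be
    continuous, and then differentiated only off that hyperplane. *)

Section Substitution.
Context {R : realType} {m : nat}.
Local Notation X := 'rV[R]_m.
Implicit Types (x : X) (a b : 'I_m) (F G : X -> R).

Definition subst x a (v : R) : X := \row_j (if j == a then v else x 0 j).

Lemma substE x a v j : subst x a v 0 j = if j == a then v else x 0 j.
Proof. by rewrite mxE. Qed.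

Lemma subst_eq x a v : subst x a v 0 a = v.
Proof. by rewrite substE eqxx. Qed.

Lemma subst_neq x a b v : b != a -> subst x a v 0 b = x 0 b.
Proof. by rewrite substE => /negbTE ->. Qed.

Lemma subst_id x a : subst x a (x 0 a) = x.
Proof. by apply/rowP => j; rewrite substE; case: eqP => [->|]. Qed.

Lemma substK x a u v : subst (subst x a u) a v = subst x a v.
Proof. by apply/rowP => j; rewrite !substE; case: eqP. Qed.

Lemma substC x a b u v : a != b ->
  subst (subst x a u) b v = subst (subst x b v) a u.
Proof.
move=> ab; apply/rowP => j; rewrite !substE; case: eqP => [->|//].
by rewrite eq_sym (negbTE ab).
Qed.

Lemma subst_line x a v : subst x a v = (v - x 0 a) *: delta_mx 0 a + x.
Proof.
apply/rowP => j; rewrite !mxE eqxx /=; case: eqP => [->|_] /=.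
  by rewrite mulr1 subrK.
by rewrite mulr0 add0r.
Qed.

Lemma cvg_subst (T : Type) (D : set_system T) {FD : Filter D} a (u : T -> X)
    (v : T -> R) x c :
  u @ D --> x -> v @ D --> c -> (fun t => subst (u t) a (v t)) @ D --> subst x a c.
Proof.
move=> ux vc; rewrite subst_line.
under eq_fun do rewrite subst_line.
apply: cvgD => //; apply: cvgZ; last exact: cvg_cst.
apply: cvgB => //.
exact: (cvg_comp u (fun y : X => y 0 a) ux (@coord_continuous _ _ _ 0 a x)).
Qed.

(** Both sides have literally the same difference quotient. This gives access to the one-variable
    chain rule and mean value theorem for partial derivatives. *)
Lemma is_derive_subst F x a d :
  is_derive x (delta_mx 0 a) F d <->
  is_derive (x 0 a) 1 (fun t => F (subst x a t)) d.
Proof.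
have E : (fun h => h^-1 *: ((F \o shift x) (h *: delta_mx 0 a) - F x)) =
  (fun h : R => h^-1 *: (((fun t => F (subst x a t)) \o shift (x 0 a))
    (h *: (1 : R)) - F (subst x a (x 0 a)))).
  apply/funext => h /=; rewrite subst_id; congr (_ *: (F _ - _)).
  by rewrite subst_line addrK [h *: 1]mulr1.
by split => -[dF vF]; (split;
  [move: dF; rewrite /derivable E|move: vF; rewrite /derive E]).
Qed.

Lemma subst_continuous F x a : continuous F ->
  continuous (fun t => F (subst x a t)).
Proof.
move=> cF t; apply: (@continuous_comp _ _ _ (subst x a) F); last exact: cF.
by apply: cvg_subst; [exact: cvg_cst|exact: cvg_id].
Qed.

Lemma continuous_substitution (h : X -> R) a : continuous h ->
  continuous (fun x => subst x a (h x)).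
Proof.
by move=> ch x; apply: (@cvg_subst _ (nbhs x) _ a id h x (h x) cvg_id (ch x)).
Qed.

End Substitution.

Section MeanValue.
Context {R : realType}.

Lemma is_derive_affine (c d s : R) : is_derive s 1 (fun t => c + t * d) d.
Proof.
rewrite (_ : (fun t => _) = cst c + d \*: id); last first.
  by apply/funext => t; rewrite !fctE mulrC.
by apply: is_derive_eq; rewrite add0r [_ *: 1]mulr1.
Qed.

(* Parametrising the segment by [0, 1] makes the statement insensitive to the
   order of the endpoints. *)
Lemma mvt (f df : R -> R) (u v : R) : continuous f ->
  (forall s, 0 < s < 1 ->
     is_derive (u + s * (v - u)) 1 f (df (u + s * (v - u)))) ->
  exists2 s, 0 < s < 1 & f v - f u = df (u + s * (v - u)) * (v - u).
Proof.
move=> cf fdf; pose p s := u + s * (v - u).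
have dp (s : R) : is_derive s 1 p (v - u) by exact: is_derive_affine.
have cp : continuous (f \o p).
  move=> s; apply: continuous_comp; last exact: cf.
  exact/differentiable_continuous/derivable1_diffP.
have [||s] := @MVT R (f \o p) (fun s => df (p s) * (v - u)) 0 1 ltr01.
- move=> s; rewrite in_itv /= => s01.
  exact: (@is_derive1_comp _ f p s _ _ (fdf _ s01) (dp s)).
- exact: continuous_subspaceT.
rewrite in_itv /= => s01; rewrite /p /= mul0r addr0 mul1r subrKC subr0 mulr1.
by exists s.
Qed.

End MeanValue.

(** * Continuity and derivatives in terms of balls *)

Section EpsilonDelta.
Context {R : realType}.

Lemma continuous_ball (V W : normedModType R) (F : V -> W) x :
  {for x, continuous F} -> forall e : R, 0 < e ->
  exists2 r : R, 0 < r & forall y, `|y - x| < r -> `|F y - F x| <= e.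
Proof.
move=> cF e e0; have /cvgrPdist_le /(_ e e0) /nbhs_ballP[r /= r0 H] := cF.
exists r => // y yx; rewrite distrC; apply: H.
by rewrite -ball_normE /ball_ /= distrC.
Qed.

Lemma ball_continuous (V W : normedModType R) (F : V -> W) x :
  (forall e : R, 0 < e ->
    exists2 r : R, 0 < r & forall y, `|y - x| < r -> `|F y - F x| <= e) ->
  {for x, continuous F}.
Proof.
move=> H; apply/cvgrPdist_le => e e0; have [r r0 {}H] := H e e0.
apply/nbhs_ballP; exists r => //= y; rewrite -ball_normE /ball_ /= => yx.
by rewrite distrC; apply: H; rewrite distrC.
Qed.

Lemma ball_is_derive (f : R -> R) (t d : R) :
  (forall e, 0 < e -> exists2 r, 0 < r & forall h, h != 0 -> `|h| < r ->
     `|f (t + h) - f t - h * d| <= e * `|h|) ->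
  is_derive t 1 f d.
Proof.
move=> H.
have cv : (fun h => h^-1 *: ((f \o shift t) (h *: (1 : R)) - f t)) @ 0^' --> d.
  apply/cvgrPdist_le => e e0; have [r r0 {}H] := H e e0.
  rewrite near_withinE; apply/nbhs_ballP; exists r => //= h.
  rewrite -ball_normE /ball_ /= sub0r normrN => hr h0.
  rewrite [h *: 1]mulr1 [_ *: _]mulrC [h + t]addrC distrC.
  rewrite (_ : _ / h - d = (f (t + h) - f t - h * d) / h); last by field.
  by rewrite normf_div ler_pdivrMr ?normr_gt0 //; apply: H.
split; first by apply/cvg_ex; exists d.
exact/cvg_lim.
Qed.

Lemma is_derive_ball (f : R -> R) (t d : R) : is_derive t 1 f d ->
  forall e, 0 < e -> exists2 r, 0 < r & forall h, `|h| < r ->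
     `|f (t + h) - f t - h * d| <= e * `|h|.
Proof.
move=> [df dv] e e0.
have cv : (fun h => h^-1 *: ((f \o shift t) (h *: (1 : R)) - f t)) @ 0^' --> d.
  by rewrite -dv.
have /cvgrPdist_le /(_ e e0) := cv.
rewrite near_withinE => /nbhs_ballP[r /= r0 H]; exists r => // h hr.
have [->|h0] := eqVneq h 0; first by rewrite addr0 mul0r !subrr normr0 mulr0.
have := H h; rewrite -ball_normE /ball_ /= sub0r normrN => /(_ hr h0).
rewrite [h *: 1]mulr1 [_ *: _]mulrC [h + t]addrC distrC.
rewrite (_ : _ / h - d = (f (t + h) - f t - h * d) / h); last by field.
by rewrite normf_div ler_pdivrMr ?normr_gt0.
Qed.

End EpsilonDelta.

Section RowNorm.
Context {R : realType} {m : nat}.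
Local Notation X := 'rV[R]_m.
Implicit Types (x : X) (a : 'I_m).

Lemma coord_le_norm x a : `|x 0 a| <= `|x|.
Proof.
rewrite [leRHS]/Num.norm /= mx_normrE.
by apply/bigmax_geP; right => /=; exists (0, a).
Qed.

Lemma norm_le_coord x C : 0 <= C -> (forall a, `|x 0 a| <= C) -> `|x| <= C.
Proof.
move=> C0 xC; rewrite [leLHS]/Num.norm /= mx_normrE.
by apply/bigmax_leP; split => // -[i j] _ /=; rewrite ord1.
Qed.

Lemma dist_subst x a v : `|subst x a v - x| <= `|v - x 0 a|.
Proof.
apply: norm_le_coord => // j; rewrite !mxE.
by case: eqP => [->//|_]; rewrite subrr normr0.
Qed.

Lemma norm_subst x a v C : `|x| <= C -> `|v| <= C -> `|subst x a v| <= C.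
Proof.
move=> xC vC; apply: norm_le_coord => [|j]; first exact: le_trans vC.
by rewrite substE; case: eqP => // _; apply: le_trans xC; exact: coord_le_norm.
Qed.

Lemma bounded_on_ball (F : X -> R) (rho : R) : continuous F ->
  exists2 C, 0 <= C & forall x, `|x| <= rho -> `|F x| <= C.
Proof.
move=> cF; have [rho0|rho0] := ltP rho 0.
  by exists 0 => // x xr; have := lt_le_trans (le_lt_trans xr rho0) (normr_ge0 x);
    rewrite ltxx.
have cB : compact [set x : X | `|x| <= rho].
  apply: bounded_closed_compact.
    by exists rho; split => //= M rM x /= xr; apply: le_trans (ltW rM).
  have -> : [set x : X | `|x| <= rho] = (fun x => `|x|) @^-1` [set y | y <= rho].
    by [].
  apply: closed_comp; last exact: closed_le.
  by move=> x _; exact: norm_continuous.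
have [| |c _ H] := @EVT_max_rV R _ (fun x => `|F x|) _ _ cB.
- by exists 0; rewrite /= normr0.
- apply: continuous_subspaceT => x.
  by apply: (continuous_comp (cF x)); exact: norm_continuous.
- by exists `|F c| => // x xr; apply: H; rewrite inE.
Qed.

End RowNorm.

(** * Derivative formulas across a coordinate hyperplane *)

Section Extension.
Context {R : realType} {m : nat}.
Local Notation X := 'rV[R]_m.
Implicit Types (x : X) (a b : 'I_m) (F G : X -> R).

Lemma mvt_subst F G x b (u v : R) : continuous F ->
  (forall s, 0 < s < 1 ->
     let y := subst x b (u + s * (v - u)) in is_derive y (delta_mx 0 b) F (G y)) ->
  exists2 s, 0 < s < 1 &
    F (subst x b v) - F (subst x b u) = G (subst x b (u + s * (v - u))) * (v - u).
Proof.
move=> cF dF.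
apply: (@mvt R (fun t => F (subst x b t)) (fun t => G (subst x b t))).
  exact: subst_continuous.
move=> s s01; have /is_derive_subst := dF s s01; rewrite subst_eq.
by under eq_fun do rewrite substK.
Qed.

(** The mean value theorem expresses difference quotients of [F] through values of [G] at points off
    the hyperplane, and these tend to [G x] by continuity. *)
Lemma is_derive_extend a b F G : continuous F -> continuous G ->
  (forall x, x 0 a != 0 -> is_derive x (delta_mx 0 b) F (G x)) ->
  forall x, is_derive x (delta_mx 0 b) F (G x).
Proof.
move=> cF cG dF x; have [xa0|] := eqVneq (x 0 a) 0; last exact: dF.
apply/is_derive_subst/ball_is_derive => e e0.
have [r r0 Gr] := continuous_ball (cG x) e0.
(* In direction a the open segment starting at x avoids the hyperplane. *)
have [ba|ba] := eqVneq b a.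
  exists r => // h h0 hr; subst b.
  have [s /andP[s0 s1]|s /andP[s0 s1]] := @mvt_subst F G x a (x 0 a) (x 0 a + h) cF.
    by apply: dF; rewrite subst_eq xa0; rewrite !add0r subr0 mulf_neq0 // gt_eqF.
  rewrite subst_id => ->; rewrite [x 0 a + h]addrC addrK mulrC -mulrBr normrM mulrC.
  apply: ler_wpM2r => //; apply: Gr.
  apply: le_lt_trans (dist_subst _ _ _) _; rewrite addrAC subrr add0r normrM.
  by apply: le_lt_trans hr; rewrite (ger0_norm (ltW s0)) ler_piMl // ltW.
exists (r / 2); first by rewrite divr_gt0.
move=> h h0 hr; rewrite subst_id.
(* In a direction b != a the whole segment lies in x_a = 0. It is moved to x_a = y with y != 0, and
   the estimate passes to the limit y -> 0. *)
pose p y h := subst (subst x a y) b (x 0 b + h).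
have cp k : continuous (fun y => F (p y k)).
  move=> y; apply: (@continuous_comp _ _ _ (fun y => p y k) F); last exact: cF.
  apply: cvg_subst; last exact: cvg_cst.
  by apply: cvg_subst; [exact: cvg_cst|exact: cvg_id].
have p0 k : p 0 k = subst x b (x 0 b + k) by rewrite /p -xa0 subst_id.
have -> : F x = F (p 0 0) by rewrite p0 addr0 subst_id.
rewrite -p0.
apply: (@cvgr_to_le _ (0^') _ _ (fun y => `|F (p y h) - F (p y 0) - h * G x|)).
  apply: cvg_norm; apply: cvgB; last exact: cvg_cst.
  by apply: cvg_within_filter; apply: cvgB; exact: cp.
rewrite near_withinE; apply/nbhs_ballP; exists (r / 2); first by rewrite /= divr_gt0.
move=> y; rewrite -ball_normE /ball_ /= sub0r normrN => yr y0.
have [s /andP[s0 s1]|s /andP[s0 s1]] :=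
  @mvt_subst F G (subst x a y) b (x 0 b) (x 0 b + h) cF.
  by apply: dF; rewrite subst_neq ?subst_eq // eq_sym.
rewrite /p addr0 => ->; rewrite [x 0 b + h]addrC addrK mulrC -mulrBr normrM mulrC.
apply: ler_wpM2r => //; apply: Gr.
rewrite -[_ - x](subrKA (subst x a y)) (splitr r).
apply: le_lt_trans (ler_normD _ _) _; apply: ltrD.
  apply: le_lt_trans (dist_subst _ _ _) _.
  rewrite subst_neq // addrAC subrr add0r normrM; apply: le_lt_trans hr.
  by rewrite (ger0_norm (ltW s0)) ler_piMl // ltW.
by apply: le_lt_trans (dist_subst _ _ _) _; rewrite xa0 subr0.
Qed.

End Extension.

(** * Smooth functions *)

Section Smooth.
Context {R : realType} {m : nat}.
Local Notation X := 'rV[R]_m.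
Implicit Types (x : X) (a b : 'I_m) (f g h F G : X -> R).

Definition Cinfty (f : X -> R) : Prop := forall k, Ck k f.

Definition pd a f : X -> R := 'D_(delta_mx 0 a) f.

Lemma Cinfty_continuous f : Cinfty f -> continuous f.
Proof. by move/(_ 0%N). Qed.
Arguments Cinfty_continuous [f] _ x _ _.

Lemma Cinfty_pd a f : Cinfty f -> Cinfty (pd a f).
Proof. by move=> sf k; have [_ _] := sf k.+1; apply. Qed.

Lemma is_derive_pd a f x : Cinfty f -> is_derive x (delta_mx 0 a) f (pd a f x).
Proof. by move=> sf; apply: derivableP; have [_ + _] := sf 1%N; apply. Qed.

Lemma pd_eq a f g : (forall x, is_derive x (delta_mx 0 a) f (g x)) -> pd a f = g.
Proof. by move=> df; apply/funext => x; rewrite /pd derive_val. Qed.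

Lemma Cinfty_cst (c : R) : Cinfty (fun=> c).
Proof. by move=> k; exact: Ck_cst. Qed.

Lemma CinftyD f g : Cinfty f -> Cinfty g -> Cinfty (f + g).
Proof. by move=> sf sg k; exact: CkD. Qed.

Lemma CinftyB f g : Cinfty f -> Cinfty g -> Cinfty (f - g).
Proof. by move=> sf sg k; exact: CkB. Qed.

Lemma CinftyM f g : Cinfty f -> Cinfty g -> Cinfty (f * g).
Proof. by move=> sf sg k; exact: CkM. Qed.

Lemma Cinfty_coord a : Cinfty (fun x => x 0 a).
Proof. by move=> k; exact: Ck_coord. Qed.

Lemma Cinfty_sum (I : Type) (r : seq I) (P : pred I) (F : I -> X -> R) :
  (forall i, P i -> Cinfty (F i)) -> Cinfty (\sum_(i <- r | P i) F i).
Proof.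
move=> sF; elim/big_rec: _ => [|i f Pi sf]; first exact: Cinfty_cst.
by apply: CinftyD => //; exact: sF.
Qed.

(* Coinduction up to smooth combinations: a partial derivative of a member
   need only be as smooth as all the members are. *)
Lemma Cinfty_upto (P : (X -> R) -> Prop) :
  (forall F, P F -> continuous F /\ forall b, exists2 G,
     (forall k, (forall H, P H -> Ck k H) -> Ck k G) &
     forall x, is_derive x (delta_mx 0 b) F (G x)) ->
  forall F, P F -> Cinfty F.
Proof.
move=> HP F PF k; elim: k F PF => [|k IH] F PF /=.
  by have [] := HP F PF.
have [cF dF] := HP F PF; split => //.
  by move=> b x; have [G _ /(_ x)[]] := dF b.
by move=> b; have [G CG /pd_eq] := dF b; rewrite /pd => ->; exact: CG.
Qed.

(** The candidate derivative [G] is continuous because it is as smooth as the members are, so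
    [is_derive_extend] carries the formula across x_a = 0. *)
Lemma Cinfty_upto_off a (P : (X -> R) -> Prop) :
  (forall F, P F -> continuous F /\ forall b, exists2 G,
     (forall k, (forall H, P H -> Ck k H) -> Ck k G) &
     forall x, x 0 a != 0 -> is_derive x (delta_mx 0 b) F (G x)) ->
  forall F, P F -> Cinfty F.
Proof.
move=> HP; apply: Cinfty_upto => F PF; have [cF dF] := HP F PF; split => // b.
have [G CG dG] := dF b; exists G => //; apply: (is_derive_extend (a := a)) => //.
by apply: (CG 0%N) => H /HP[].
Qed.

(** A chain rule derived from continuous partial derivatives alone, since total differentiability is
    not part of [Cinfty]. *)
Lemma is_derive_substitution f h a b x : Cinfty f -> Cinfty h ->
  is_derive x (delta_mx 0 b) (fun y => f (subst y a (h y)))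
   ((if b == a then 0 else pd b f (subst x a (h x))) +
    pd a f (subst x a (h x)) * pd b h x).
Proof.
move=> sf sh; apply/is_derive_subst.
have dk : is_derive (x 0 b) 1 (fun t => h (subst x b t)) (pd b h x).
  exact/is_derive_subst/is_derive_pd.
have [->|ba] := eqVneq b a.
  under eq_fun do rewrite substK.
  rewrite add0r; apply: (@is_derive1_comp _ (fun t => f (subst x a t))
    (fun t => h (subst x a t))).
    have /is_derive_subst := is_derive_pd a (subst x a (h x)) sf.
    rewrite subst_id subst_eq.
    by under eq_fun do rewrite substK.
  exact/is_derive_subst/is_derive_pd.
set k := fun t => h (subst x b t) in dk *.
set y := subst x a (h x); set g0 := pd a f y; set k' := pd b h x.
have k0 : k (x 0 b) = h x by rewrite /k subst_id.
have dfb : is_derive (x 0 b) 1 (fun t => f (subst y b t)) (pd b f y).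
  have /is_derive_subst := is_derive_pd b y sf.
  by rewrite /y subst_neq.
apply/ball_is_derive => e e0.
have g1 : 0 < `|g0| + 1 by rewrite ltr_wpDl.
have k1 : 0 < `|k'| + 1 by rewrite ltr_wpDl.
(* The bound e1 <= 1 keeps the slope of [k] below |k'| + 1, and |g0| e1 stays below e / 3. The
   tolerance e2 on [pd a f] satisfies (|k'| + 1) e2 = e / 3. The radius involves |k'| + 2 because
   x_b moves by |s| and x_a by at most (|k'| + 1) |s|. *)
pose e1 := Num.min 1 (e / 3 / (`|g0| + 1)).
have e10 : 0 < e1 by rewrite lt_min ltr01 !divr_gt0.
pose e2 := e / 3 / (`|k'| + 1).
have e20 : 0 < e2 by rewrite !divr_gt0.
have e30 : 0 < e / 3 by rewrite divr_gt0.
have [r1 r10 H1] := is_derive_ball dk e10.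
have cg : continuous (pd a f) by exact/Cinfty_continuous/Cinfty_pd.
have [r2 r20 H2] := continuous_ball (cg y) e20.
have [r3 r30 H3] := is_derive_ball dfb e30.
pose r := Num.min r1 (Num.min r3 (r2 / (`|k'| + 2))).
have k2 : 0 < `|k'| + 2 by rewrite ltr_wpDl.
exists r; first by rewrite !lt_min r10 r30 divr_gt0.
move=> s _; rewrite !lt_min => /and3P[sr1 sr3 sr2].
have Dk : `|k (x 0 b + s) - k (x 0 b) - s * k'| <= e1 * `|s| by exact: H1.
have kb : `|k (x 0 b + s) - h x| <= (`|k'| + 1) * `|s|.
  rewrite -k0 -[X in `|X|](subrK (s * k')).
  apply: le_trans (ler_normD _ _) _; rewrite [leRHS]mulrDl mul1r addrC normrM mulrC.
  apply: lerD => //; apply: le_trans Dk _.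
  by rewrite ler_piMl // ge_min lexx.
have E t : subst (subst x b t) a (h (subst x b t)) = subst (subst x b t) a (k t) by [].
have Ey : subst (subst x b (x 0 b + s)) a (h x) = subst y b (x 0 b + s).
  by rewrite /y substC // eq_sym.
have [u /andP[u0 u1] Hu] := @mvt_subst _ _ f (pd a f) (subst x b (x 0 b + s)) a
  (h x) (k (x 0 b + s)) (Cinfty_continuous sf)
  (fun u _ => is_derive_pd a _ sf).
rewrite /= subst_id E -/y.
set z := subst _ _ _ in Hu; set z' := subst _ a (h x) in Hu.
rewrite -/z.
(* The path from y to z goes through z': x_b moves while x_a is held at [h x], then x_a moves. *)
have -> : f z - f y - s * (pd b f y + g0 * k') =
  (pd a f (subst (subst x b (x 0 b + s)) a (h x + u * (k (x 0 b + s) - h x))) - g0)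
     * (k (x 0 b + s) - h x) + g0 * (k (x 0 b + s) - k (x 0 b) - s * k')
  + (f z' - f y - s * pd b f y).
  by rewrite -[f z](subrK (f z')) Hu k0; ring.
rewrite (_ : e * `|s| = e / 3 * `|s| + e / 3 * `|s| + e / 3 * `|s|); last by field.
apply: le_trans (ler_normD _ _) _; apply: lerD; last first.
  have fy : f (subst y b (x 0 b)) = f y.
    by rewrite -[in RHS](subst_id y b) [y 0 b]subst_neq.
  by rewrite /z' Ey -fy; exact: H3.
apply: le_trans (ler_normD _ _) _; apply: lerD; rewrite normrM.
  apply: le_trans (_ : e2 * ((`|k'| + 1) * `|s|) <= _).
    apply: ler_pM => //; apply: H2.
    apply: (@le_lt_trans _ _ ((`|k'| + 2) * `|s|)); last first.
      by rewrite mulrC -ltr_pdivlMr.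
    have -> : `|k'| + 2 = 1 + (`|k'| + 1) by ring.
    rewrite mulrDl mul1r -[_ - y](subrKA (subst y b (x 0 b + s))).
    rewrite addrC; apply: le_trans (ler_normD _ _) _; apply: lerD.
      apply: le_trans (dist_subst _ _ _) _.
      by rewrite /y subst_neq // addrAC subrr add0r.
    rewrite -Ey; set w := subst x b _.
    rewrite -[subst w a (h x + _)](substK _ _ (h x)).
    apply: le_trans (dist_subst _ _ _) _; rewrite subst_eq addrAC subrr add0r.
    apply: le_trans kb; rewrite normrM (ger0_norm (ltW u0)).
    by rewrite ler_piMl // ltW.
  by rewrite mulrA divfK ?gt_eqF.
apply: le_trans (_ : `|g0| * (e1 * `|s|) <= _); first by rewrite ler_wpM2l.
rewrite mulrA; apply: ler_wpM2r => //.
apply: le_trans (_ : (`|g0| + 1) * e1 <= _).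
  by apply: ler_wpM2r; [exact: ltW|rewrite lerDl].
by rewrite mulrC -ler_pdivlMr // ge_min lexx orbT.
Qed.

Lemma Cinfty_subst a f h : Cinfty f -> Cinfty h ->
  Cinfty (fun x => f (subst x a (h x))).
Proof.
move=> sf sh.
apply: (@Cinfty_upto (fun F => exists2 f, Cinfty f & F = fun x => f (subst x a (h x))));
  last by exists f.
move=> _ {sf} [{}f sf ->]; split.
  move=> x; apply: (@continuous_comp _ _ _ (fun x => subst x a (h x)) f).
    by apply: continuous_substitution; exact: Cinfty_continuous.
  by have cf := Cinfty_continuous sf; exact: cf.
move=> b; exists ((if b == a then cst 0 else fun x => pd b f (subst x a (h x))) +
  (fun x => pd a f (subst x a (h x))) * pd b h).
  move=> k PC; apply: CkD; last first.
    apply: CkM; last by apply: Cinfty_pd.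
    by apply: PC; exists (pd a f) => //; exact: Cinfty_pd.
  case: eqP => _; first exact: Ck_cst.
  by apply: PC; exists (pd b f) => //; exact: Cinfty_pd.
move=> x; apply: is_derive_eq (is_derive_substitution _ _ _ sf sh) _.
by rewrite !fctE; case: eqP.
Qed.

End Smooth.
Arguments Cinfty_continuous [R m f] _ x _ _.

(** * Hadamard quotients *)

Section Hadamard.
Context {R : realType} {m : nat}.
Local Notation X := 'rV[R]_m.
Implicit Types (x : X) (a b : 'I_m) (f g h F G : X -> R).

(* The quotient by [x_a ^ N] of the [N]-th Taylor remainder of [f] in [x_a].
   Off [x_a = 0] its derivative is
   [taylor_quotient N (pd a f) - N * taylor_quotient N.+1 f], so that the
   family is stable under derivatives. *)
Fixpoint taylor_quotient a N f : X -> R :=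
  if N is N'.+1 then fun x => if x 0 a == 0 then iter N (pd a) f x / N`!%:R else
    (taylor_quotient a N' f x - taylor_quotient a N' f (subst x a 0)) / x 0 a
  else f.

Local Notation Q := taylor_quotient.

Lemma taylor_quotient0 a N f x : x 0 a = 0 -> Q a N f x = iter N (pd a) f x / N`!%:R.
Proof. by case: N => [|N] xa0 /=; rewrite ?divr1 // xa0 eqxx. Qed.

Lemma taylor_quotientS a N f x : x 0 a != 0 ->
  Q a N.+1 f x = (Q a N f x - Q a N f (subst x a 0)) / x 0 a.
Proof. by move=> /negbTE /= ->. Qed.

Lemma taylor_quotient_pd0 a N f x :
  Q a N (pd a f) (subst x a 0) = N.+1%:R * Q a N.+1 f (subst x a 0).
Proof.
rewrite !taylor_quotient0 ?subst_eq // -iterSr factS natrM.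
have nN : N.+1%:R != 0 :> R by rewrite pnatr_eq0.
have nf : N`!%:R != 0 :> R by rewrite pnatr_eq0 -lt0n fact_gt0.
by move: (N.+1%:R) (N`!%:R) nN nf => u v u0 v0; field; rewrite u0 v0.
Qed.

Lemma is_derive_near (F G : R -> R) (t d : R) : t != 0 ->
  (forall u, u != 0 -> F u = G u) -> is_derive t 1 G d -> is_derive t 1 F d.
Proof.
move=> t0 FG; apply: near_eq_is_derive; near=> u.
apply/esym/FG; near: u; exact: (@cvgr_neq0 _ _ _ _ _ id t).
Unshelve. all: by end_near. Qed.

Lemma is_derive_taylor_quotient_off a N f x : Cinfty f -> x 0 a != 0 ->
  is_derive x (delta_mx 0 a) (Q a N f)
    (Q a N (pd a f) x - N%:R * Q a N.+1 f x).
Proof.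
elim: N f x => [|N IH] f x sf xa0.
  by rewrite mul0r subr0; exact: is_derive_pd.
apply/is_derive_subst.
pose c := Q a N f (subst x a 0); pose t := x 0 a.
have /is_derive_subst dq := IH f x sf xa0.
apply: (is_derive_near xa0 (G := (fun u => Q a N f (subst x a u) - c) *
  (fun u : R => u^-1))).
  by move=> u u0; rewrite taylor_quotientS ?subst_eq // substK.
have di : is_derive (x 0 a) 1 (fun u : R => u^-1) (- (t ^- 2)).
  apply: is_derive_eq; first exact: (@is_deriveV _ id _ 1 1).
  by rewrite [LHS]mulr1.
have dqc : is_derive (x 0 a) 1 (fun u => Q a N f (subst x a u) - c)
  (Q a N (pd a f) x - N%:R * Q a N.+1 f x).
  rewrite -[X in is_derive _ _ _ X]subr0.
  exact: (@is_deriveB _ _ _ (fun u => Q a N f (subst x a u)) (cst c)).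
apply: is_derive_eq (is_deriveM dqc di) _.
rewrite subst_id [Q a N.+2 f x]taylor_quotientS // [Q a N.+1 (pd a f) x]taylor_quotientS //.
rewrite taylor_quotient_pd0 [Q a N.+1 f x]taylor_quotientS // -/c -/t.
rewrite -[_ *: _]/(_ * _) -[t^-1 *: _]/(_ * _).
by rewrite -[N.+1%:R]natr1; field.
Qed.

(** Rolle's theorem for t^N (q(t) - q(0)) - k t^(N+1), with q the N-th quotient along the line and k
    the next one at x: it vanishes at 0 and at x_a. The factor t^N cancels the singular part of q',
    so that the derivative is t^N (Q_N(pd f) - (N+1) k). *)
Lemma taylor_quotient_mean a N f x : Cinfty f -> continuous (Q a N f) ->
  exists2 s, 0 <= s <= 1 &
    Q a N.+1 f x = Q a N (pd a f) (subst x a (s * x 0 a)) / N.+1%:R.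
Proof.
move=> sf cQ; have [xa0|xa0] := eqVneq (x 0 a) 0.
  exists 0; first by rewrite lexx ler01.
  by rewrite mul0r taylor_quotient_pd0 -xa0 subst_id [N.+1%:R * _]mulrC mulfK // pnatr_eq0.
set v := x 0 a; pose q t := Q a N f (subst x a t).
pose k := Q a N.+1 f x.
have [||s /andP[s0 s1]] := @mvt R (fun t => t ^+ N * (q t - q 0) - k * t ^+ N.+1)
    (fun t => t ^+ N * (Q a N (pd a f) (subst x a t) - N.+1%:R * k)) 0 v.
- move=> t; apply: cvgB.
    apply: cvgM; first exact: exprn_continuous.
    by apply: cvgB; [exact: (subst_continuous cQ)|exact: cvg_cst].
  by apply: cvgM; [exact: cvg_cst|exact: exprn_continuous].
- move=> s /andP[s0 s1]; rewrite subr0 add0r.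
  have t0 : s * v != 0 by rewrite mulf_neq0 // gt_eqF.
  set t := s * v in t0 *.
  have := @is_derive_taylor_quotient_off a N f (subst x a t) sf.
  rewrite subst_eq => /(_ t0) /is_derive_subst; rewrite subst_eq.
  under eq_fun do rewrite substK.
  move=> dq.
  have dqc : is_derive t 1 (fun u => q u - q 0)
    (Q a N (pd a f) (subst x a t) - N%:R * Q a N.+1 f (subst x a t)).
    rewrite -[X in is_derive _ _ _ X]subr0.
    exact: (@is_deriveB _ _ _ q (cst (q 0))).
  have dX n : is_derive t 1 (fun u : R => u ^+ n) (n%:R * t ^+ n.-1).
    by apply: DeriveDef; [exact: exprn_derivable|rewrite exp_derive [LHS]mulr1].
  have dk : is_derive t 1 (fun u : R => k * u ^+ N.+1) (k * (N.+1%:R * t ^+ N)).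
    exact: (@is_deriveZ _ _ _ (fun u : R => u ^+ N.+1) k).
  apply: is_derive_eq (is_deriveB (is_deriveM (dX N) dqc) dk) _.
  rewrite taylor_quotientS ?subst_eq // substK -/(q t) -/(q 0).
  rewrite -[_ *: _]/(_ * _) -[(q t - q 0) *: _]/(_ * _).
  case: (N) => [|n] /=; first by rewrite expr0; field.
  by rewrite exprS; field.
rewrite subr0 add0r subrr mulr0 expr0n /= mulr0 !subr0.
rewrite {1}/k taylor_quotientS // -/v [q v]/q subst_id -/(q 0).
have -> : v ^+ N * (Q a N f x - q 0) - (Q a N f x - q 0) / v * v ^+ N.+1 = 0.
  by rewrite exprS; field.
move=> /esym/eqP; rewrite !mulf_eq0 (negbTE xa0) orbF expf_eq0 mulf_eq0 gt_eqF //=.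
rewrite (negbTE xa0) andbF /= subr_eq0 => /eqP e.
exists s; first by rewrite !ltW.
by rewrite e [RHS]mulrC mulKf ?pnatr_eq0 // /k taylor_quotientS.
Qed.

(** Only points with x_a = 0 are at issue. There the mean value form rewrites the quotient of order
    N+1 as a value of the quotient of order N of [pd a f] at a nearby point, which is continuous by
    induction. *)
Lemma taylor_quotient_continuous a N f : Cinfty f -> continuous (Q a N f).
Proof.
elim: N f => [|N IH] f sf; first exact: Cinfty_continuous.
move=> x; have [xa0|xa0] := eqVneq (x 0 a) 0.
  apply: ball_continuous => e e0.
  have cQ := IH _ (Cinfty_pd a sf).
  have [r r0 H] := continuous_ball (cQ x) e0.
  exists r => // y yx.
  have [s /andP[s0 s1] ->] := @taylor_quotient_mean a N f y sf (IH f sf).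
  have [s' _ ->] := @taylor_quotient_mean a N f x sf (IH f sf).
  rewrite xa0 mulr0 -xa0 subst_id -mulrBl normrM.
  rewrite [X in _ * X]ger0_norm ?invr_ge0 //.
  rewrite ler_pdivrMr ?ltr0n //; apply: le_trans (_ : e <= _); last first.
    by rewrite ler_pMr // ler1n.
  apply: H; apply: le_lt_trans yx; apply: norm_le_coord => // j.
  apply: le_trans (coord_le_norm _ j); rewrite !mxE.
  case: eqP => [->|//]; rewrite xa0 !subr0 normrM ger0_norm //.
  by rewrite ler_piMl.
have -> : Q a N.+1 f = fun y => if y 0 a == 0 then Q a N.+1 f y else
  (Q a N f y - Q a N f (subst y a 0)) / y 0 a.
  by apply/funext => y; case: ifPn => // ya0; rewrite taylor_quotientS.
have c : {for x, continuous
    (fun y => (Q a N f y - Q a N f (subst y a 0)) / y 0 a)}.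
  apply: (@continuousM _ _ (fun y => Q a N f y - Q a N f (subst y a 0))
    (fun y : X => (y 0 a)^-1)); last first.
    by apply: (@continuousV _ _ (fun y : X => y 0 a)) => //; exact: coord_continuous.
  apply: (@continuousB _ _ _ (Q a N f) (fun y => Q a N f (subst y a 0))).
    exact: IH.
  apply: (@continuous_comp _ _ _ (fun y => subst y a 0)); last exact: IH.
  by apply: (@continuous_substitution _ _ (cst 0)); exact: cst_continuous.
have nx : \forall y \near x, (y : X) 0 a != 0.
  apply: (@cvgr_neq0 _ _ _ (nbhs x) _ (fun y : X => y 0 a) (x 0 a)) => //.
  exact: coord_continuous.
apply: ball_continuous => e e0; have [r r0 H] := continuous_ball c e0.
have /nbhs_ballP[r' /= r'0 H'] := nx.
exists (Num.min r r'); first by rewrite lt_min r0.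
move=> y; rewrite lt_min => /andP[yr yr'].
have ya0 : y 0 a != 0 by apply: H'; rewrite -ball_normE /ball_ /= distrC.
by rewrite (negbTE ya0) (negbTE xa0); exact: H.
Qed.

Lemma is_derive_taylor_quotient_other a b N f x : b != a -> Cinfty f ->
  is_derive x (delta_mx 0 b) (Q a N f) (Q a N (pd b f) x).
Proof.
move=> ba; elim: N f x => [|N IH] f x sf; first exact: is_derive_pd.
apply: (is_derive_extend (a := a)).
- exact: taylor_quotient_continuous.
- exact/taylor_quotient_continuous/Cinfty_pd.
move=> {}x xa0; apply/is_derive_subst.
have -> : (fun t => Q a N.+1 f (subst x b t)) = (x 0 a)^-1 \*:
  ((fun t => Q a N f (subst x b t)) - (fun t => Q a N f (subst (subst x a 0) b t))).
  have xab t : subst x b t 0 a = x 0 a by rewrite subst_neq // eq_sym.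
  by apply/funext => t; rewrite taylor_quotientS xab // substC // mulrC.
have /is_derive_subst d1 := IH f x sf.
have := IH f (subst x a 0) sf => /is_derive_subst; rewrite subst_neq // => d2.
apply: is_derive_eq (is_deriveZ _ (is_deriveB d1 d2)) _.
by rewrite taylor_quotientS // [RHS]mulrC.
Qed.

Lemma Cinfty_taylor_quotient a N f : Cinfty f -> Cinfty (Q a N f).
Proof.
move=> sf.
apply: (@Cinfty_upto_off _ _ a (fun F => exists N f, Cinfty f /\ F = Q a N f));
  last by exists N, f.
move=> _ [{}N [{sf}f [sf ->]]]; split; first exact: taylor_quotient_continuous.
move=> b; have [->|ba] := eqVneq b a.
  exists (Q a N (pd a f) - cst N%:R * Q a N.+1 f).
    move=> k PC; apply: CkB.
      by apply: PC; exists N, (pd a f); split => //; exact: Cinfty_pd.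
    by apply: CkM; [exact: Ck_cst|apply: PC; exists N.+1, f].
  by move=> x xa0; exact: is_derive_taylor_quotient_off.
exists (Q a N (pd b f)).
  by move=> k PC; apply: PC; exists N, (pd b f); split => //; exact: Cinfty_pd.
by move=> x _; exact: is_derive_taylor_quotient_other.
Qed.

(** The translation x_a -> x_a + h moves the graph x_a = h to x_a = 0, where the first Taylor
    quotient does the division; it is invertible because [h] does not involve x_a. *)
Lemma hadamard a f h : Cinfty f -> Cinfty h ->
  (forall x v, h (subst x a v) = h x) ->
  exists2 g, Cinfty g &
    forall x, f x - f (subst x a (h x)) = (x 0 a - h x) * g x.
Proof.
move=> sf sh ha; pose f1 x := f (subst x a (x 0 a + h x)).
have sf1 : Cinfty f1.
  by apply: Cinfty_subst => //; apply: CinftyD => //; exact: Cinfty_coord.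
exists (fun x => Q a 1 f1 (subst x a (x 0 a - h x))).
  apply: Cinfty_subst; first exact: Cinfty_taylor_quotient.
  by apply: CinftyB => //; exact: Cinfty_coord.
move=> x; have [e|ne] := eqVneq (x 0 a) (h x).
  by rewrite e subrr mul0r -{1}[x](subst_id x a) e subrr.
rewrite taylor_quotientS ?subst_eq ?subr_eq0 //= mulrC divfK ?subr_eq0 //.
by rewrite /f1 !substK !subst_eq !ha subrK add0r subst_id.
Qed.

End Hadamard.

(** * Seeley's coefficients *)

Section ExtensionCoefficients.
Context {R : realType}.

Lemma ratio_geometric (u : nat -> R) (n0 : nat) :
  (forall k, (n0 <= k)%N -> `|u k.+1| <= `|u k| / 2) ->
  exists C, forall k, `|u k| <= C / 2 ^+ k.
Proof.
elim: n0 u => [|n0 IH] u H.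
  exists `|u 0|; elim=> [|k IHk]; first by rewrite expr0 divr1.
  apply: le_trans (H k isT) _; rewrite exprSr invfM mulrA.
  by apply: ler_wpM2r.
have [C HC] := IH (fun k => u k.+1) (fun k n0k => H k.+1 n0k).
exists (Num.max `|u 0| (2 * C)) => -[|k].
  by rewrite expr0 divr1 le_max lexx.
apply: le_trans (HC k) _; rewrite exprS invfM mulrA; apply: ler_wpM2r.
  by rewrite invr_ge0 exprn_ge0.
by rewrite ler_pdivlMr // le_max [C * 2]mulrC lexx orbT.
Qed.

Lemma geometric_summable (u : nat -> R) C :
  (forall k, `|u k| <= C / 2 ^+ k) -> cvgn (series (fun k => `|u k|)).
Proof.
move=> uC; apply: (@series_le_cvg _ _ (geometric C (2^-1))) => //.
- by move=> k; rewrite /geometric /= exprVn; apply: le_trans (uC k).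
- by move=> k; rewrite /geometric /= exprVn.
- by apply: is_cvg_geometric_series; rewrite ger0_norm // invf_lt1 // ltr1n.
Qed.

(* The coefficients of [\prod_i (1 - z / 4 ^ i)], which vanishes at every
   [z = 4 ^ j]. *)
Fixpoint euler_coef (k : nat) : R :=
  if k is k'.+1 then - 4 * euler_coef k' / (4 ^+ k - 1) else 1.

Local Notation e := euler_coef.

Lemma euler_coefS k : e k.+1 * (4 ^+ k.+1 - 1) = - 4 * e k.
Proof.
rewrite /= divfK // subr_eq0 gt_eqF // exprn_egt1 //; by rewrite ltr1n.
Qed.

(** Consecutive terms have ratio 4^(j+1) / (4^(k+1) - 1) up to sign, which is at most 1/2 from k = j
    + 1 on. So the coefficients decay faster than any power of 4^k, and all their moments converge
    absolutely. *)
Lemma euler_coef_decay j : exists C, forall k, `|e k * 4 ^+ (k * j)| <= C / 2 ^+ k.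
Proof.
apply: (@ratio_geometric _ j.+1) => k jk.
have k41 : 0 < 4 ^+ k.+1 - 1 :> R by rewrite subr_gt0 exprn_egt1 // ltr1n.
have -> : e k.+1 * 4 ^+ (k.+1 * j) = e k * 4 ^+ (k * j) * (- (4 ^+ j.+1) / (4 ^+ k.+1 - 1)).
  by rewrite mulSn exprD exprS /=; field; rewrite gt_eqF.
rewrite normrM; apply: ler_wpM2l => //.
rewrite mulNr normrN ger0_norm; last by rewrite divr_ge0 ?exprn_ge0 // ltW.
rewrite ler_pdivrMr // ler_pdivlMl //.
have jk4 : 4 ^+ j.+2 <= 4 ^+ k.+1 :> R by apply: ler_weXn2l; rewrite ?ler1n.
have : 1 <= 4 ^+ j.+1 :> R by apply: exprn_ege1; rewrite ler1n.
by rewrite exprS in jk4; move: jk4; set u := 4 ^+ j.+1; set v := 4 ^+ k.+1; lra.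
Qed.

Lemma euler_coef_cvg0 : e k @[k --> \oo] --> (0 : R).
Proof.
have [C HC] := euler_coef_decay 0.
apply: cvg_series_cvg_0; apply: normed_cvg.
by apply: (@geometric_summable _ C) => k; have := HC k; rewrite muln0 expr0 mulr1.
Qed.

(** The functional equation P(4 z) = (1 - 4 z) P(z) of the product P carries its zero at 4^j to
    4^(j+1). For j = 0 the partial sums are e_n / 4^n. *)
Lemma euler_series j : series (fun k => e k * 4 ^+ (k * j)) @ \oo --> (0 : R).
Proof.
elim: j => [|j IH].
  rewrite -cvg_shiftS.
  have -> : (fun n => series (fun k => e k * 4 ^+ (k * 0)) n.+1) =
            (fun n => e n * (4^-1) ^+ n).
    apply/funext => n; elim: n => [|n IH].
      by rewrite /series /= big_nat1 muln0 !expr0.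
    rewrite seriesSr IH muln0 expr0 mulr1.
    have n4 : 4 ^+ n.+1 - 1 != 0 :> R.
      by rewrite subr_eq0 gt_eqF // exprn_egt1 // ltr1n.
    rewrite !exprVn; apply: (mulIf (x := 4 ^+ n.+1)); first by rewrite expf_neq0.
    rewrite divfK ?expf_neq0 // mulrDl -[X in _ + X](subrK (e n.+1)).
    rewrite -[e n.+1 * _ - _]/(e n.+1 * 4 ^+ n.+1 - e n.+1).
    have -> : e n.+1 * 4 ^+ n.+1 - e n.+1 = - 4 * e n by rewrite -euler_coefS; ring.
    by rewrite exprS; field; rewrite expf_neq0.
  have := cvgM euler_coef_cvg0 (@cvg_expr R (4^-1) _).
  rewrite mul0r; apply.
  by rewrite ger0_norm // invf_lt1 // ltr1n.
pose P := series (fun k => e k * 4 ^+ (k * j)).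
have PS n : P n.+1 = P n + e n * 4 ^+ (n * j) by rewrite /P seriesSr.
(* The functional equation at z = 4^j, on the level of partial sums. *)
have E n : series (fun k => e k * 4 ^+ (k * j.+1)) n.+1 = P n.+1 - 4 ^+ j.+1 * P n.
  elim: n => [|n IHn].
    by rewrite /P /series /= !big_nat1 big_geq // mulr0 subr0 !mul0n.
  rewrite seriesSr IHn !PS.
  have -> : e n.+1 * 4 ^+ (n.+1 * j.+1) =
     e n.+1 * (4 ^+ n.+1 - 1) * 4 ^+ (n.+1 * j) + e n.+1 * 4 ^+ (n.+1 * j).
    by rewrite mulnS exprD; ring.
  have -> : 4 ^+ (n.+1 * j) = 4 ^+ j * 4 ^+ (n * j) :> R by rewrite mulSn exprD.
  by rewrite euler_coefS exprS; ring.
rewrite -cvg_shiftS.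
have -> : (fun n => series (fun k => e k * 4 ^+ (k * j.+1)) n.+1) =
  (fun n => P n.+1) - 4 ^+ j.+1 \*: P by apply/funext => n; rewrite E.
suff : (fun n => P n.+1) - 4 ^+ j.+1 \*: P @ \oo --> 0 - 4 ^+ j.+1 *: (0 : R).
  by rewrite scaler0 subr0.
apply: cvgB; first by rewrite cvg_shiftS; exact: IH.
by apply: cvgZ; [exact: cvg_cst|exact: IH].
Qed.

(** Since 4^k / (1 + 4^k) = 1 - 1 / (1 + 4^k) and the moments of [euler_coef] vanish, each moment of
    these weights against 4^(k j) is minus the preceding one. The alternation is undone by the sign
    of (-4^k)^j. *)
Let euler_weight k : R := e k / (1 + 4 ^+ k).

Lemma euler_weight_decay j : exists C, forall k,
  `|euler_weight k * 4 ^+ (k * j)| <= C / 2 ^+ k.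
Proof.
have [C HC] := euler_coef_decay j; exists C => k; apply: le_trans (HC k).
have k4 : 1 <= 1 + 4 ^+ k :> R by rewrite lerDl exprn_ge0.
rewrite /euler_weight mulrAC normrM ler_piMr // ger0_norm ?invr_ge0 ?(le_trans _ k4) //.
by rewrite invf_le1 // (lt_le_trans _ k4).
Qed.

(** Keeps the total of the weights away from 0, so that they can be normalised. The weights begin
    with 1/2 and -4/15, then shrink by a factor of at least 10 in absolute value; 10/9 is the sum of
    the geometric series of ratio 1/10, and 1/2 exceeds 1/5 plus 10/9 of 4/15. *)
Lemma euler_weight_lower n : 1 / 5 + 10 / 9 * `|euler_weight n.+1| <= series euler_weight n.+1.
Proof.
elim: n => [|n IH].
  rewrite /series /= big_nat1 /euler_weight /= !expr0 expr1.
  rewrite (_ : - 4 * 1 / (4 - 1) / (1 + 4) = - (4 / 15)) ?normrN; last by field.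
  by rewrite ger0_norm // -[1 + 1]/(2%:R : R); lra.
rewrite seriesSr; set T := series euler_weight n.+1 in IH *.
have wS : `|euler_weight n.+2| <= `|euler_weight n.+1| / 10.
  have y4 : 4 <= 4 ^+ n.+1 :> R by rewrite -[leLHS]expr1; apply: ler_weXn2l; rewrite ?ler1n.
  have -> : euler_weight n.+2 = euler_weight n.+1 * (- (4 * (1 + 4 ^+ n.+1) /
      ((4 * 4 ^+ n.+1 - 1) * (1 + 4 * 4 ^+ n.+1)))).
    rewrite /euler_weight [e n.+2]/= -/(e n.+1) [4 ^+ n.+2]exprS.
    by move: (4 ^+ n.+1) y4 => y y4; field; apply/and3P; split; apply: lt0r_neq0; lra.
  rewrite normrM; apply: ler_wpM2l => //; rewrite normrN.
  move: (4 ^+ n.+1) y4 => y y4; rewrite ger0_norm; last first.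
    by rewrite divr_ge0 // mulr_ge0 //; lra.
  rewrite ler_pdivrMr; first nra.
  by rewrite mulr_gt0 //; lra.
have := ler_norm (- euler_weight n.+1); rewrite normrN => wn.
have := ler_norm (euler_weight n.+1).
lra.
Qed.

(** Seeley's conditions for the dilations by -4^k: moments all equal to 1 make sum_k c_k f(-4^k t)
    match f to infinite order at t = 0. *)
Lemma extension_coefficients : exists c : nat -> R,
  (forall j, cvgn (series (fun k => `|c k * (- 4 ^+ k) ^+ j|))) /\
  (forall j, series (fun k => c k * (- 4 ^+ k) ^+ j) @ \oo --> (1 : R)).
Proof.
have cw : cvgn (series euler_weight).
  have [C HC] := euler_weight_decay 0; apply: normed_cvg.
  apply: (@geometric_summable _ C) => k.
  by have := HC k; rewrite muln0 expr0 mulr1.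
pose S0 := limn (series euler_weight).
have S0gt0 : 0 < S0.
  apply: (@lt_le_trans _ _ (1 / 5)); first by lra.
  rewrite /S0; apply: limr_ge => //; near=> n.
  have n0 : (0 < n)%N by near: n; exists 1%N.
  rewrite -(prednK n0); apply: le_trans (euler_weight_lower _).
  by rewrite lerDl mulr_ge0.
exists (fun k => euler_weight k / S0); split => j.
  have [C HC] := euler_weight_decay j; apply: (@geometric_summable _ (C / S0)) => k.
  have -> : euler_weight k / S0 * (- 4 ^+ k) ^+ j =
      (-1) ^+ j * (euler_weight k * 4 ^+ (k * j)) / S0.
    by rewrite -mulN1r exprMn -exprM; ring.
  rewrite normrM [in X in X * _]normrM normrX normrN1 expr1n mul1r.
  rewrite (ger0_norm (_ : 0 <= S0^-1)) ?invr_ge0 ?(ltW S0gt0) // [leRHS]mulrAC.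
  by apply: ler_wpM2r; rewrite ?invr_ge0 ?(ltW S0gt0).
have Tj : series (fun k => euler_weight k * 4 ^+ (k * j)) @ \oo --> (-1) ^+ j * S0.
  elim: j => [|j IH].
    by rewrite expr0 mul1r; under eq_fun do rewrite muln0 expr0 mulr1; exact: cw.
  have -> : series (fun k => euler_weight k * 4 ^+ (k * j.+1)) =
     series (fun k => e k * 4 ^+ (k * j)) - series (fun k => euler_weight k * 4 ^+ (k * j)).
    apply/funext => n; rewrite !fctE /series /= -sumrB; apply: eq_bigr => k _.
    rewrite mulnS exprD /euler_weight; field.
    by rewrite gt_eqF // ltr_wpDr ?exprn_ge0.
  have -> : (-1) ^+ j.+1 * S0 = 0 - (-1) ^+ j * S0 by rewrite exprS; ring.
  by apply: cvgB; [exact: euler_series|exact: IH].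
have -> : series (fun k => euler_weight k / S0 * (- 4 ^+ k) ^+ j) =
   fun n => (-1) ^+ j / S0 * series (fun k => euler_weight k * 4 ^+ (k * j)) n.
  apply/funext => n; rewrite /series /= mulr_sumr; apply: eq_bigr => k _.
  by rewrite -mulN1r exprMn -exprM; ring.
have e1 : (-1) ^+ j / S0 * ((-1) ^+ j * S0) = 1 :> R.
  by rewrite mulrCA divfK ?gt_eqF // -exprD addnn -mul2n exprM sqrrN !expr1n.
have := cvgM (cvg_cst ((-1) ^+ j / S0)) Tj.
by rewrite e1; apply.
Unshelve. all: by end_near. Qed.

End ExtensionCoefficients.

(** * Series with summable coefficients and bounded terms *)

Section DominatedSeries.
Context {R : realType}.
Implicit Types (c v : nat -> R).

Lemma dominated_cvg (u d : nat -> R) :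
  (forall k, `|u k| <= d k) -> cvgn (series d) -> cvgn (series u).
Proof.
move=> ud cd; apply: normed_cvg; apply: series_le_cvg cd => // k.
  exact: normr_ge0.
exact: le_trans (ud k).
Qed.

Lemma dominated_tail (u d : nat -> R) N :
  (forall k, `|u k| <= d k) -> cvgn (series d) ->
  `|limn (series u) - series u N| <= limn (series d) - series d N.
Proof.
move=> ud cd; have cu := dominated_cvg ud cd.
apply: (@ler_cvg_to _ \oo _ _ (fun n => `|series u n - series u N|)
  (fun n => series d n - series d N)).
- by apply: cvg_norm; apply: cvgB => //; exact: cvg_cst.
- by apply: cvgB => //; exact: cvg_cst.
near=> n; have Nn : (N <= n)%N by near: n; exists N.
rewrite !sub_series_geq //; apply: le_trans (ler_norm_sum _ _ _) _.
by apply: ler_sum.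
Unshelve. all: by end_near. Qed.

Lemma bounded_summable c v B : cvgn (series (fun k => `|c k|)) ->
  (forall k, `|v k| <= B) ->
  [/\ forall k, `|c k * v k| <= `|c k| * B,
      cvgn (series (fun k => `|c k| * B)) & cvgn (series (fun k => c k * v k))].
Proof.
move=> cc vB; have H k : `|c k * v k| <= `|c k| * B.
  by rewrite normrM; apply: ler_wpM2l.
have cB : cvgn (series (fun k => `|c k| * B)).
  have -> : series (fun k => `|c k| * B) = (fun n => series (fun k => `|c k|) n * B).
    by apply/funext => n; rewrite /series /= mulr_suml.
  by apply: is_cvgM => //; exact: is_cvg_cst.
by split => //; exact: dominated_cvg cB.
Qed.

(** [N] is chosen before [v]; this uniformity is what allows continuity and derivatives to pass
    through the sum. *)
Lemma bounded_tail c B e : cvgn (series (fun k => `|c k|)) -> 0 <= B -> 0 < e ->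
  exists N, forall v, (forall k, `|v k| <= B) ->
    `|limn (series (fun k => c k * v k)) - series (fun k => c k * v k) N| <= e.
Proof.
move=> cc B0 e0.
have e1 : 0 < e / (B + 1) by rewrite divr_gt0 // ltr_wpDl.
have /cvgrPdist_le /(_ _ e1) [N _ HN] := cc.
exists N => v vB; have [H cB _] := bounded_summable cc vB.
apply: le_trans (dominated_tail N H cB) _.
have E n : series (fun k => `|c k| * B) n = series (fun k => `|c k|) n * B.
  by rewrite /series /= mulr_suml.
have -> : limn (series (fun k => `|c k| * B)) = limn (series (fun k => `|c k|)) * B.
  rewrite (funext E).
  by apply/cvg_lim => //; apply: cvgM => //; exact: cvg_cst.
rewrite E -mulrBl; apply: le_trans (_ : e / (B + 1) * B <= e).
  by apply: ler_wpM2r => //; apply: le_trans (ler_norm _) _; exact: (HN N (leqnn N)).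
rewrite mulrAC ler_pdivrMr ?ltr_wpDl //; apply: ler_wpM2l; first exact: ltW.
by rewrite lerDl.
Qed.

Lemma series_continuous (V : normedModType R) c (v : nat -> V -> R) (x : V) B :
  cvgn (series (fun k => `|c k|)) ->
  (forall k, continuous (v k)) ->
  (forall k y, `|y - x| < 1 -> `|v k y| <= B) ->
  {for x, continuous (fun y => limn (series (fun k => c k * v k y)))}.
Proof.
move=> cc cv vB; have B0 : 0 <= B.
  by apply: le_trans (normr_ge0 (v 0 x)) (vB 0 x _); rewrite subrr normr0.
apply: ball_continuous => e e0; have e3 : 0 < e / 3 by rewrite divr_gt0.
have [N HN] := bounded_tail cc B0 e3.
have cS n : continuous (fun y => series (fun k => c k * v k y) n).
  elim: n => [|n IH] y.
    have -> : (fun y => series (fun k => c k * v k y) 0) = cst 0.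
      by apply/funext => z; rewrite /series /= big_geq.
    exact: cst_continuous.
  have -> : (fun y => series (fun k => c k * v k y) n.+1) =
      (fun y => series (fun k => c k * v k y) n) + (cst (c n) * v n).
    by apply/funext => z; rewrite seriesSr.
  apply: continuousD; first exact: IH.
  by apply: continuousM; [exact: cst_continuous|exact: cv].
have [r r0 Hr] := continuous_ball (cS N x) e3.
exists (Num.min r 1); first by rewrite lt_min r0 ltr01.
move=> y; rewrite lt_min => /andP[yr y1].
have xB k : `|v k x| <= B by apply: vB; rewrite subrr normr0.
have yB k : `|v k y| <= B by apply: vB.
have := HN _ xB; have := HN _ yB; have := Hr y yr.
move: (limn _) (series _ N) => ly sy; move: (limn _) (series _ N) => lx sx.
rewrite !ler_norml => /andP[? ?] /andP[? ?] /andP[? ?].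
by apply/andP; split; lra.
Qed.

(** By the mean value theorem each difference quotient differs from its derivative by at most 2 B.
    The tail is therefore small uniformly in the increment, and a finite sum remains to be
    differentiated. *)
Lemma is_derive_series c (v dv : nat -> R -> R) (t r B : R) : 0 < r ->
  cvgn (series (fun k => `|c k|)) ->
  (forall k, continuous (v k)) ->
  (forall k (s : R), `|s - t| < r -> is_derive s 1 (v k) (dv k s)) ->
  (forall k s, `|s - t| < r -> `|v k s| <= B /\ `|dv k s| <= B) ->
  is_derive t 1 (fun s => limn (series (fun k => c k * v k s)))
    (limn (series (fun k => c k * dv k t))).
Proof.
move=> r0 cc cv dvv HB; have tt : `|t - t| < r by rewrite subrr normr0.
have B0 : 0 <= B by have [/(le_trans (normr_ge0 _))] := HB 0 t tt.
have dS n : is_derive t 1 (fun s => series (fun k => c k * v k s) n)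
    (series (fun k => c k * dv k t) n).
  elim: n => [|n IH].
    rewrite /series /= big_geq //.
    rewrite (_ : (fun s => _) = cst 0); first exact: is_derive_cst.
    by apply/funext => z; rewrite big_geq.
  have -> : (fun y => series (fun k => c k * v k y) n.+1) =
      (fun y => series (fun k => c k * v k y) n) + (c n \*: v n).
    by apply/funext => z; rewrite seriesSr.
  by rewrite seriesSr; apply: is_deriveD => //; apply: is_deriveZ; exact: dvv.
apply: ball_is_derive => e e0; have e2 : 0 < e / 2 by rewrite divr_gt0.
have B2 : 0 <= B + B by rewrite addr_ge0.
have [N HN] := bounded_tail cc B2 e2.
have [r' r'0 Hr] := is_derive_ball (dS N) e2.
exists (Num.min r r'); first by rewrite lt_min r0.
move=> h h0; rewrite lt_min => /andP[hr hr'].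
pose q k := (v k (t + h) - v k t - h * dv k t) / h.
have thr s : 0 < s < 1 -> `|t + s * (t + h - t) - t| < r.
  move=> /andP[s0 s1]; rewrite addrAC subrr add0r addrAC subrr add0r normrM.
  by apply: le_lt_trans hr; rewrite (ger0_norm (ltW s0)) ler_piMl // ltW.
have qB k : `|q k| <= B + B.
  rewrite /q; have [s s01 ->] := @mvt R (v k) (dv k) t (t + h) (cv k)
    (fun s s01 => dvv k _ (thr s s01)).
  rewrite (_ : _ / h = dv k (t + s * (t + h - t)) - dv k t).
    apply: le_trans (ler_normB _ _) _; apply: lerD.
      by have [] := HB k _ (thr s s01).
    by have [] := HB k t tt.
  by rewrite [t + h - t]addrAC subrr add0r; field.
have [_ _ cvt] := bounded_summable cc (fun k => (HB k t tt).1).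
have [_ _ cdvt] := bounded_summable cc (fun k => (HB k t tt).2).
have th : `|t + h - t| < r by rewrite addrAC subrr add0r.
have [_ _ cvth] := bounded_summable cc (fun k => (HB k _ th).1).
have Q n : series (fun k => c k * q k) n * h =
   series (fun k => c k * v k (t + h)) n - series (fun k => c k * v k t) n -
   h * series (fun k => c k * dv k t) n.
  rewrite /series /= mulr_suml mulr_sumr -!sumrB; apply: eq_bigr => k _.
  by rewrite /q; field.
have Qlim : limn (series (fun k => c k * q k)) * h =
   limn (series (fun k => c k * v k (t + h))) - limn (series (fun k => c k * v k t)) -
   h * limn (series (fun k => c k * dv k t)).
  have [_ _ cq] := bounded_summable cc qB.
  have /cvg_lim <- // : series (fun k => c k * q k) n * h @[n --> \oo] -->
    limn (series (fun k => c k * v k (t + h))) - limn (series (fun k => c k * v k t)) -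
     h * limn (series (fun k => c k * dv k t)).
    under eq_fun do rewrite Q.
    by apply: cvgB; [apply: cvgB|apply: cvgM => //; exact: cvg_cst].
  by apply/esym/cvg_lim => //; apply: cvgM => //; exact: cvg_cst.
rewrite -Qlim; move: (Hr h hr') (HN q qB); rewrite -Q.
set l := limn _; set s := series _ N => H1 H2.
have -> : l * h = s * h + (l - s) * h by ring.
rewrite [e]splitr [leRHS]mulrDl; apply: le_trans (ler_normD _ _) _; apply: lerD => //.
by rewrite normrM; apply: ler_wpM2r.
Qed.

End DominatedSeries.

(** * Even functions as functions of the square *)

Section EvenFunctions.
Context {R : realType} {m : nat}.
Local Notation X := 'rV[R]_m.
Implicit Types (x : X) (a b : 'I_m) (f g h F G : X -> R).

Definition even_in a f := forall x, f (subst x a (- x 0 a)) = f x.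

Lemma is_derive_coord a b x :
  is_derive x (delta_mx 0 b) (fun y : X => y 0 a) (a == b)%:R.
Proof.
apply/is_derive_subst; have [->|ab] := eqVneq a b.
  under eq_fun do rewrite subst_eq.
  exact: is_derive_id.
by under eq_fun do rewrite subst_neq //; exact: is_derive_cst.
Qed.

Lemma pd_even a b f x : Cinfty f -> even_in a f ->
  pd b f (subst x a (- x 0 a)) = (if b == a then - pd b f x else pd b f x).
Proof.
move=> sf ef.
have sh : Cinfty (fun y : X => - y 0 a).
  have -> : (fun y : X => - y 0 a) = cst 0 - (fun y : X => y 0 a).
    by apply/funext => y; rewrite !fctE sub0r.
  by apply: CinftyB; [exact: Cinfty_cst|exact: Cinfty_coord].
have /= := is_derive_substitution a b x sf sh.
rewrite (_ : (fun y => f (subst y a (- y 0 a))) = f); last first.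
  by apply/funext => y; exact: ef.
move=> [_]; rewrite -/(pd b f x) => ->.
have -> : pd b (fun y : X => - y 0 a) x = - (a == b)%:R.
  by apply: derive_val; apply: is_deriveN; exact: is_derive_coord.
rewrite [a == b]eq_sym; have [->|_] := eqVneq b a; last by rewrite oppr0 mulr0 addr0.
by rewrite add0r mulrN1 opprK.
Qed.

Lemma even_in_pd a b f : b != a -> Cinfty f -> even_in a f -> even_in a (pd b f).
Proof. by move=> /negbTE ba sf ef x; rewrite pd_even // ba. Qed.

(** The derivative of an even function is odd, hence vanishes on x_a = 0 and is divisible by x_a.
    The factor 2 makes [L] the derivative of [f] with respect to x_a^2. *)
Lemma even_quotient a f : Cinfty f -> even_in a f ->
  exists L, [/\ Cinfty L, even_in a L & forall x, pd a f x = 2 * x 0 a * L x].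
Proof.
move=> sf ef.
have [G sG HG] := @hadamard _ _ a (pd a f) (fun=> 0) (Cinfty_pd a sf)
  (Cinfty_cst 0) (fun _ _ => erefl).
have f0 x : pd a f (subst x a 0) = 0.
  have := pd_even a (subst x a 0) sf ef; rewrite eqxx subst_eq oppr0 substK.
  by move/eqP; rewrite -addr_eq0 -mulr2n mulrn_eq0 /= => /eqP.
have fG x : pd a f x = x 0 a * G x by have := HG x; rewrite f0 !subr0.
exists (cst (2^-1) * G); split.
- by apply: CinftyM; [exact: Cinfty_cst|].
- move=> x; rewrite !fctE; congr (_ * _).
  have [xa0|xa0] := eqVneq (x 0 a) 0; first by rewrite xa0 oppr0 -xa0 subst_id.
  have := pd_even a x sf ef; rewrite eqxx !fG subst_eq mulNr => /oppr_inj.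
  exact: mulfI.
- by move=> x; rewrite fG !fctE; field.
Qed.

(* [sqrt (s / (1 + s))] at [s = max(l t, 0)]: bounded, which makes dilations by
   arbitrarily large [l] harmless. *)
Definition saturation (l t : R) : R :=
  Num.sqrt (Num.max (l * t) 0 / (1 + Num.max (l * t) 0)).

Lemma saturation_ge0 l t : 0 <= saturation l t. Proof. exact: sqrtr_ge0. Qed.

Lemma saturation_le1 l t : saturation l t <= 1.
Proof.
rewrite /saturation; set u := Num.max _ _.
have u0 : 0 <= u by rewrite le_max lexx orbT.
by rewrite -[leRHS]sqrtr1; apply: ler_wsqrtr; rewrite ler_pdivrMr ?ltr_wpDr //; lra.
Qed.

Lemma saturation_norm l t : `|saturation l t| <= 1.
Proof. by rewrite ger0_norm ?saturation_le1 ?saturation_ge0. Qed.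

Lemma saturation_eq0 l t : l * t <= 0 -> saturation l t = 0.
Proof. by move=> lt0; rewrite /saturation max_r // mul0r sqrtr0. Qed.

Lemma saturation_continuous l : continuous (saturation l).
Proof.
move=> t; apply: (@continuous_comp _ _ _ (fun t =>
  Num.max (l * t) 0 / (1 + Num.max (l * t) 0)) Num.sqrt); last exact: sqrt_continuous.
have cM : continuous (fun t => Num.max (l * t) 0).
  move=> s; apply: (@continuous_max _ _ (fun t => l * t) (cst 0)).
    by apply: continuousM; [exact: cst_continuous|exact: cvg_id].
  exact: cst_continuous.
apply: continuousM; first exact: cM.
apply: (@continuousV _ _ (fun t => 1 + Num.max (l * t) 0)).
  by rewrite gt_eqF // ltr_wpDr // le_max lexx orbT.
by apply: continuousD; [exact: cst_continuous|exact: cM].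
Qed.

Lemma is_derive_saturation l (t : R) : 0 < l * t ->
  is_derive t 1 (saturation l) ((2 * saturation l t)^-1 * (l / (1 + l * t) ^+ 2)).
Proof.
move=> lt0; have p1 : 0 < 1 + l * t by rewrite ltr_wpDl.
have near_pos : \forall s \near t, 0 < l * s.
  have : (fun s => l * s) @ t --> l * t.
    by apply: continuousM; [exact: cst_continuous|exact: cvg_id].
  by move/cvgr_gt; apply.
pose p s := (l * s) * (1 + l * s)^-1.
have E : \forall s \near t, Num.sqrt (p s) = saturation l s.
  by apply: filterS near_pos => s ls; rewrite /saturation max_l // ltW.
apply: near_eq_is_derive E _.
have dl : is_derive t 1 (fun s : R => l * s) l.
  by apply: is_derive_eq; rewrite ?[_ *: 1]mulr1 //.
have d1l : is_derive t 1 (fun s : R => 1 + l * s) l.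
  by under eq_fun do rewrite mulrC; exact: is_derive_affine.
have dp : is_derive t 1 p (l / (1 + l * t) ^+ 2).
  have dV := @is_deriveV _ (fun s : R => 1 + l * s) t l 1 (lt0r_neq0 p1) d1l.
  apply: is_derive_eq (@is_deriveM _ _ (fun s : R => l * s) _ t 1 _ _ dl dV) _.
  rewrite -[_ *: (_ *: _)]/(_ * (_ * _)) -[_^-1 *: _]/(_ * _).
  by field; rewrite gt_eqF.
have -> : saturation l t = Num.sqrt (p t) by rewrite /saturation max_l // ltW.
apply: (@is_derive1_comp _ Num.sqrt p) dp.
by apply: is_derive1_sqrt; rewrite divr_gt0.
Qed.

Lemma saturation_sqr l t : 0 < l * t -> 1 - saturation l t ^+ 2 = (1 + l * t)^-1.
Proof.
move=> lt0; have p1 : 0 < 1 + l * t by rewrite ltr_wpDl.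
rewrite /saturation max_l ?ltW // sqr_sqrtr ?divr_ge0 ?ltW //.
by field; rewrite gt_eqF.
Qed.

(** For s = [saturation l t] with l t > 0 one has s^2 = l t / (1 + l t) and d(s^2)/dt = l (1 -
    s^2)^2; the weight is this chain rule factor without l. *)
Definition damp a f : X -> R := fun x => (1 - x 0 a ^+ 2) ^+ 2 * f x.

Lemma Cinfty_damp a f : Cinfty f -> Cinfty (damp a f).
Proof.
move=> sf.
have s1 : Cinfty (cst 1 - (fun x : X => x 0 a) * (fun x : X => x 0 a)).
  by apply: CinftyB; [exact: Cinfty_cst|apply: CinftyM; exact: Cinfty_coord].
have -> : damp a f = (cst 1 - (fun x : X => x 0 a) * (fun x : X => x 0 a)) *
   (cst 1 - (fun x : X => x 0 a) * (fun x : X => x 0 a)) * f.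
  by apply/funext => x; rewrite /damp !fctE !expr2.
by apply: CinftyM => //; apply: CinftyM.
Qed.

Lemma even_in_damp a f : even_in a f -> even_in a (damp a f).
Proof. by move=> ef x; rewrite /damp ef subst_eq sqrrN. Qed.

Lemma is_derive_saturated a f L x l (t : R) : Cinfty f ->
  (forall x, pd a f x = 2 * x 0 a * L x) -> 0 < l * t ->
  is_derive t 1 (fun s => f (subst x a (saturation l s)))
    (l * damp a L (subst x a (saturation l t))).
Proof.
move=> sf fL lt0; set s0 := saturation l t.
have p1 : 0 < 1 + l * t by rewrite ltr_wpDl.
have s0gt : 0 < s0.
  by rewrite /s0 /saturation max_l ?ltW // sqrtr_gt0 divr_gt0.
have := is_derive_pd a (subst x a s0) sf => /is_derive_subst.
rewrite subst_eq; under eq_fun do rewrite substK.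
move=> df.
have := @is_derive1_comp _ _ (saturation l) t _ _ df (is_derive_saturation lt0).
move=> d.
have e : pd a f (subst x a s0) * ((2 * saturation l t)^-1 * (l / (1 + l * t) ^+ 2)) =
  l * damp a L (subst x a s0); last by rewrite -e; exact: d.
rewrite fL subst_eq /damp subst_eq saturation_sqr // -/s0.
by field; rewrite !gt_eqF.
Qed.

End EvenFunctions.

(** * Seeley's extension in a bounded variable *)

Section BoundedExtension.
Context {R : realType} {m : nat}.
Local Notation X := 'rV[R]_m.
Implicit Types (x : X) (a b : 'I_m) (f g h F G : X -> R).

Variable c : nat -> R.
Hypothesis c_summable : forall j, cvgn (series (fun k => `|c k * (- 4 ^+ k) ^+ j|)).
Hypothesis c_moment : forall j, series (fun k => c k * (- 4 ^+ k) ^+ j) @ \oo --> (1 : R).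

(* For [x_a >= 0] this is [g] at [sqrt (x_a / (1 + x_a))]; the moment
   conditions on [c] make all derivatives match across [x_a = 0]. *)
Definition seeley a j g : X -> R := fun x =>
  g (subst x a (saturation 1 (x 0 a))) - g (subst x a 0) +
  limn (series (fun k => c k * (- 4 ^+ k) ^+ j *
                         g (subst x a (saturation (- 4 ^+ k) (x 0 a))))).

(** All the arguments -4^k x_a are nonpositive, so every term of the series is taken at 0; the j-th
    moment being 1, the sum cancels the subtracted value at 0. *)
Lemma seeley_pos a j g x : 0 <= x 0 a ->
  seeley a j g x = g (subst x a (saturation 1 (x 0 a))).
Proof.
move=> xa0; rewrite /seeley; set d := limn _.
suff -> : d = g (subst x a 0) by rewrite subrK.
rewrite /d.
have E n : series (fun k => c k * (- 4 ^+ k) ^+ j *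
     g (subst x a (saturation (- 4 ^+ k) (x 0 a)))) n =
   series (fun k => c k * (- 4 ^+ k) ^+ j) n * g (subst x a 0).
  rewrite /series /= mulr_suml; apply: eq_bigr => k _.
  by rewrite saturation_eq0 // mulNr oppr_le0 mulr_ge0 ?exprn_ge0.
rewrite (funext E); apply/cvg_lim => //.
have := cvgM (c_moment j) (cvg_cst (g (subst x a 0))).
by rewrite mul1r; apply.
Qed.

Lemma seeley_neg a j g x : x 0 a <= 0 -> seeley a j g x =
  limn (series (fun k => c k * (- 4 ^+ k) ^+ j *
                         g (subst x a (saturation (- 4 ^+ k) (x 0 a))))).
Proof. by move=> xa0; rewrite /seeley saturation_eq0 ?mul1r // subrr add0r. Qed.

Lemma saturated_bound a g x : continuous g ->
  exists B, forall k y, `|y - x| < 1 ->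
    `|g (subst y a (saturation (- 4 ^+ k) (y 0 a)))| <= B.
Proof.
move=> cg; have [B B0 HB] := bounded_on_ball (`|x| + 1) cg.
exists B => k y yx; apply: HB; apply: norm_subst.
  rewrite -[y](subrK x) addrC; apply: le_trans (ler_normD _ _) _.
  by rewrite lerD2l ltW.
by apply: le_trans (saturation_norm _ _) _; rewrite lerDr.
Qed.

Lemma saturated_continuous a l g : continuous g ->
  continuous (fun x => g (subst x a (saturation l (x 0 a)))).
Proof.
move=> cg x; apply: (@continuous_comp _ _ _ (fun x => subst x a (saturation l (x 0 a)))).
  apply: continuous_substitution => {}x.
  apply: (@continuous_comp _ _ _ (fun x : X => x 0 a)); first exact: coord_continuous.
  exact: saturation_continuous.
exact: cg.
Qed.

Lemma seeley_continuous a j g : continuous g -> continuous (seeley a j g).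
Proof.
move=> cg x; apply: (@continuousD _ _ _ (fun x =>
    g (subst x a (saturation 1 (x 0 a))) - g (subst x a 0))).
  apply: (@continuousB _ _ _ (fun x => g (subst x a (saturation 1 (x 0 a))))).
    exact: saturated_continuous.
  apply: (@continuous_comp _ _ _ (fun x => subst x a 0)); last exact: cg.
  by apply: (@continuous_substitution _ _ (cst 0)); exact: cst_continuous.
have [B HB] := saturated_bound a x cg.
apply: (@series_continuous _ _ (fun k => c k * (- 4 ^+ k) ^+ j)
  (fun k y => g (subst y a (saturation (- 4 ^+ k) (y 0 a)))) x B) => //.
by move=> k; exact: saturated_continuous.
Qed.

Lemma is_derive_seeley_other a b j g x : b != a -> Cinfty g ->
  is_derive x (delta_mx 0 b) (seeley a j g) (seeley a j (pd b g) x).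
Proof.
move=> ba sg; apply/is_derive_subst.
have E t : seeley a j g (subst x b t) =
    g (subst (subst x a (saturation 1 (x 0 a))) b t) -
    g (subst (subst x a 0) b t) +
    limn (series (fun k => c k * (- 4 ^+ k) ^+ j *
      g (subst (subst x a (saturation (- 4 ^+ k) (x 0 a))) b t))).
  rewrite /seeley subst_neq 1?eq_sym // !(substC _ _ _ ba).
  congr (_ + limn (series _)); apply/funext => k.
  by rewrite (substC _ _ _ ba).
rewrite (funext E).
have dg (v t : R) : is_derive t 1 (fun t => g (subst (subst x a v) b t))
    (pd b g (subst (subst x a v) b t)).
  have := is_derive_pd b (subst (subst x a v) b t) sg => /is_derive_subst.
  by rewrite subst_eq; under eq_fun do rewrite substK.
have sE v : subst (subst x a v) b (x 0 b) = subst x a v.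
  by rewrite -[in RHS](subst_id (subst x a v) b) subst_neq.
have [B1 _ HB1] := bounded_on_ball (`|x| + 1) (Cinfty_continuous sg).
have [B2 _ HB2] := bounded_on_ball (`|x| + 1) (Cinfty_continuous (Cinfty_pd b sg)).
rewrite /seeley.
apply: is_deriveD.
  have := dg (saturation 1 (x 0 a)) (x 0 b); have := dg 0 (x 0 b); rewrite !sE.
  by move=> d0 d1; exact: is_deriveB.
pose s k := saturation (- 4 ^+ k) (x 0 a).
have -> : (fun k => c k * (- 4 ^+ k) ^+ j * pd b g (subst x a (s k))) =
   (fun k => c k * (- 4 ^+ k) ^+ j * pd b g (subst (subst x a (s k)) b (x 0 b))).
  by apply/funext => k; rewrite sE.
apply: (@is_derive_series _ _ (fun k t => g (subst (subst x a (s k)) b t))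
   (fun k t => pd b g (subst (subst x a (s k)) b t)) (x 0 b) 1 (Num.max B1 B2)) => //.
  by move=> k; apply: subst_continuous; exact: Cinfty_continuous.
move=> k t tx; have H : `|subst (subst x a (s k)) b t| <= `|x| + 1.
  apply: norm_subst; last first.
    rewrite -[t](subrK (x 0 b)) addrC; apply: le_trans (ler_normD _ _) _.
    by apply: lerD; [exact: coord_le_norm|exact: ltW].
  apply: norm_subst; first by rewrite lerDl.
  by apply: le_trans (saturation_norm _ _) _; rewrite lerDr.
by rewrite !le_max HB1 // HB2 // orbT.
Qed.

(** Differentiating the term dilated by -4^k brings out that factor, which raises the moment index
    [j] by one. *)
Lemma is_derive_seeley a j g L x : Cinfty g -> Cinfty L ->
  (forall x, pd a g x = 2 * x 0 a * L x) -> x 0 a != 0 ->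
  is_derive x (delta_mx 0 a) (seeley a j g) (seeley a j.+1 (damp a L) x).
Proof.
move=> sg sL gL xa0; apply/is_derive_subst.
set t := x 0 a.
have [tgt|tlt] : 0 < t \/ t < 0 by apply/orP; rewrite orbC -neq_lt.
  rewrite seeley_pos ?ltW // -[damp _ _ _]mul1r.
  apply: near_eq_is_derive (is_derive_saturated x sg gL _); last by rewrite mul1r.
  have : \forall s \near t, 0 < s by exact: lt_nbhsr.
  apply: filterS => s s0.
  by rewrite seeley_pos subst_eq ?ltW // substK.
rewrite seeley_neg ?ltW //.
have near_neg : \forall s \near t, s < 0 by exact: lt_nbhsl.
(* One factor -4^k is moved into the coefficient. Afterwards the terms and their derivatives are
   both bounded independently of k. *)
have E : \forall s \near t,
   limn (series (fun k => c k * (- 4 ^+ k) ^+ j.+1 *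
     ((- 4 ^+ k)^-1 * g (subst x a (saturation (- 4 ^+ k) s))))) =
   seeley a j g (subst x a s).
  apply: filterS near_neg => s s0; rewrite seeley_neg subst_eq ?ltW //.
  congr (limn (series _)); apply/funext => k; rewrite substK exprSr.
  by field; rewrite expf_neq0.
apply: near_eq_is_derive E _.
have /nbhs_ballP[r /= r0 Hr] := near_neg.
pose v k s := (- 4 ^+ k)^-1 * g (subst x a (saturation (- 4 ^+ k) s)).
pose dv k s := damp a L (subst x a (saturation (- 4 ^+ k) s)).
have [B1 B10 HB1] := bounded_on_ball (`|x| + 1) (Cinfty_continuous sg).
have [B2 B20 HB2] := bounded_on_ball (`|x| + 1)
  (Cinfty_continuous (Cinfty_damp a sL)).
have xs l s : `|subst x a (saturation l s)| <= `|x| + 1.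
  apply: norm_subst; first by rewrite lerDl.
  by apply: le_trans (saturation_norm _ _) _; rewrite lerDr.
apply: (@is_derive_series _ _ v dv t r (Num.max B1 B2)) => //.
- move=> k s; apply: (@continuousM _ _ (cst (- 4 ^+ k)^-1)).
    exact: cst_continuous.
  apply: (@continuous_comp _ _ _ (saturation (- 4 ^+ k)) (fun t => g (subst x a t))).
    exact: saturation_continuous.
  by apply: subst_continuous; exact: Cinfty_continuous.
- move=> k s st.
  have s0 : s < 0 by apply: Hr; rewrite -ball_normE /ball_ /= distrC.
  have n0 : - 4 ^+ k != 0 :> R by rewrite oppr_eq0 expf_neq0.
  have ls : 0 < - 4 ^+ k * s by rewrite nmulr_lgt0 // oppr_lt0 exprn_gt0.
  have := is_deriveZ (- 4 ^+ k)^-1 (is_derive_saturated x sg gL ls).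
  by rewrite -[_ *: (_ * _)]/(_ * _) mulKf.
- move=> k s _; split; rewrite le_max.
    rewrite (le_trans _ (HB1 _ (xs (- 4 ^+ k) s))) // /v normrM ler_piMl //.
    rewrite normfV normrN ger0_norm ?exprn_ge0 // invf_le1 ?exprn_gt0 //.
    by rewrite exprn_ege1 // ler1n.
  by rewrite (HB2 _ (xs _ _)) orbT.
Qed.

Lemma Cinfty_seeley a j g : Cinfty g -> even_in a g -> Cinfty (seeley a j g).
Proof.
move=> sg eg.
apply: (@Cinfty_upto_off _ _ a (fun F => exists j g,
  [/\ Cinfty g, even_in a g & F = seeley a j g])); last by exists j, g.
move=> _ [{}j [{sg eg}g [sg eg ->]]]; split.
  by apply: seeley_continuous; exact: Cinfty_continuous.
move=> b; have [->|ba] := eqVneq b a.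
  have [L [sL eL gL]] := even_quotient sg eg.
  exists (seeley a j.+1 (damp a L)).
    move=> k; apply; exists j.+1, (damp a L).
    by split; [exact: Cinfty_damp|exact: even_in_damp|].
  by move=> x xa0; exact: is_derive_seeley.
exists (seeley a j (pd b g)).
  move=> k; apply; exists j, (pd b g).
  by split; [exact: Cinfty_pd|exact: even_in_pd|].
by move=> x _; exact: is_derive_seeley_other.
Qed.

End BoundedExtension.

(** * From a variable to its square *)

Section EvenExtension.
Context {R : realType} {m : nat}.
Local Notation X := 'rV[R]_m.
Implicit Types (x : X) (a b : 'I_m) (f g h F G : X -> R).

(** With t the coordinate of [g], this says that [g] is [f] under x_a^2 = t / (1 + t). *)
Definition saturated_pair a f g :=
  forall x, 0 < x 0 a -> g x = f (subst x a (saturation 1 (x 0 a))).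

Lemma saturated_pair0 a f g x : continuous f -> continuous g ->
  saturated_pair a f g -> g (subst x a 0) = f (subst x a 0).
Proof.
move=> cf cg fg; pose p t := g (subst x a t) - f (subst x a (saturation 1 t)).
have cp : continuous p.
  move=> t; apply: (@continuousB _ _ _ (fun t => g (subst x a t))).
    exact: (subst_continuous cg).
  apply: (@continuous_comp _ _ _ (saturation 1) (fun t => f (subst x a t))).
    exact: saturation_continuous.
  exact: (subst_continuous cf).
apply/eqP; rewrite -subr_eq0 -{2}(saturation_eq0 (l := 1) (t := 0)) ?mulr0 //.
rewrite -/(p 0) -normr_le0; apply/ler_addgt0Pl => e e0; rewrite addr0.
have [r r0 H] := continuous_ball (cp 0) e0.
have r2 : 0 < r / 2 by rewrite divr_gt0.
have <- : `|p (r / 2) - p 0| = `|p 0|.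
  by rewrite {1}/p fg ?subst_eq // substK subrr sub0r normrN.
by apply: H; rewrite subr0 gtr0_norm // ltr_pdivrMr // ltr_pMr // ltr1n.
Qed.

(** For u = x_a <= 0 the square root is 0 by convention, and [g] is taken at t = u / (1 - u), the
    inverse of u = t / (1 + t). Truncating u at 0 avoids the pole u = 1, and both halves are
    continuous on the whole line. *)
Definition square_descent a f g : X -> R := fun x =>
  f (subst x a (Num.sqrt (x 0 a))) +
  (g (subst x a (Num.min (x 0 a) 0 / (1 - Num.min (x 0 a) 0))) - g (subst x a 0)).

Lemma square_descent_pos a f g x : 0 <= x 0 a ->
  square_descent a f g x = f (subst x a (Num.sqrt (x 0 a))).
Proof. by move=> xa; rewrite /square_descent min_r // mul0r subrr addr0. Qed.

Lemma square_descent_neg a f g x : continuous f -> continuous g ->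
  saturated_pair a f g -> x 0 a <= 0 ->
  square_descent a f g x = g (subst x a (x 0 a / (1 - x 0 a))).
Proof.
move=> cf cg fg xa; rewrite /square_descent min_l // ler0_sqrtr //.
by rewrite (saturated_pair0 _ cf cg fg) addrC subrK.
Qed.

Lemma square_descent_continuous a f g : continuous f -> continuous g ->
  continuous (square_descent a f g).
Proof.
move=> cf cg x.
have csub (F : X -> R) (h : R -> R) : continuous F -> continuous h ->
    continuous (fun x => F (subst x a (h (x 0 a)))).
  move=> cF ch y; apply: (@continuous_comp _ _ _ (fun x => subst x a (h (x 0 a))));
    last exact: cF.
  apply: continuous_substitution => {}y.
  by apply: (@continuous_comp _ _ _ (fun x : X => x 0 a)); [exact: coord_continuous|exact: ch].
apply: (@continuousD _ _ _ (fun x => f (subst x a (Num.sqrt (x 0 a))))).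
  by apply: csub => //; exact: sqrt_continuous.
apply: (@continuousB _ _ _
   (fun x => g (subst x a (Num.min (x 0 a) 0 / (1 - Num.min (x 0 a) 0))))
   (fun x => g (subst x a 0))); last first.
  by apply: (csub g (cst 0)) => //; exact: cst_continuous.
apply: (csub g (fun t => Num.min t 0 / (1 - Num.min t 0))) => // t.
have cm : continuous (fun t : R => Num.min t 0).
  by move=> s; apply: (@continuous_min _ _ id (cst 0)); [exact: cvg_id|exact: cst_continuous].
apply: (@continuousM _ _ (fun t : R => Num.min t 0)); first exact: cm.
apply: (@continuousV _ _ (fun t : R => 1 - Num.min t 0)).
  by rewrite gt_eqF // subr_gt0 gt_min ltr01 orbT.
by apply: (@continuousB _ _ _ (fun=> 1 : R^o) (fun t : R => Num.min t 0));
  [exact: cst_continuous|exact: cm].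
Qed.

Lemma saturated_pair_other a b f g : b != a -> Cinfty f -> Cinfty g ->
  saturated_pair a f g -> saturated_pair a (pd b f) (pd b g).
Proof.
move=> ba sf sg fg x xa0; apply: derive_val; apply/is_derive_subst.
have -> : (fun t => g (subst x b t)) =
    (fun t => f (subst (subst x a (saturation 1 (x 0 a))) b t)).
  apply/funext => t; rewrite fg subst_neq 1?eq_sym //.
  by rewrite (substC _ _ _ ba).
have := is_derive_pd b (subst x a (saturation 1 (x 0 a))) sf => /is_derive_subst.
by rewrite subst_neq.
Qed.

(** From u = t / (1 + t) one gets d/du = (1 + t)^2 d/dt, while [L] is the derivative of [f] in u =
    x_a^2: the new pair consists of the derivatives in u. *)
Lemma saturated_pair_pd a f g L : Cinfty f -> Cinfty g -> Cinfty L ->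
  (forall x, pd a f x = 2 * x 0 a * L x) -> saturated_pair a f g ->
  saturated_pair a L (fun x => (1 + x 0 a) ^+ 2 * pd a g x).
Proof.
move=> sf sg sL fL fg x xa0.
have -> : pd a g x = damp a L (subst x a (saturation 1 (x 0 a))).
  apply: derive_val; apply/is_derive_subst.
  have l1 : 0 < 1 * x 0 a by rewrite mul1r.
  have := is_derive_saturated x sf fL l1; rewrite [1 * damp _ _ _]mul1r.
  apply: near_eq_is_derive; have : \forall s \near (x 0 a : R), 0 < s by exact: lt_nbhsr.
  by apply: filterS => s s0; rewrite fg subst_eq // substK.
rewrite /damp subst_eq saturation_sqr ?mul1r // mulrA -exprMn.
by rewrite divff ?expr1n ?mul1r // gt_eqF // ltr_wpDl.
Qed.

(** The family of descents of saturated pairs is stable under derivatives: the derivative in x_a is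
    the descent of the pair of u-derivatives, any other one that of the differentiated pair. *)
Lemma Cinfty_square_descent a f g : Cinfty f -> Cinfty g -> even_in a f ->
  saturated_pair a f g -> Cinfty (square_descent a f g).
Proof.
move=> sf sg ef fg.
apply: (@Cinfty_upto_off _ _ a (fun F => exists f g,
  [/\ Cinfty f, Cinfty g, even_in a f & saturated_pair a f g /\ F = square_descent a f g]));
  last by exists f, g.
move=> _ [{sf sg ef fg}f [{}g [sf sg ef [fg ->]]]].
have cf := Cinfty_continuous sf; have cg := Cinfty_continuous sg.
split; first exact: square_descent_continuous.
move=> b; have [->|ba] := eqVneq b a.
  have [L [sL eL fL]] := even_quotient sf ef.
  pose g' x := (1 + x 0 a) ^+ 2 * pd a g x.
  have sg' : Cinfty g'.
    have s1 : Cinfty (cst 1 + (fun x : X => x 0 a)).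
      by apply: CinftyD; [exact: Cinfty_cst|exact: Cinfty_coord].
    have -> : g' = (cst 1 + (fun x : X => x 0 a)) * (cst 1 + (fun x : X => x 0 a)) * pd a g.
      by apply/funext => x; rewrite /g' !fctE expr2.
    by apply: CinftyM; [exact: CinftyM|exact: Cinfty_pd].
  have fg' := saturated_pair_pd sf sg sL fL fg.
  exists (square_descent a L g'); first by move=> k; apply; exists L, g'.
  move=> x xa0; apply/is_derive_subst; set t := x 0 a.
  have [tgt|tlt] : 0 < t \/ t < 0 by apply/orP; rewrite orbC -neq_lt.
    rewrite square_descent_pos ?ltW // -/t.
    have s0 : 0 < Num.sqrt t by rewrite sqrtr_gt0.
    have := is_derive_pd a (subst x a (Num.sqrt t)) sf => /is_derive_subst.
    rewrite subst_eq; under eq_fun do rewrite substK.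
    move=> df; have := @is_derive1_comp _ _ Num.sqrt t _ _ df (is_derive1_sqrt tgt).
    rewrite fL subst_eq mulrAC divff ?mul1r; last by rewrite mulf_neq0 // gt_eqF.
    apply: near_eq_is_derive; have : \forall s \near t, 0 < s by exact: lt_nbhsr.
    by apply: filterS => s sgt; rewrite square_descent_pos subst_eq ?ltW // substK.
  rewrite (square_descent_neg (Cinfty_continuous sL) (Cinfty_continuous sg') fg') ?ltW //.
  rewrite -/t; pose q (s : R) := s * (1 - s)^-1.
  have t1 : 0 < 1 - t by rewrite subr_gt0 (lt_trans tlt).
  have dq : is_derive t 1 q ((1 - t) ^- 2).
    have d1 : is_derive t 1 (fun s : R => 1 - s) (-1).
      by rewrite -[X in is_derive _ _ _ X]sub0r; apply: is_deriveB.
    have dV := @is_deriveV _ (fun s : R => 1 - s) t (-1) 1 (lt0r_neq0 t1) d1.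
    apply: is_derive_eq (@is_deriveM _ _ id _ t 1 _ _ (is_derive_id _ _) dV) _.
    rewrite -[_ *: (_ *: _)]/(_ * (_ * _)) -[_^-1 *: _]/(_ * _).
    by field; rewrite gt_eqF.
  have := is_derive_pd a (subst x a (q t)) sg => /is_derive_subst.
  rewrite subst_eq; under eq_fun do rewrite substK.
  move=> dg; have := @is_derive1_comp _ _ q t _ _ dg dq.
  rewrite /g' subst_eq -/(q t).
  have -> : 1 + q t = (1 - t)^-1 by rewrite /q; field; rewrite gt_eqF.
  rewrite exprVn [pd a g _ * _]mulrC.
  apply: near_eq_is_derive; have : \forall s \near t, s < 0 by exact: lt_nbhsl.
  apply: filterS => s slt.
  by rewrite (square_descent_neg cf cg fg) subst_eq ?ltW // substK.
exists (square_descent a (pd b f) (pd b g)).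
  move=> k; apply; exists (pd b f), (pd b g).
  split; [exact: Cinfty_pd|exact: Cinfty_pd|exact: even_in_pd|split => //].
  exact: saturated_pair_other.
move=> x _; apply/is_derive_subst.
have dF F v : Cinfty F -> is_derive (x 0 b) 1 (fun t => F (subst (subst x a v) b t))
    (pd b F (subst x a v)).
  move=> sF; have := is_derive_pd b (subst x a v) sF => /is_derive_subst.
  by rewrite subst_neq.
have E t : square_descent a f g (subst x b t) =
  f (subst (subst x a (Num.sqrt (x 0 a))) b t) +
  (g (subst (subst x a (Num.min (x 0 a) 0 / (1 - Num.min (x 0 a) 0))) b t) -
   g (subst (subst x a 0) b t)).
  by rewrite /square_descent subst_neq 1?eq_sym // !(substC _ _ _ ba).
rewrite (funext E); apply: is_deriveD; first exact: dF.
by apply: is_deriveB; exact: dF.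
Qed.

(* Seeley's extension theorem gives Whitney's theorem on even functions: [f]
   is a smooth function of [x_a ^ 2], defined also for negative values of that
   variable. *)
Lemma even_extension a f : Cinfty f -> even_in a f ->
  exists F, [/\ Cinfty F, forall x, F (subst x a (x 0 a ^+ 2)) = f x &
    forall b, b != a -> even_in b f -> even_in b F].
Proof.
move=> sf ef; have [c [cs cm]] := @extension_coefficients R.
pose g := seeley c a 0 f; have sg : Cinfty g by exact: Cinfty_seeley.
have fg : saturated_pair a f g by move=> x xa; rewrite /g seeley_pos // ltW.
exists (square_descent a f g); split.
- exact: Cinfty_square_descent.
- move=> x; rewrite square_descent_pos subst_eq ?sqr_ge0 // substK sqrtr_sqr.
  by have [_|_] := ger0P (x 0 a); rewrite ?subst_id // ef.
- move=> b ba eb x.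
  have E (F : X -> R) v : even_in b F ->
      F (subst (subst x b (- x 0 b)) a v) = F (subst x a v).
    move=> eF; rewrite (substC _ _ _ ba) -[in RHS](eF (subst x a v)).
    by rewrite subst_neq.
  have eg : even_in b g.
    move=> y; rewrite /g /seeley subst_neq 1?eq_sym //.
    have Ey (F : X -> R) v : even_in b F ->
        F (subst (subst y b (- y 0 b)) a v) = F (subst y a v).
      move=> eF; rewrite (substC _ _ _ ba) -[in RHS](eF (subst y a v)).
      by rewrite subst_neq.
    rewrite !Ey //; congr (_ + limn (series _)); apply/funext => k.
    by rewrite Ey.
  by rewrite /square_descent subst_neq 1?eq_sym // !E.
Qed.

End EvenExtension.

(** * Flat functions *)

Section Flatness.
Context {R : realType} {m : nat}.
Local Notation X := 'rV[R]_m.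
Implicit Types (x : X) (a b : 'I_m) (f g h e F G w : X -> R).

(* Optimising [tau] trades half of the order of vanishing for the error term
   linear in [tau]. *)
Lemma power_balance (A K C D : R) N : 0 <= A -> 0 <= K -> 0 <= C ->
  exists2 C', 0 <= C' & forall u d, 0 <= d <= D ->
    (forall t, 0 < t <= 1 -> u <= A * (d + K * t) ^+ (2 * N.+1) / t + C * t) ->
    u <= C' * d ^+ N.+1.
Proof.
move=> A0 K0 C0; pose D1 := Num.max D 1.
have D10 : 0 < D1 by rewrite lt_max ltr01 orbT.
have D1ge1 : 1 <= D1 by rewrite le_max lexx orbT.
have K1 : 0 <= 1 + K by rewrite addr_ge0.
exists (A * (1 + K) ^+ (2 * N.+1) * D1 ^+ N.+1 + C).
  by rewrite addr_ge0 // !mulr_ge0 // exprn_ge0 // ltW.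
move=> u d /andP[d0 dD] H; have [d0'|dn0] := eqVneq d 0.
  rewrite d0' expr0n mulr0; apply/ler_addgt0Pl => e e0; rewrite addr0.
  pose B := A * K ^+ (2 * N.+1) + C; have B0 : 0 <= B.
    by rewrite addr_ge0 // mulr_ge0 // exprn_ge0.
  pose t := Num.min 1 (e / (B + 1)).
  have B1 : 0 < B + 1 by rewrite ltr_wpDl.
  have t0 : 0 < t by rewrite lt_min ltr01 divr_gt0.
  have t1 : t <= 1 by rewrite ge_min lexx.
  have := H t; rewrite t0 t1 => /(_ isT) /le_trans; apply.
  rewrite d0' add0r exprMn.
  have tt : t ^+ (2 * N.+1) / t <= t.
    rewrite mulSn addSn exprSr mulfK ?gt_eqF // addnC addSn exprS.
    by rewrite ler_piMr ?(ltW t0) // exprn_ile1 // ltW.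
  apply: le_trans (_ : B * t <= _).
    rewrite mulrDl lerD2r -!mulrA; apply: ler_wpM2l => //.
    by apply: ler_wpM2l => //; rewrite exprn_ge0.
  apply: le_trans (_ : (B + 1) * t <= _); first by rewrite ler_wpM2r ?ltW // ltrDl.
  by rewrite mulrC -ler_pdivlMr // ge_min lexx orbT.
have dgt0 : 0 < d by rewrite lt_neqAle eq_sym dn0.
pose t := (d / D1) ^+ N.+1.
have dD1 : d / D1 <= 1 by rewrite ler_pdivrMr // mul1r le_max dD.
have t0 : 0 < t by rewrite exprn_gt0 // divr_gt0.
have t1 : t <= 1 by apply: exprn_ile1 => //; rewrite divr_ge0 // ltW.
have td : t <= d.
  apply: le_trans (_ : d / D1 <= _).
    by rewrite /t exprS ler_piMr ?divr_ge0 ?(ltW D10) // exprn_ile1 // divr_ge0 // ltW.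
  by rewrite ler_pdivrMr // ler_peMr.
have := H t; rewrite t0 t1 => /(_ isT) /le_trans; apply.
rewrite mulrDl; apply: lerD.
  have dn : d ^+ N.+1 != 0 by rewrite expf_neq0.
  have Dn : D1 ^+ N.+1 != 0 by rewrite expf_neq0 // gt_eqF.
  have tE : t = d ^+ N.+1 / D1 ^+ N.+1 by rewrite /t expr_div_n.
  rewrite ler_pdivrMr // {2}tE.
  have -> : A * (1 + K) ^+ (2 * N.+1) * D1 ^+ N.+1 * d ^+ N.+1 * (d ^+ N.+1 / D1 ^+ N.+1) =
     A * ((1 + K) * d) ^+ (2 * N.+1).
    have dd : d ^+ (2 * N.+1) = d ^+ N.+1 * d ^+ N.+1 by rewrite mul2n -addnn exprD.
    rewrite exprMn dd; move: (d ^+ N.+1) (D1 ^+ N.+1) Dn => y z z0.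
    by move: (_ ^+ _) => k; field.
  apply: ler_wpM2l => //; apply: lerXn2r; rewrite ?nnegrE.
  - by rewrite addr_ge0 // mulr_ge0 // ltW.
  - by rewrite mulr_ge0.
  - by rewrite mulrDl mul1r lerD2l; apply: ler_wpM2l.
apply: ler_wpM2l => //; rewrite /t expr_div_n ler_pdivrMr ?exprn_gt0 //.
by rewrite ler_peMr ?exprn_ge0 // exprn_ege1.
Qed.

(** Infinite order of vanishing relative to a gauge [w], locally uniformly. The gauges in use are
    [orthant_dist], for which only continuity is shown, and the smooth [residual]. *)
Definition flat w f := forall N rho, exists2 C, 0 <= C &
  forall x, `|x| <= rho -> `|f x| <= C * w x ^+ N.

Lemma flatS w f : continuous f ->
  (forall N rho, exists2 C, 0 <= C &
    forall x, `|x| <= rho -> `|f x| <= C * w x ^+ N.+1) -> flat w f.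
Proof.
move=> cf H [|N] rho; last exact: H.
have [C C0 HC] := bounded_on_ball rho cf; exists C => // x xr.
by rewrite expr0 mulr1 HC.
Qed.

Lemma flat0 w f x : flat w f -> w x = 0 -> f x = 0.
Proof.
move=> fl wx; have [C _ /(_ x (lexx _))] := fl 1%N `|x|.
by rewrite wx expr0n mulr0 normr_le0 => /eqP.
Qed.

Lemma flatD w f g : (forall x, 0 <= w x) -> flat w f -> flat w g -> flat w (f + g).
Proof.
move=> w0 ff fg N rho; have [C C0 HC] := ff N rho; have [D D0 HD] := fg N rho.
exists (C + D); first by rewrite addr_ge0.
move=> x xr; apply: le_trans (ler_normD _ _) _; rewrite mulrDl.
by apply: lerD; [exact: HC|exact: HD].
Qed.

Lemma flatM w f g : (forall x, 0 <= w x) -> continuous g -> flat w f -> flat w (g * f).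
Proof.
move=> w0 cg ff N rho; have [C C0 HC] := ff N rho.
have [D D0 HD] := bounded_on_ball rho cg.
exists (D * C); first by rewrite mulr_ge0.
move=> x xr; rewrite !fctE normrM -mulrA; apply: ler_pM => //.
  exact: HD.
exact: HC.
Qed.

Lemma flat_subst w f h a : (forall x, 0 <= w x) -> continuous h ->
  (forall x, w (subst x a (h x)) <= w x) -> flat w f ->
  flat w (fun x => f (subst x a (h x))).
Proof.
move=> w0 ch wh ff N rho; have [B B0 HB] := bounded_on_ball rho ch.
have [C C0 HC] := ff N (Num.max rho B); exists C => // x xr.
apply: le_trans (HC _ _) _.
  by apply: norm_subst; rewrite le_max ?xr // HB ?orbT.
by apply: ler_wpM2l => //; apply: lerXn2r; rewrite ?nnegrE.
Qed.

Lemma lipschitz_line f a rho : Cinfty f -> exists2 K, 0 <= K &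
  forall x t, `|x| <= rho -> `|t| <= 1 ->
    `|f (subst x a (x 0 a + t)) - f x| <= K * `|t|.
Proof.
move=> sf; have [K K0 HK] := bounded_on_ball (rho + 1) (Cinfty_continuous (Cinfty_pd a sf)).
exists K => // x t xr t1.
have [s /andP[s0 s1]] := @mvt_subst _ _ f (pd a f) x a (x 0 a) (x 0 a + t)
  (Cinfty_continuous sf) (fun s _ => is_derive_pd a _ sf).
rewrite subst_id => ->; rewrite [x 0 a + t - _]addrAC subrr add0r normrM.
apply: ler_wpM2r => //; apply: HK; apply: norm_subst.
  by apply: le_trans xr _; rewrite lerDl.
apply: le_trans (ler_normD _ _) _; apply: lerD.
  by apply: le_trans (coord_le_norm _ _) xr.
by rewrite normrM (ger0_norm (ltW s0)) mulr_ile1 // ltW.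
Qed.

Lemma norm_shift x a t rho : `|x| <= rho -> `|t| <= 1 ->
  `|subst x a (x 0 a + t)| <= rho + 1.
Proof.
move=> xr t1; apply: norm_subst; first by apply: le_trans xr _; rewrite lerDl.
apply: le_trans (ler_normD _ _) _; apply: lerD => //.
by apply: le_trans (coord_le_norm _ _) xr.
Qed.

(** The derivative is a difference quotient of step t up to O(t). As [w] changes by at most K t,
    that quotient is O((w + K t)^(2N+2) / t), and [power_balance] chooses t. *)
Lemma flat_pd w e b : (forall x, 0 <= w x) -> Cinfty w -> Cinfty e ->
  flat w e -> flat w (pd b e).
Proof.
move=> w0 sw se fe; apply: flatS; first by apply: Cinfty_continuous; exact: Cinfty_pd.
move=> N rho; have [K K0 HK] := lipschitz_line b rho sw.
have [C C0 HC] := lipschitz_line b rho (Cinfty_pd b se).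
have [A A0 HA] := fe (2 * N.+1)%N (rho + 1).
have [D D0 HD] := bounded_on_ball rho (Cinfty_continuous sw).
have A2 : 0 <= A + A by rewrite addr_ge0.
have [C' C'0 HC'] := power_balance D N A2 K0 C0.
exists C' => // x xr; apply: HC'.
  by rewrite w0 /= -[leLHS]ger0_norm // HD.
move=> t /andP[t0 t1]; have tn : `|t| <= 1 by rewrite ger0_norm // ltW.
have [s /andP[s0 s1] Hs] := @mvt_subst _ _ e (pd b e) x b (x 0 b) (x 0 b + t)
  (Cinfty_continuous se) (fun s _ => is_derive_pd b _ se).
rewrite subst_id [X in _ * X]addrAC subrr add0r in Hs.
rewrite [x 0 b + t - _]addrAC subrr add0r in Hs.
have st : `|s * t| <= t.
  by rewrite ger0_norm ?mulr_ge0 ?(ltW s0) ?(ltW t0) // ler_piMl ?(ltW s1) ?(ltW t0).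
have st1 : `|s * t| <= 1 by apply: le_trans st t1.
have dist := HC x (s * t) xr st1.
set z := subst x b (x 0 b + s * t) in Hs dist.
set y := subst x b (x 0 b + t) in Hs.
have yr : `|y| <= rho + 1 by exact: norm_shift.
have xr1 : `|x| <= rho + 1 by apply: le_trans xr _; rewrite lerDl.
have wy : w y <= w x + K * t.
  have := HK x t xr tn; rewrite -/y (ger0_norm (ltW t0)) => /(le_trans (ler_norm _)).
  by rewrite lerBlDl.
have ez : `|pd b e z| <= (A + A) * (w x + K * t) ^+ (2 * N.+1) / t.
  rewrite ler_pdivlMr // -[X in _ * X](ger0_norm (ltW t0)) -normrM -Hs mulrDl.
  apply: le_trans (ler_normB _ _) _; apply: lerD.
    apply: le_trans (HA _ yr) _; apply: ler_wpM2l => //.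
    by apply: lerXn2r => //; rewrite nnegrE (le_trans (w0 y)).
  apply: le_trans (HA _ xr1) _; apply: ler_wpM2l => //.
  have wK : w x <= w x + K * t by rewrite lerDl mulr_ge0 // ltW.
  by apply: lerXn2r => //; rewrite nnegrE (le_trans (w0 x)).
rewrite -[pd b e x](subKr (pd b e z)).
apply: le_trans (ler_normB _ _) _; apply: lerD => //.
by apply: le_trans dist _; apply: ler_wpM2l.
Qed.

(* Moving [x_a] by at most [t] makes the divisor at least [t / 4]. *)
Lemma flat_div w h g a : (forall x, 0 <= w x) -> continuous w ->
  (forall x v, h (subst x a v) = h x) ->
  (forall x t, 0 <= t -> w (subst x a (x 0 a + t)) <= w x) ->
  Cinfty g -> flat w (fun x => (x 0 a - h x) * g x) -> flat w g.
Proof.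
move=> w0 cw ha wa sg fg; apply: flatS; first exact: Cinfty_continuous.
move=> N rho; have [C C0 HC] := lipschitz_line a rho sg.
have [A A0 HA] := fg (2 * N.+1)%N (rho + 1).
have [D D0 HD] := bounded_on_ball rho cw.
have A4 : 0 <= 4 * A by rewrite mulr_ge0.
have [C' C'0 HC'] := power_balance D N A4 (lexx 0) C0.
exists C' => // x xr; apply: HC'.
  by rewrite w0 /= -[leLHS]ger0_norm // HD.
move=> t /andP[t0 t1]; rewrite mul0r addr0.
have [s /andP[s0 st] ys] : exists2 s, 0 < s <= t & t / 4 <= `|x 0 a - h x + s|.
  have [yt|yt] := lerP (t / 4) `|x 0 a - h x + t|; first by exists t; rewrite ?t0 ?lexx.
  exists (t / 2); first by apply/andP; split; lra.
  move: yt; rewrite ltr_norml => /andP[y1 y2].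
  by rewrite ler0_norm; lra.
have sn : `|s| <= 1 by rewrite ger0_norm ?(le_trans st) // ltW.
have yr : `|subst x a (x 0 a + s)| <= rho + 1 by exact: norm_shift.
have := HC x s xr sn; set y := subst x a (x 0 a + s) in yr * => dist.
have gy : `|g y| <= 4 * A * w x ^+ (2 * N.+1) / t.
  have := HA y yr; rewrite {1}/y subst_eq ha normrM addrAC => gy.
  have {}gy : t / 4 * `|g y| <= A * w x ^+ (2 * N.+1).
    apply: le_trans (_ : `|x 0 a - h x + s| * `|g y| <= _); first exact: ler_wpM2r.
    apply: le_trans gy _; apply: ler_wpM2l => //; apply: lerXn2r; rewrite ?nnegrE //.
    by apply: wa; exact: ltW.
  rewrite ler_pdivlMr // -mulrA -ler_pdivrMl //; apply: le_trans gy.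
  by rewrite le_eqVlt; apply/orP; left; apply/eqP; field.
rewrite -[g x](subKr (g y)).
apply: le_trans (ler_normB _ _) _; apply: lerD => //.
apply: le_trans dist _; apply: ler_wpM2l => //.
by rewrite ger0_norm // ltW.
Qed.

Lemma flat_quotient_bound w e n N rho : (forall x, 0 <= w x) -> flat w e ->
  exists2 C, 0 <= C & forall x, `|x| <= rho -> `|e x / w x ^+ n| <= C * w x ^+ N.
Proof.
move=> w0 fe; have [C C0 HC] := fe (N + n)%N rho; exists C => // x xr.
have [wx|wx] := eqVneq (w x) 0.
  by rewrite (flat0 fe wx) mul0r normr0 mulr_ge0 // exprn_ge0.
have wn : 0 < w x ^+ n by rewrite exprn_gt0 // lt_neqAle eq_sym wx w0.
by rewrite normf_div (ger0_norm (ltW wn)) ler_pdivrMr // -mulrA -exprD HC.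
Qed.

(** Quotients of flat functions by powers of [w] are stable under derivatives up to smooth
    combinations. Where w = 0 the inverse is 0 by convention, and flatness makes 0 the right
    value. *)
Lemma Cinfty_flat_quotient w e n : (forall x, 0 <= w x) -> Cinfty w ->
  Cinfty e -> flat w e -> Cinfty (fun x => e x / w x ^+ n).
Proof.
move=> w0 sw se fe; have cw := Cinfty_continuous sw.
apply: (@Cinfty_upto _ _ (fun F => exists e n,
   [/\ Cinfty e, flat w e & F = fun x => e x / w x ^+ n])); last by exists e, n.
move=> _ [{}e [{}n [{}se {}fe ->]]].
have ce := Cinfty_continuous se; split.
  move=> x; have [wx|wx] := eqVneq (w x) 0.
    apply: ball_continuous => eps eps0.
    have [C C0 HC] := @flat_quotient_bound w e n 1 (`|x| + 1) w0 fe.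
    have C1 : 0 < C + 1 by rewrite ltr_wpDl.
    have [r r0 Hr] := continuous_ball (cw x) (divr_gt0 eps0 C1).
    exists (Num.min r 1); first by rewrite lt_min r0 ltr01.
    move=> y; rewrite lt_min => /andP[yr y1].
    rewrite (flat0 fe wx) mul0r subr0; apply: le_trans (HC y _) _.
      rewrite -[y](subrK x) addrC; apply: le_trans (ler_normD _ _) _.
      by rewrite lerD2l ltW.
    have := Hr y yr; rewrite wx subr0 ger0_norm // expr1 => wy.
    apply: le_trans (_ : (C + 1) * w y <= _).
      by apply: ler_wpM2r; [exact: w0|rewrite lerDl].
    by rewrite mulrC -ler_pdivlMr.
  apply: (@continuousM _ _ e); first exact: ce.
  apply: (@continuousV _ _ (fun x => w x ^+ n)); first by rewrite expf_neq0.
  by apply: (@continuous_comp _ _ _ w (fun t => t ^+ n)); [exact: cw|exact: exprn_continuous].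
move=> b; exists ((fun x => pd b e x / w x ^+ n) +
    cst (- n%:R) * (fun x => (pd b w * e) x / w x ^+ n.+1)).
  move=> k PC; apply: CkD; first apply: PC.
    by exists (pd b e), n; split; [exact: Cinfty_pd|exact: flat_pd|].
  apply: CkM; first exact: Ck_cst.
  apply: PC; exists (pd b w * e), n.+1; split => //.
    by apply: CinftyM => //; exact: Cinfty_pd.
  by apply: flatM => //; apply: Cinfty_continuous; exact: Cinfty_pd.
move=> x; apply/is_derive_subst; have [wx|wx] := eqVneq (w x) 0.
  rewrite !fctE (flat0 fe wx) (flat0 (flat_pd b w0 sw se fe) wx) mulr0 !mul0r mulr0 addr0.
  apply: ball_is_derive => eps eps0.
  have [K K0 HK] := lipschitz_line b `|x| sw.
  (* Order 2 suffices: near a zero of [w] one has w = O(t) along the line, so the quotient is O(t^2)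
     and has derivative 0. *)
  have [C C0 HC] := @flat_quotient_bound w e n 2 (`|x| + 1) w0 fe.
  pose D := C * K ^+ 2 + 1; have D0 : 0 < D by rewrite ltr_wpDl // mulr_ge0 // exprn_ge0.
  exists (Num.min 1 (eps / D)); first by rewrite lt_min ltr01 divr_gt0.
  move=> t _; rewrite lt_min => /andP[/ltW t1 tD].
  rewrite subst_id (flat0 fe wx) mul0r mulr0 !subr0.
  apply: le_trans (HC _ (norm_shift b (lexx _) t1)) _.
  have := HK x t (lexx _) t1; rewrite wx subr0 ger0_norm // => wt.
  apply: le_trans (_ : C * (K * `|t|) ^+ 2 <= _).
    by apply: ler_wpM2l => //; apply: lerXn2r; rewrite ?nnegrE // mulr_ge0.
  rewrite exprMn [`|t| ^+ 2]expr2 !mulrA; apply: ler_wpM2r => //.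
  apply: le_trans (_ : D * `|t| <= _).
    by apply: ler_wpM2r => //; rewrite /D expr2 mulrA lerDl.
  by rewrite mulrC -ler_pdivlMr // ltW.
have /is_derive_subst de := is_derive_pd b x se.
have /is_derive_subst dw := is_derive_pd b x sw.
have dn : is_derive (x 0 b) 1 (fun t => w (subst x b t) ^+ n)
    (n%:R * w x ^+ n.-1 * pd b w x).
  apply: (@is_derive1_comp _ (fun u : R => u ^+ n) _ _ _ _ _ dw).
  rewrite subst_id; apply: DeriveDef; first exact: exprn_derivable.
  by rewrite exp_derive [LHS]mulr1.
have wxn : w (subst x b (x 0 b)) ^+ n != 0 by rewrite subst_id expf_neq0.
have dV := @is_deriveV _ (fun t => w (subst x b t) ^+ n) (x 0 b) _ 1 wxn dn.
apply: is_derive_eq (is_deriveM de dV) _.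
rewrite !fctE subst_id.
rewrite -[_ *: (_ *: _)]/(_ * (_ * _)) -[_ *: pd b e x]/(_ * _).
case: (n) => [|k]; first by rewrite !expr0; field.
by rewrite /= !exprS; field; rewrite wx expf_neq0.
Qed.

End Flatness.

(** * The Koszul complex *)

Section ExteriorAlgebra.
Context {S : comPzRingType} {l : nat}.
Local Notation V := {ffun {set 'I_l} -> S}.
Implicit Types (x y z : 'I_l -> S) (u v w : V) (i j : 'I_l) (T : {set 'I_l}).

Definition scalef (s : S) w : V := [ffun T => s * w T].

Definition exterior i w : V :=
  [ffun T : {set 'I_l} => if i \in T then
     (-1) ^+ #|[set j in T | (j < i)%N]| * w (T :\ i) else 0].

Definition wedge z w : V := [ffun T => \sum_i z i * exterior i w T].

Local Notation contraction := Defs.contraction.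
Local Notation before T i := #|[set j in T | (j < i)%N]|.

Lemma before_setU1 T i j : j \notin T -> before (j |: T) i = (before T i + (j < i))%N.
Proof.
move=> jT; case: (ltnP j i) => ji.
  rewrite (_ : [set k in j |: T | _] = j |: [set k in T | (k < i)%N]).
    by rewrite cardsU1 inE (negbTE jT) addnC.
  by apply/setP => k; rewrite !inE; case: eqVneq => // ->; rewrite ji.
rewrite addn0; congr #|pred_of_set _|; apply/setP => k; rewrite !inE.
by case: eqVneq => [->|//]; rewrite ltnNge ji !andbF.
Qed.

Lemma signMsign n : (-1) ^+ n * (-1) ^+ n = 1 :> S.
Proof. by rewrite -exprMn mulrNN mulr1 expr1n. Qed.

(** The canonical anticommutation relation. For i != j the two composites have opposite signs
    because exactly one of i < j and j < i holds. *)
Lemma contraction_exterior i j w :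
  contraction j (exterior i w) + exterior i (contraction j w) =
  if i == j then w else 0.
Proof.
apply/ffunP => T; rewrite !ffunE; have [<-|ij] := eqVneq i j.
  have [iT|iT] := boolP (i \in T).
    rewrite add0r !inE eqxx /= finset.setD1K //.
    rewrite (_ : [set j0 in T :\ i | _] = [set j0 in T | (j0 < i)%N]).
      by rewrite mulrA signMsign mul1r.
    by apply/setP => k; rewrite !inE; case: eqVneq => // ->; rewrite ltnn !andbF.
  rewrite addr0 finset.setU11 before_setU1 // ltnn addn0 mulrA signMsign mul1r.
  by rewrite finset.setU1K.
rewrite [RHS]ffunE; have [jT|jT] := boolP (j \in T).
  case: ifP => iT; last by rewrite addr0.
  by rewrite !inE jT eq_sym ij mulr0 addr0.
rewrite in_setU1 (negbTE ij) /=; case: ifPn => iT; last by rewrite mulr0 addr0.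
rewrite in_setD1 (negbTE jT) andbF.
rewrite before_setU1 // -{1}(finset.setD1K iT) before_setU1 ?finset.setD11 //.
have -> : (j |: T) :\ i = j |: (T :\ i).
  apply/setP => k; rewrite !inE; case: eqVneq => // ->.
  by rewrite (negbTE ij).
rewrite !exprD; set a := (-1) ^+ before T i; set b := (-1) ^+ _.
move: (w _) => c.
have [ltij|ltji|/val_inj e] := ltngtP i j; last by rewrite e eqxx in ij.
  by rewrite expr1 expr0; ring.
by rewrite expr1 expr0; ring.
Qed.

Lemma koszul_diffD x u v : koszul_diff x (u + v) = koszul_diff x u + koszul_diff x v.
Proof.
apply/ffunP => T; rewrite !ffunE -big_split; apply: eq_bigr => i _ /=.
by rewrite !ffunE; case: ifP; rewrite ?mulr0 ?addr0 // !mulrDr.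
Qed.

Lemma koszul_diff_scale x s u : koszul_diff x (scalef s u) = scalef s (koszul_diff x u).
Proof.
apply/ffunP => T; rewrite !ffunE mulr_sumr; apply: eq_bigr => i _ /=.
by rewrite !ffunE; case: ifP; rewrite ?mulr0 // => _; ring.
Qed.

Lemma koszul_diff0 x : koszul_diff x 0 = 0.
Proof.
apply/ffunP => T; rewrite !ffunE big1 // => i _; rewrite !ffunE.
by case: ifP; rewrite !mulr0.
Qed.

Lemma koszul_diffN x u : koszul_diff x (- u) = - koszul_diff x u.
Proof. by apply/eqP; rewrite -addr_eq0 -koszul_diffD addNr koszul_diff0. Qed.

Lemma koszul_diffB x u v : koszul_diff x (u - v) = koszul_diff x u - koszul_diff x v.
Proof. by rewrite koszul_diffD koszul_diffN. Qed.

Lemma koszul_diffDl x y u :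
  koszul_diff (fun i => x i + y i) u = koszul_diff x u + koszul_diff y u.
Proof.
apply/ffunP => T; rewrite !ffunE -big_split; apply: eq_bigr => i _ /=.
by rewrite mulrDl.
Qed.

(** Polarisation of [koszul_diff_diff]. *)
Lemma koszul_diff_anticomm x y u :
  koszul_diff x (koszul_diff y u) = - koszul_diff y (koszul_diff x u).
Proof.
have := koszul_diff_diff (fun i => x i + y i) u.
rewrite !koszul_diffDl !koszul_diffD !koszul_diff_diff add0r addr0.
by move/eqP; rewrite addr_eq0 => /eqP.
Qed.

Lemma wedge0 z : wedge z 0 = 0.
Proof.
apply/ffunP => T; rewrite !ffunE big1 // => i _; rewrite !ffunE.
by case: ifP; rewrite !mulr0.
Qed.

Lemma wedgeD z u v : wedge z (u + v) = wedge z u + wedge z v.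
Proof.
apply/ffunP => T; rewrite !ffunE -big_split; apply: eq_bigr => i _ /=.
by rewrite !ffunE; case: ifP; rewrite ?mulr0 ?addr0 // !mulrDr.
Qed.

(** Thus [wedge z] is a homotopy between 0 and multiplication by sum_i x_i z_i. It provides both the
    coordinate homotopies and the final division by the residual. *)
Lemma koszul_wedge x z w :
  koszul_diff x (wedge z w) = scalef (\sum_i x i * z i) w - wedge z (koszul_diff x w).
Proof.
apply/eqP; rewrite -subr_eq opprK; apply/eqP/ffunP => T.
have c_wedge j : contraction j (wedge z w) T = \sum_i z i * contraction j (exterior i w) T.
  rewrite ffunE; case: ifP => jT.
    by rewrite big1 // => i _; rewrite ffunE jT mulr0.
  rewrite ffunE mulr_sumr; apply: eq_bigr => i _.
  by rewrite [in RHS]ffunE jT mulrCA.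
have e_diff i : exterior i (koszul_diff x w) T = \sum_j x j * exterior i (contraction j w) T.
  rewrite ffunE; case: ifP => iT.
    rewrite ffunE mulr_sumr; apply: eq_bigr => j _.
    by rewrite [in RHS]ffunE iT mulrCA.
  by rewrite big1 // => j _; rewrite ffunE iT mulr0.
rewrite !ffunE.
under eq_bigr => j _ do rewrite c_wedge mulr_sumr.
under [X in _ + X]eq_bigr => i _ do rewrite e_diff mulr_sumr.
rewrite exchange_big /= -big_split /= mulr_suml; apply: eq_bigr => i _.
rewrite -big_split /= (bigD1 i) //= [X in _ + X]big1 ?addr0.
  have /ffunP /(_ T) := contraction_exterior i i w.
  rewrite eqxx ffunE => <-.
  by move: (contraction _ _ _) (exterior _ _ _) => A B; ring.
move=> j ji; have /ffunP /(_ T) := contraction_exterior i j w.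
rewrite eq_sym (negbTE ji) ffunE [RHS]ffunE => /eqP; rewrite addr_eq0 => /eqP ->.
by ring.
Qed.

Lemma wedge_deg k z w : koszul_deg k w -> koszul_deg k.+1 (wedge z w).
Proof.
move=> hw T; apply: contra_neq_eq => hT; rewrite ffunE big1 // => i _.
rewrite ffunE; case: ifPn => iT; last by rewrite mulr0.
have [->|/hw] := eqVneq (w (T :\ i)) 0; first by rewrite !mulr0.
by move=> c; move: hT; rewrite (cardsD1 i) iT c add1n eqxx.
Qed.

Lemma koszul_degD k u v : koszul_deg k u -> koszul_deg k v -> koszul_deg k (u + v).
Proof.
move=> hu hv T; rewrite ffunE; have [->|/hu//] := eqVneq (u T) 0.
by rewrite add0r => /hv.
Qed.

Lemma koszul_degN k u : koszul_deg k u -> koszul_deg k (- u).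
Proof. by move=> hu T; rewrite ffunE oppr_eq0 => /hu. Qed.

Definition degree_part (k : nat) w : V :=
  [ffun T : {set 'I_l} => if #|T| == k then w T else 0].

Lemma degree_part_deg k w : koszul_deg k (degree_part k w).
Proof. by move=> T; rewrite ffunE; case: (_ =P k); rewrite ?eqxx. Qed.

(** The differential lowers degrees by exactly one, so only the part of degree k+1 of [v] can
    contribute. Primitives may therefore be built without regard to degree. *)
Lemma koszul_diff_degree_part x k v w : koszul_deg k w -> koszul_diff x v = w ->
  koszul_diff x (degree_part k.+1 v) = w.
Proof.
move=> hw xv; apply/ffunP => T; rewrite ffunE.
have [Tk|Tk] := eqVneq #|T| k.
  rewrite -xv ffunE; apply: eq_bigr => i _; rewrite !ffunE; case: ifPn => // iT.
  by rewrite cardsU1 iT add1n Tk eqxx.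
rewrite big1 => [|i _].
  by apply/esym; apply: contra_neq_eq Tk => /hw.
rewrite !ffunE; case: ifPn => iT; first by rewrite mulr0.
by rewrite cardsU1 iT add1n eqSS (negbTE Tk) !mulr0.
Qed.

Lemma contraction_eq0 w : (forall i, contraction i w = 0) ->
  forall T, T != finset.set0 -> w T = 0.
Proof.
move=> hw T /finset.set0Pn[i iT]; have /ffunP /(_ (T :\ i)) := hw i.
rewrite !ffunE finset.setD11 finset.setD1K //.
move/(congr1 (fun s => (-1) ^+ #|[set j in T :\ i | (j < i)%N]| * s)).
by rewrite mulrA signMsign mul1r mulr0.
Qed.

End ExteriorAlgebra.

Section KoszulMorphism.
Context {S S' : comPzRingType} {l : nat} (f : S -> S').
Hypothesis fD : {morph f : u v / u + v}.

Definition map_ext (w : {ffun {set 'I_l} -> S}) : {ffun {set 'I_l} -> S'} :=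
  [ffun T => f (w T)].

Let f0 : f 0 = 0.
Proof. by apply: (addrI (f 0)); rewrite -fD !addr0. Qed.

Let fN u : f (- u) = - f u.
Proof. by apply/eqP; rewrite -addr_eq0 -fD addNr f0. Qed.

(** Multiplicativity is asked only against the x_i, so that real and imaginary parts qualify as
    [f]. *)
Lemma map_koszul_diff x x' w : (forall i u, f (x i * u) = x' i * f u) ->
  map_ext (koszul_diff x w) = koszul_diff x' (map_ext w).
Proof.
move=> fx; apply/ffunP => T; rewrite !ffunE (big_morph f fD f0).
apply: eq_bigr => i _; rewrite fx !ffunE; case: ifP => _; first by rewrite f0.
congr (_ * _); elim: #|_| => [|n IH]; first by rewrite !expr0 !mul1r.
by rewrite !exprS !mulN1r !mulNr fN IH.
Qed.

End KoszulMorphism.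

Section KoszulClosure.
Context {R : realType} {m l : nat}.
Local Notation X := 'rV[R]_m.
Local Notation V := {ffun {set 'I_l} -> (X -> R)}.
Implicit Types (x z : 'I_l -> X -> R) (w : V).

Lemma Cinfty_sign n : Cinfty ((-1) ^+ n : X -> R).
Proof.
elim: n => [|n IH]; first exact: (Cinfty_cst 1).
by rewrite exprS; apply: CinftyM => //; exact: (Cinfty_cst (-1)).
Qed.

Variable P : (X -> R) -> Prop.
Hypotheses (P0 : P 0) (PD : forall f g, P f -> P g -> P (f + g))
  (PM : forall f g, Cinfty g -> P f -> P (g * f)).

(** Applied with [P] the smooth functions and with [P] the flat ones. *)
Lemma closed_koszul_diff x w : (forall i, Cinfty (x i)) -> (forall T, P (w T)) ->
  forall T, P (koszul_diff x w T).
Proof.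
move=> sx Pw T; rewrite ffunE; elim/big_rec: _ => // i f _ Pf; apply: PD => //.
apply: PM => //; rewrite ffunE; case: ifP => // _.
by apply: PM => //; exact: Cinfty_sign.
Qed.

Lemma closed_wedge z w : (forall i, Cinfty (z i)) -> (forall T, P (w T)) ->
  forall T, P (wedge z w T).
Proof.
move=> sz Pw T; rewrite ffunE; elim/big_rec: _ => // i f _ Pf; apply: PD => //.
apply: PM => //; rewrite ffunE; case: ifP => // _.
by apply: PM => //; exact: Cinfty_sign.
Qed.

End KoszulClosure.

(** * Koszul homotopies for shifted coordinates *)

Section CoordinateKoszul.
Context {R : realType} {m l : nat}.
Local Notation X := 'rV[R]_m.
Local Notation V := {ffun {set 'I_l} -> (X -> R)}.

Variables (a : 'I_l -> 'I_m) (h : 'I_l -> X -> R) (alpha beta : 'M[R]_l).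
Hypotheses (a_inj : injective a) (sh : forall i, Cinfty (h i))
  (h_indep : forall i j x v, h i (subst x (a j) v) = h i x)
  (beta_alpha : beta *m alpha = 1%:M).

Definition shear i : X -> R := fun x => x 0 (a i) - h i x.
(** [mixed_shear] is the combination of the columns of [alpha] with coefficients y_i, and the rows
    of [beta] are the dual basis. Using both bases avoids transporting the exterior algebra along
    [alpha]. *)
Definition col_fun i : 'I_l -> X -> R := fun k => cst (alpha k i).
Definition row_fun i : 'I_l -> X -> R := fun k => cst (beta i k).
Definition mixed_shear : 'I_l -> X -> R := fun k => \sum_i col_fun i k * shear i.

Local Notation y := shear.
Local Notation J := mixed_shear.

Definition smoothV (w : V) := forall T, Cinfty (w T).

Definition specialize i (f : X -> R) : X -> R := fun x => f (subst x (a i) (h i x)).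

Lemma Cinfty_shear i : Cinfty (y i).
Proof. by apply: CinftyB => //; exact: Cinfty_coord. Qed.

Lemma Cinfty_mixed_shear k : Cinfty (J k).
Proof.
apply: Cinfty_sum => i _; apply: CinftyM; first exact: Cinfty_cst.
exact: Cinfty_shear.
Qed.

Lemma smooth_koszul x w : (forall i, Cinfty (x i)) -> smoothV w -> smoothV (koszul_diff x w).
Proof.
apply: closed_koszul_diff; first exact: (Cinfty_cst 0).
  by move=> f g sf sg; exact: CinftyD.
by move=> f g sg sf; exact: CinftyM.
Qed.

Lemma smooth_wedge z w : (forall i, Cinfty (z i)) -> smoothV w -> smoothV (wedge z w).
Proof.
apply: closed_wedge; first exact: (Cinfty_cst 0).
  by move=> f g sf sg; exact: CinftyD.
by move=> f g sg sf; exact: CinftyM.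
Qed.

Lemma smoothVD v w : smoothV v -> smoothV w -> smoothV (v + w).
Proof. by move=> sv sw T; rewrite ffunE; exact: CinftyD. Qed.

Lemma smoothVB v w : smoothV v -> smoothV w -> smoothV (v - w).
Proof. by move=> sv sw T; rewrite !ffunE; exact: CinftyB. Qed.

Lemma smooth_specialize i w : smoothV w -> smoothV (map_ext (specialize i) w).
Proof. by move=> sw T; rewrite ffunE; exact: Cinfty_subst. Qed.

Lemma col_row i j : \sum_k col_fun j k * row_fun i k = cst (i == j)%:R.
Proof.
apply/funext => x; rewrite fct_sumE; have /matrixP /(_ i j) := beta_alpha.
by rewrite !mxE => <-; apply: eq_bigr => k _; rewrite mulrC.
Qed.

Lemma mixed_shear_row i : \sum_k J k * row_fun i k = y i.
Proof.
under eq_bigr => k _ do rewrite mulr_suml.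
rewrite exchange_big /= (bigD1 i) //= [X in _ + X]big1 ?addr0.
  under eq_bigr => k _ do rewrite mulrAC.
  by rewrite -mulr_suml col_row eqxx mul1r.
move=> j ji; under eq_bigr => k _ do rewrite mulrAC.
by rewrite -mulr_suml col_row eq_sym (negbTE ji) mul0r.
Qed.

(** The ring has zero divisors, but y_i vanishes only on a graph, whose complement is dense. *)
Lemma shear_cancel i (f g : X -> R) : continuous f -> continuous g ->
  y i * f = y i * g -> f = g.
Proof.
move=> cf cg fg; apply/funext => x.
have E z : y i z != 0 -> f z = g z.
  by move=> yz; apply: (mulfI yz); have := congr1 (fun F => F z) fg.
have [yx|] := eqVneq (y i x) 0; last exact: E.
have cB : continuous (f - g) by move=> z; apply: continuousB; [exact: cf|exact: cg].
apply/eqP; rewrite -subr_eq0 -[_ - _]/((f - g) x) -normr_le0.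
apply/ler_addgt0Pl => e e0; rewrite addr0.
have [r r0 H] := continuous_ball (cB x) e0.
have r2 : 0 < r / 2 by rewrite divr_gt0.
pose z := subst x (a i) (x 0 (a i) + r / 2).
have yz : y i z = r / 2.
  by rewrite /shear /z subst_eq h_indep addrAC -/(y i x) yx add0r.
have <- : `|(f - g) z - (f - g) x| = `|(f - g) x|.
  have -> : (f - g) z = 0.
    by rewrite -[LHS]/(f z - g z) E ?subrr // yz gt_eqF.
  by rewrite sub0r normrN.
apply: H; apply: le_lt_trans (dist_subst _ _ _) _.
by rewrite addrAC subrr add0r gtr0_norm // ltr_pdivrMr // ltr_pMr // ltr1n.
Qed.

Lemma shear_cancelV i (v w : V) : smoothV v -> smoothV w ->
  scalef (y i) v = scalef (y i) w -> v = w.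
Proof.
move=> sv sw /ffunP vw; apply/ffunP => T; apply: (@shear_cancel i).
- exact: Cinfty_continuous.
- exact: Cinfty_continuous.
- by have := vw T; rewrite !ffunE.
Qed.

Lemma specialize_mixed_shear i k : specialize i (J k) = J k - col_fun i k * y i.
Proof.
have -> : specialize i (J k) = \sum_j col_fun j k * specialize i (y j).
  by apply/funext => x; rewrite /specialize /mixed_shear !fct_sumE; apply: eq_bigr.
rewrite /mixed_shear (bigD1 i) //= [in RHS](bigD1 i) //= addrAC subrr add0r.
have -> : specialize i (y i) = 0.
  by apply/funext => x; rewrite /specialize /shear subst_eq h_indep subrr.
rewrite mulr0 add0r; apply: eq_bigr => j ji; congr (_ * _).
apply/funext => x; rewrite /specialize /shear h_indep subst_neq //.
by apply: contra_neq ji => /a_inj.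
Qed.

Lemma koszul_diff_scalel (s : X -> R) x (w : V) :
  koszul_diff (fun k => s * x k) w = scalef s (koszul_diff x w).
Proof.
apply/ffunP => T; rewrite !ffunE mulr_sumr; apply: eq_bigr => i _.
by rewrite mulrA.
Qed.

Lemma specialize_koszul i w : map_ext (specialize i) (koszul_diff J w) =
  koszul_diff J (map_ext (specialize i) w) -
  scalef (y i) (koszul_diff (col_fun i) (map_ext (specialize i) w)).
Proof.
rewrite (@map_koszul_diff _ _ _ (specialize i) (fun _ _ => erefl) J
  (specialize i \o J) w (fun _ _ => erefl)).
rewrite -koszul_diff_scalel; apply/eqP; rewrite -subr_eq opprK; apply/eqP.
rewrite -koszul_diffDl; congr (koszul_diff _ _); apply/funext => k /=.
by rewrite specialize_mixed_shear mulrC subrK.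
Qed.

(** Restriction to y_i = 0 followed by the projection onto the kernel of contraction with column i:
    what is left is a form in the other directions. *)
Definition eliminate i (w : V) : V :=
  map_ext (specialize i) w -
  wedge (row_fun i) (koszul_diff (col_fun i) (map_ext (specialize i) w)).

Lemma smooth_eliminate i w : smoothV w -> smoothV (eliminate i w).
Proof.
move=> sw; apply: smoothVB; first exact: smooth_specialize.
apply: smooth_wedge => [k|]; first exact: Cinfty_cst.
apply: smooth_koszul => [k|]; first exact: Cinfty_cst.
exact: smooth_specialize.
Qed.

Lemma hadamardV i w : smoothV w ->
  exists2 u, smoothV u & scalef (y i) u = w - map_ext (specialize i) w.
Proof.
move=> sw; have H T := hadamard (sw T) (sh i) (fun x v => h_indep i i x v).
pose u := [ffun T => sval (cid2 (H T))] : V.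
exists u; first by move=> T; rewrite ffunE; case: cid2.
apply/ffunP => T; rewrite !ffunE; case: cid2 => g /= _ Hg.
by apply/funext => x; rewrite -[RHS]/(w T x - _) Hg.
Qed.

(* [u] and [u'] are the divided differences in [x_(a i)] of [w] and of its
   differential. *)
Lemma eliminate_homotopy i w : smoothV w -> exists u u',
  [/\ smoothV u, smoothV u',
    scalef (y i) u' = koszul_diff J w - map_ext (specialize i) (koszul_diff J w) &
    w = koszul_diff J (wedge (row_fun i) u) + wedge (row_fun i) u' + eliminate i w].
Proof.
move=> sw; have [u su Hu] := hadamardV i sw.
have sJ : smoothV (koszul_diff J w).
  by apply: smooth_koszul => // k; exact: Cinfty_mixed_shear.
have [u' su' Hu'] := hadamardV i sJ.
exists u, u'; split => //.
have sr := smooth_specialize i sw.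
(* Since d(w - r w) = y_i d u and r(d w) = d(r w) - y_i (contraction of r w with column i), with r
   the specialisation, both sides agree after multiplication by y_i. *)
have E : u' = koszul_diff J u + koszul_diff (col_fun i) (map_ext (specialize i) w).
  apply: (@shear_cancelV i) => //.
    apply: smoothVD; apply: smooth_koszul => // k; first exact: Cinfty_mixed_shear.
    exact: Cinfty_cst.
  rewrite Hu' specialize_koszul opprB addrA.
  have -> (v v' : V) : scalef (y i) (v + v') = scalef (y i) v + scalef (y i) v'.
    by apply/ffunP => T; rewrite !ffunE mulrDr.
  by rewrite -(koszul_diff_scale J) Hu koszul_diffB addrAC.
rewrite koszul_wedge mixed_shear_row Hu E wedgeD /eliminate.
move: (map_ext _ _) (wedge _ _) (wedge _ _) => A B C.
by rewrite [X in X + _]addrA subrK addrACA subrr addr0 subrK.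
Qed.

Fixpoint eliminate_all (s : seq 'I_l) (w : V) : V :=
  if s is i :: s' then eliminate_all s' (eliminate i w) else w.

Lemma eliminate_deg i k w : koszul_deg k.+1 w -> koszul_deg k.+1 (eliminate i w).
Proof.
move=> hw.
have hr : koszul_deg k.+1 (map_ext (specialize i) w).
  move=> T; rewrite ffunE => nz; apply: hw; apply: contra_neq nz => ->.
  by apply/funext.
apply: koszul_degD => //; apply: koszul_degN; apply: wedge_deg.
exact: koszul_diff_deg.
Qed.

Lemma col_eliminate i w : koszul_diff (col_fun i) (eliminate i w) = 0.
Proof.
rewrite /eliminate koszul_diffB koszul_wedge col_row eqxx koszul_diff_diff wedge0 subr0.
rewrite (_ : scalef _ ?[u] = ?u) ?subrr //.
by apply/ffunP => T; rewrite ffunE mul1r.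
Qed.

Lemma col_eliminate_other i j w : i != j -> koszul_diff (col_fun j) w = 0 ->
  koszul_diff (col_fun j) (eliminate i w) = 0.
Proof.
move=> ij jw.
have rj : koszul_diff (col_fun j) (map_ext (specialize i) w) = 0.
  have /= := @map_koszul_diff _ _ _ (specialize i) (fun _ _ => erefl) (col_fun j)
    (col_fun j) w (fun _ _ => erefl).
  rewrite jw => <-; apply/ffunP => T; rewrite !ffunE.
  by apply/funext.
rewrite /eliminate koszul_diffB rj koszul_wedge col_row (negbTE ij).
rewrite koszul_diff_anticomm rj koszul_diff0 oppr0 wedge0 subr0 sub0r.
by apply/ffunP => T; rewrite !ffunE mul0r oppr0.
Qed.

Lemma eliminate_all_col s j w : (j \in s) || (koszul_diff (col_fun j) w == 0) ->
  koszul_diff (col_fun j) (eliminate_all s w) = 0.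
Proof.
elim: s w => [|i s IH] w /=; first by move/eqP.
move=> H; apply: IH; have [//|js /=] := boolP (j \in s).
have [->|ij] := eqVneq i j; first by rewrite col_eliminate eqxx.
move: H; rewrite in_cons eq_sym (negbTE ij) (negbTE js) /= => /eqP H.
by rewrite col_eliminate_other.
Qed.

(** The result is killed by contraction with every column of the invertible matrix [alpha], hence
    with every basis vector. Such a form lives in degree 0, whereas the degree here is positive. *)
Lemma eliminate_all_eq0 k w : koszul_deg k.+1 w ->
  eliminate_all (enum 'I_l) w = 0.
Proof.
move=> hw; set u := eliminate_all _ w.
have hu : koszul_deg k.+1 u.
  rewrite /u; elim: (enum _) w hw {u} => //= i s IH w hw.
  by apply: IH; exact: eliminate_deg.
have cu i : koszul_diff (col_fun i) u = 0.
  by apply: eliminate_all_col; rewrite mem_enum.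
have alpha_beta : alpha *m beta = 1%:M by apply: mulmx1C.
have ku i : Defs.contraction i u = 0.
  apply/ffunP => T; rewrite [RHS]ffunE.
  have : \sum_j row_fun j i * koszul_diff (col_fun j) u T = 0.
    by rewrite big1 // => j _; rewrite cu ffunE mulr0.
  under eq_bigr => j _ do rewrite ffunE mulr_sumr.
  rewrite exchange_big /= => <-.
  rewrite (bigD1 i) //= [X in _ + X]big1 ?addr0.
    under eq_bigr => j _ do rewrite mulrA.
    rewrite -mulr_suml.
    rewrite (_ : \sum_j _ = 1) ?mul1r //.
    apply/funext => x; rewrite fct_sumE; have /matrixP /(_ i i) := alpha_beta.
    rewrite !mxE eqxx => e; rewrite -[RHS]/(true%:R : R) -e; apply: eq_bigr => j _.
    by rewrite mulrC.
  move=> k0 k0i; under eq_bigr => j _ do rewrite mulrA.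
  rewrite -mulr_suml (_ : \sum_j _ = 0) ?mul0r //.
  apply/funext => x; rewrite fct_sumE; have /matrixP /(_ k0 i) := alpha_beta.
  rewrite !mxE (negbTE k0i) => e; rewrite -[RHS]/(false%:R : R) -e.
  apply: eq_bigr => j _.
  by rewrite mulrC.
apply/ffunP => T; rewrite [RHS]ffunE; have [->|T0] := eqVneq T finset.set0.
  by apply/eqP/negPn/negP => /hu; rewrite cards0.
exact: contraction_eq0.
Qed.

End CoordinateKoszul.

(** * Squaring several coordinates *)

Section Squares.
Context {R : realType} {m : nat}.
Local Notation X := 'rV[R]_m.
Implicit Types (x : X) (s : seq 'I_m) (f : X -> R).

Definition square_coords s x : X := \row_j (if j \in s then x 0 j ^+ 2 else x 0 j).

Lemma square_coords_cons b s x : b \notin s ->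
  square_coords (b :: s) x = square_coords s (subst x b (x 0 b ^+ 2)).
Proof.
move=> bs; apply/rowP => j; rewrite !mxE in_cons; case: eqP => [->|//].
by rewrite (negbTE bs).
Qed.

Lemma square_coords_nil x : square_coords [::] x = x.
Proof. by apply/rowP => j; rewrite mxE. Qed.

Lemma Cinfty_square_coords s f : uniq s -> Cinfty f -> Cinfty (f \o square_coords s).
Proof.
elim: s f => [|b s IH] f /=.
  by move=> _; rewrite (_ : f \o _ = f) //; apply/funext => x /=; rewrite square_coords_nil.
move=> /andP[bs us] sf.
have -> : f \o square_coords (b :: s) =
    (fun x => (f \o square_coords s) (subst x b ((fun y : X => y 0 b ^+ 2) x))).
  by apply/funext => x /=; rewrite square_coords_cons.
apply: Cinfty_subst; first exact: IH.
rewrite (_ : (fun y => _) = (fun y : X => y 0 b) * (fun y : X => y 0 b)).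
  by apply: CinftyM; exact: Cinfty_coord.
by apply/funext => y; rewrite !fctE expr2.
Qed.

(** One coordinate is treated at a time; the extension stays even in the others, which keeps the
    induction going. *)
Lemma even_extension_seq s f : uniq s -> Cinfty f ->
  (forall b, b \in s -> even_in b f) ->
  exists2 F, Cinfty F & forall x, F (square_coords s x) = f x.
Proof.
elim: s f => [|b s IH] f /=.
  by move=> _ sf _; exists f => // x; rewrite square_coords_nil.
move=> /andP[bs us] sf ef.
have [F1 [sF1 F1f eF1]] := even_extension sf (ef b (mem_head _ _)).
have [|F sF HF] := IH F1 us sF1.
  move=> c cs; apply: eF1; first by apply: contraNneq bs => <-.
  by apply: ef; rewrite in_cons cs orbT.
by exists F => // x; rewrite square_coords_cons // HF F1f.
Qed.

Lemma square_coords_surj s x : (forall b, b \in s -> 0 <= x 0 b) ->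
  exists x', square_coords s x' = x.
Proof.
move=> x0; exists (\row_j (if j \in s then Num.sqrt (x 0 j) else x 0 j)).
by apply/rowP => j; rewrite !mxE; case js: (j \in s) => //; rewrite sqr_sqrtr // x0.
Qed.

Lemma square_coords_norm s x rho : 1 <= rho -> `|x| <= rho ->
  `|square_coords s x| <= rho ^+ 2.
Proof.
move=> r1 xr; have r0 : 0 <= rho by exact: le_trans r1.
apply: norm_le_coord => [|j]; first exact: exprn_ge0.
have xj : `|x 0 j| <= rho by apply: le_trans (coord_le_norm _ _) xr.
rewrite mxE; case: ifP => _; first by rewrite normrX lerXn2r ?nnegrE.
by apply: le_trans xj _; rewrite expr2 ler_peMr.
Qed.

End Squares.

(** * Exactness for even cycles *)

Section EvenCore.
Context {R : realType} {m l : nat}.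
Local Notation X := 'rV[R]_m.
Local Notation V := {ffun {set 'I_l} -> (X -> R)}.

Variables (a : 'I_l -> 'I_m) (h : 'I_l -> X -> R) (alpha beta : 'M[R]_l).
Hypotheses (a_inj : injective a) (sh : forall i, Cinfty (h i))
  (h_indep : forall i j x v, h i (subst x (a j) v) = h i x)
  (beta_alpha : beta *m alpha = 1%:M).

Local Notation y := (shear a h).
Local Notation J := (mixed_shear a h alpha).

(* Comparable to the distance from the box spanned by the pairs
   [x_(a i), h_i x] to the orthant [x_(a i) >= 0]. *)
Definition orthant_dist (x : X) : R :=
  \sum_i Num.max 0 (Num.max (- x 0 (a i)) (- h i x)).

Local Notation w := orthant_dist.

Lemma orthant_dist_ge0 x : 0 <= w x.
Proof. by apply: sumr_ge0 => i _; rewrite le_max lexx. Qed.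

Lemma orthant_dist_continuous : continuous w.
Proof.
apply: continuous_big => [|i _]; first exact: add_continuous.
move=> x; apply: (@continuous_max _ _ (cst 0)
  (fun x : X => Num.max (- x 0 (a i)) (- h i x))); first exact: cst_continuous.
apply: (@continuous_max _ _ (fun x : X => - x 0 (a i)) (fun x => - h i x)).
  by apply: (@continuousN _ _ _ (fun x : X => x 0 (a i))); exact: coord_continuous.
apply: (@continuousN _ _ _ (h i)).
by have ch := Cinfty_continuous (sh i); exact: ch.
Qed.

Lemma orthant_dist_subst i (x : X) v : - v <= Num.max 0 (Num.max (- x 0 (a i)) (- h i x)) ->
  w (subst x (a i) v) <= w x.
Proof.
move=> vx; apply: ler_sum => j _; rewrite h_indep.
have [->|ji] := eqVneq j i.
  by rewrite subst_eq !ge_max vx !le_max !lexx !orbT.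
by rewrite subst_neq //; apply: contra_neq ji => /a_inj.
Qed.

(** Induction on the order: negative coordinates are moved to 0 one after the other, and each move
    costs at most a displacement bounded by w times a derivative bounded by C w^N. *)
Lemma flat_vanish (f : X -> R) : Cinfty f ->
  (forall x : X, (forall i, 0 <= x 0 (a i)) -> f x = 0) -> flat w f.
Proof.
move=> sf f0 N; elim: N f sf f0 => [|N IH] f sf f0 rho.
  have [C C0 HC] := bounded_on_ball rho (Cinfty_continuous sf).
  by exists C => // x xr; rewrite expr0 mulr1 HC.
(* A one-sided difference quotient with positive increment stays in the orthant. *)
have pd0 i (x : X) : (forall j, 0 <= x 0 (a j)) -> pd (a i) f x = 0.
  move=> x0; have /is_derive_subst df := is_derive_pd (a i) x sf.
  apply/eqP; rewrite -normr_le0; apply/ler_addgt0Pl => e e0; rewrite addr0.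
  have [r r0 Hr] := is_derive_ball df e0.
  have r2 : 0 < r / 2 by rewrite divr_gt0.
  have := Hr (r / 2); rewrite gtr0_norm // ltr_pdivrMr // ltr_pMr // ltr1n => /(_ isT).
  rewrite subst_id [f x]f0 // f0; last first.
    move=> j; rewrite substE; case: eqP => // _.
    by rewrite addr_ge0 // ltW.
  by rewrite subrr sub0r normrN normrM gtr0_norm // mulrC ler_pM2r.
have IHpd i := IH (pd (a i) f) (Cinfty_pd _ sf) (pd0 i) rho.
(* The induction is on the list of those coordinates that are allowed to be negative. *)
have [C C0 HC] : exists2 C, 0 <= C & forall x : X, `|x| <= rho ->
    (forall i, i \notin enum 'I_l -> 0 <= x 0 (a i)) -> `|f x| <= C * w x ^+ N.+1.
  elim: (enum _) => [|i s [C C0 HC]].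
    by exists 0 => // x _ x0; rewrite f0 ?normr0 ?mul0r // => i; exact: x0.
  have [D D0 HD] := IHpd i; exists (C + D); first exact: addr_ge0.
  move=> x xr xs; have wN : 0 <= D * w x ^+ N.+1.
    by rewrite mulr_ge0 // exprn_ge0 // orthant_dist_ge0.
  have [xi|xi] := lerP 0 (x 0 (a i)).
    rewrite mulrDl; apply: le_trans (HC x xr _) _; last by rewrite lerDl.
    move=> j js; have [->//|ji] := eqVneq j i.
    by apply: xs; rewrite in_cons negb_or ji.
  pose x' := subst x (a i) 0.
  have wx v : x 0 (a i) <= v -> w (subst x (a i) v) <= w x.
    by move=> xv; apply: orthant_dist_subst; rewrite !le_max lerN2 xv orbT.
  have x'r : `|x'| <= rho.
    by apply: norm_subst => //; rewrite normr0 (le_trans _ xr).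
  have fx' : `|f x'| <= C * w x ^+ N.+1.
    apply: le_trans (HC x' x'r _) _.
      move=> j js; have [->|ji] := eqVneq j i; first by rewrite subst_eq.
      rewrite subst_neq; last by apply: contra_neq ji => /a_inj.
      by apply: xs; rewrite in_cons negb_or ji.
    apply: ler_wpM2l => //; apply: lerXn2r; rewrite ?nnegrE ?orthant_dist_ge0 //.
    by apply: wx; exact: ltW.
  have [t /andP[t0 t1]] := @mvt_subst _ _ f (pd (a i) f) x (a i) 0 (x 0 (a i))
    (Cinfty_continuous sf) (fun s _ => is_derive_pd _ _ sf).
  rewrite subst_id subr0 add0r => /eqP; rewrite subr_eq => /eqP ->.
  rewrite mulrDl addrC; apply: le_trans (ler_normD _ _) _; apply: lerD => //.
  rewrite normrM exprSr mulrA; apply: ler_pM => //.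
    apply: le_trans (HD _ _) _.
      apply: norm_subst => //; apply: le_trans (le_trans (coord_le_norm x (a i)) xr).
      by rewrite normrM gtr0_norm // ler_piMl // ltW.
    apply: ler_wpM2l => //; apply: lerXn2r; rewrite ?nnegrE ?orthant_dist_ge0 //.
    by apply: wx; rewrite -[leLHS]mul1r ler_wnM2r // ltW.
  rewrite ltr0_norm // /w (bigD1 i) //=.
  apply: le_trans (_ : Num.max 0 (Num.max (- x 0 (a i)) (- h i x)) <= _).
    by rewrite !le_max lexx orbT.
  by rewrite lerDl; apply: sumr_ge0 => j _; rewrite le_max lexx.
by exists C => // x xr; apply: HC => // i; rewrite mem_enum.
Qed.

Local Notation flatV u := (forall T, flat w ((u : V) T)).

Lemma flatV_koszul u : flatV u -> flatV (koszul_diff J u).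
Proof.
apply: closed_koszul_diff.
- by move=> N rho; exists 0 => // x _; rewrite normr0 mul0r.
- by move=> f g; apply: flatD; exact: orthant_dist_ge0.
- by move=> f g sg; apply: flatM; [exact: orthant_dist_ge0|exact: Cinfty_continuous].
- exact: Cinfty_mixed_shear.
Qed.

Lemma flatV_wedge i u : flatV u -> flatV (wedge (row_fun beta i) u).
Proof.
apply: closed_wedge.
- by move=> N rho; exists 0 => // x _; rewrite normr0 mul0r.
- by move=> f g; apply: flatD; exact: orthant_dist_ge0.
- by move=> f g sg; apply: flatM; [exact: orthant_dist_ge0|exact: Cinfty_continuous].
- by move=> k; exact: Cinfty_cst.
Qed.

Lemma flatB (f g : X -> R) : flat w f -> flat w g -> flat w (f - g).
Proof.
move=> ff fg; have -> : f - g = f + cst (-1) * g.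
  by apply/funext => x; rewrite !fctE mulN1r.
apply: flatD => //; first exact: orthant_dist_ge0.
by apply: flatM => //; [exact: orthant_dist_ge0|exact: cst_continuous].
Qed.

(** The terms -h_i in [orthant_dist] serve this purpose: substituting h_i for x_(a i) does not
    increase it. *)
Lemma flat_specialize i (f : X -> R) : flat w f -> flat w (specialize a h i f).
Proof.
apply: flat_subst; first exact: orthant_dist_ge0.
  exact: Cinfty_continuous.
by move=> x; apply: orthant_dist_subst; rewrite !le_max lexx !orbT.
Qed.

(** Each elimination leaves an error row_i /\ u', where y_i u' is the differential of u minus its
    specialisation; so u' is flat by [flat_div]. Applying the differential to the homotopy formula
    shows that the eliminated form again has a flat differential. *)
Lemma approximate_exactness (s : seq 'I_l) (u : V) :
  smoothV u -> flatV (koszul_diff J u) -> exists v e,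
  [/\ smoothV v, smoothV e, flatV e &
      u = koszul_diff J v + e + eliminate_all a h alpha beta s u].
Proof.
elim: s u => [|i s IH] u su fu.
  exists 0, 0; split => [T|T|T|]; first by rewrite ffunE; exact: (Cinfty_cst 0).
  - by rewrite ffunE; exact: (Cinfty_cst 0).
  - by rewrite ffunE => N rho; exists 0 => // x _; rewrite normr0 mul0r.
  - by rewrite koszul_diff0 !add0r.
have [v [v' [sv sv' Hv' Hu]]] := eliminate_homotopy a_inj sh h_indep beta_alpha i su.
set u1 := eliminate a h alpha beta i u in Hu.
have su1 : smoothV u1 by exact: smooth_eliminate.
have fv' : flatV v'.
  move=> T; apply: (@flat_div _ _ w (h i) (v' T) (a i)) => //.
  - exact: orthant_dist_ge0.
  - exact: orthant_dist_continuous.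
  - by move=> x t t0; apply: orthant_dist_subst;
    rewrite !le_max lerN2 lerDl t0 orbT.
  have -> : (fun x : X => (x 0 (a i) - h i x) * v' T x) = scalef (y i) v' T.
    by rewrite ffunE.
  rewrite Hv'.
  have -> : (koszul_diff J u - map_ext (specialize a h i) (koszul_diff J u)) T =
    koszul_diff J u T - specialize a h i (koszul_diff J u T) by rewrite !ffunE.
  by apply: flatB; [|apply: flat_specialize].
have fwv : flatV (wedge (row_fun beta i) v') by exact: flatV_wedge.
have fu1 : flatV (koszul_diff J u1).
  have -> : koszul_diff J u1 = koszul_diff J u - koszul_diff J (wedge (row_fun beta i) v').
    rewrite [in RHS]Hu !koszul_diffD koszul_diff_diff add0r.
    by rewrite addrAC subrr add0r.
  move=> T.
  have -> (u2 u3 : V) : (u2 - u3) T = u2 T - u3 T by rewrite !ffunE.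
  by apply: flatB; [|exact: flatV_koszul].
have [v2 [e2 [sv2 se2 fe2 Hu1]]] := IH u1 su1 fu1.
exists (wedge (row_fun beta i) v + v2), (wedge (row_fun beta i) v' + e2); split.
- by apply: smoothVD => //; apply: smooth_wedge => // k; exact: Cinfty_cst.
- by apply: smoothVD => //; apply: smooth_wedge => // k; exact: Cinfty_cst.
- move=> T; rewrite ffunE; apply: flatD => //; exact: orthant_dist_ge0.
rewrite koszul_diffD /= -/u1 {1}Hu {1}Hu1 !addrA; congr (_ + _).
by rewrite -!addrA; congr (_ + _); rewrite !addrA; congr (_ + _); rewrite addrC.
Qed.

Let s : seq 'I_m := [seq a i | i <- enum 'I_l].

Let us : uniq s. Proof. by rewrite map_inj_uniq // enum_uniq. Qed.

Let in_s i : a i \in s. Proof. by apply: map_f; rewrite mem_enum. Qed.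

Definition pull (f : X -> R) : X -> R := f \o square_coords s.

Lemma h_square_coords i (x : X) : h i (square_coords s x) = h i x.
Proof.
rewrite /s; elim: (enum 'I_l) (enum_uniq 'I_l) x => [|j t IH] /= ut x.
  by rewrite square_coords_nil.
move/andP: ut => [jt ut].
by rewrite square_coords_cons ?mem_map // IH // h_indep.
Qed.

Lemma pull_shear i (x : X) : pull (y i) x = x 0 (a i) ^+ 2 - h i x.
Proof. by rewrite /pull /= /shear h_square_coords mxE in_s. Qed.

Definition residual : X -> R := \sum_i pull (y i) * pull (y i).

Lemma residual_ge0 x : 0 <= residual x.
Proof. by rewrite /residual fct_sumE; apply: sumr_ge0 => i _; rewrite -expr2 sqr_ge0. Qed.

Lemma Cinfty_pull f : Cinfty f -> Cinfty (pull f).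
Proof. exact: Cinfty_square_coords. Qed.

Lemma Cinfty_residual : Cinfty residual.
Proof.
apply: Cinfty_sum => i _; apply: CinftyM; apply: Cinfty_pull; exact: Cinfty_shear.
Qed.

(** At t = x^2 only the terms -h_i > 0 count, and each is at most x_i^2 - h_i, hence at most the
    square root of the residual. There are l of them. *)
Lemma orthant_dist_residual (x : X) : w (square_coords s x) ^+ 2 <= l%:R ^+ 2 * residual x.
Proof.
have rx := residual_ge0 x.
have -> : l%:R ^+ 2 * residual x = (l%:R * Num.sqrt (residual x)) ^+ 2.
  by rewrite exprMn sqr_sqrtr.
apply: lerXn2r; rewrite ?nnegrE ?orthant_dist_ge0 ?mulr_ge0 ?sqrtr_ge0 //.
rewrite /w mulr_natl -[X in _ *+ X](card_ord l) -sumr_const; apply: ler_sum => i _.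
rewrite ge_max sqrtr_ge0 /= ge_max h_square_coords mxE in_s.
rewrite (le_trans _ (sqrtr_ge0 _)) ?oppr_le0 ?sqr_ge0 //=.
have [hi|hi] := lerP (- h i x) 0; first exact: le_trans hi (sqrtr_ge0 _).
rewrite -[leLHS](ger0_norm (ltW hi)) -sqrtr_sqr; apply: ler_wsqrtr.
apply: le_trans (_ : pull (y i) x ^+ 2 <= _).
  rewrite pull_shear; have x2 := sqr_ge0 (x 0 (a i)).
  by apply: lerXn2r; rewrite ?nnegrE; [exact: ltW|lra|lra].
rewrite /residual fct_sumE (bigD1 i) //= -expr2 lerDl.
by apply: sumr_ge0 => j _; rewrite -expr2 sqr_ge0.
Qed.

Lemma flat_pull (f : X -> R) : flat w f -> flat residual (pull f).
Proof.
move=> ff N rho; pose r := Num.max 1 rho.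
have r1 : 1 <= r by rewrite le_max lexx.
(* Order 2 N, because the residual is quadratic in the distance; radius r^2, because coordinates are
   squared. *)
have [C C0 HC] := ff (2 * N)%N (r ^+ 2).
exists (C * l%:R ^+ 2 ^+ N); first by rewrite mulr_ge0 // !exprn_ge0.
move=> x xr; apply: le_trans (HC _ _) _.
  by apply: square_coords_norm => //; rewrite le_max xr orbT.
rewrite -mulrA; apply: ler_wpM2l => //; rewrite exprM -exprMn.
apply: lerXn2r; rewrite ?nnegrE ?sqr_ge0 ?orthant_dist_residual //.
by rewrite mulr_ge0 ?sqr_ge0 ?residual_ge0.
Qed.

Lemma even_koszul_exact k (u : V) : smoothV u -> koszul_deg k.+1 u ->
  (forall T i, even_in (a i) (u T)) -> koszul_diff (pull \o J) u = 0 ->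
  exists2 v, smoothV v & koszul_diff (pull \o J) v = u.
Proof.
move=> su du eu Ju.
have H T : exists2 F, Cinfty F & forall x, F (square_coords s x) = u T x.
  apply: even_extension_seq => //.
  by move=> b /mapP[i _ ->]; exact: eu.
(* Coefficients outside degree k+1 are set to 0, because an extension of 0 chosen separately need
   not be 0. *)
pose U : V := [ffun T : {set 'I_l} => if #|T| == k.+1 then sval (cid2 (H T)) else 0].
have sU : smoothV U.
  move=> T; rewrite ffunE; case: ifP => _; last exact: (Cinfty_cst 0).
  by case: cid2.
have dU : koszul_deg k.+1 U by move=> T; rewrite ffunE; case: (_ =P k.+1); rewrite ?eqxx.
have pU : map_ext pull U = u.
  apply/ffunP => T; rewrite !ffunE; case: ifPn => Tk.
    by case: cid2 => F /= _ HF; apply/funext.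
  have -> : u T = 0 by apply/eqP; apply: contraNT Tk => /du ->.
  by apply/funext.
have pJ (v : V) : map_ext pull (koszul_diff J v) = koszul_diff (pull \o J) (map_ext pull v).
  exact: (@map_koszul_diff _ _ _ pull (fun _ _ => erefl) J (pull \o J) v
    (fun _ _ => erefl)).
have fJU : flatV (koszul_diff J U).
  move=> T; apply: flat_vanish.
    by apply: smooth_koszul => // j; exact: Cinfty_mixed_shear.
  move=> x x0; have [x' <-] : exists x', square_coords s x' = x.
    by apply: square_coords_surj => b /mapP[i _ ->].
  have /ffunP /(_ T) := pJ U; rewrite pU Ju !ffunE => /(congr1 (fun F => F x')).
  by [].
have [v [e [sv se fe HU]]] := approximate_exactness (enum 'I_l) sU fJU.
rewrite (eliminate_all_eq0 a h beta_alpha dU) addr0 in HU.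
pose e' := map_ext pull e.
have He : u = koszul_diff (pull \o J) (map_ext pull v) + e'.
  by rewrite -pJ -{1}pU {1}HU; apply/ffunP => T; rewrite !ffunE.
have Je' : koszul_diff (pull \o J) e' = 0.
  by have := Ju; rewrite {1}He koszul_diffD koszul_diff_diff add0r.
have fe' T : flat residual (e' T) by rewrite ffunE; exact: flat_pull.
pose q : V := scalef (fun x => (residual x)^-1) e'.
have sq : smoothV q.
  move=> T; rewrite ffunE.
  have -> : (fun x => (residual x)^-1) * e' T = (fun x => e' T x / residual x ^+ 1).
    by apply/funext => x; rewrite !fctE expr1 mulrC.
  apply: Cinfty_flat_quotient => //; [exact: residual_ge0|exact: Cinfty_residual|].
  by rewrite ffunE; exact: Cinfty_pull.
(* Chosen so that the pairing with J is the sum of the squares of the pulled back y_i, by duality of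
   rows and columns. *)
pose z : 'I_l -> X -> R := fun j => \sum_i row_fun beta i j * pull (y i).
have sz j : Cinfty (z j).
  apply: Cinfty_sum => i _; apply: CinftyM; first exact: Cinfty_cst.
  by apply: Cinfty_pull; exact: Cinfty_shear.
exists (map_ext pull v + wedge z q).
  apply: smoothVD; last exact: smooth_wedge.
  by move=> T; rewrite ffunE; exact: Cinfty_pull.
rewrite koszul_diffD [RHS]He; congr (_ + _).
rewrite koszul_wedge koszul_diff_scale Je'.
have -> : \sum_i (pull \o J) i * z i = residual.
  under eq_bigr => j _ do rewrite mulr_sumr.
  rewrite exchange_big; apply: eq_bigr => i _ /=.
  under eq_bigr => j _ do rewrite mulrA.
  rewrite -mulr_suml; congr (_ * _).
  have := mixed_shear_row a h beta_alpha i => /(congr1 pull) <-.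
  by apply/funext => x; rewrite /pull /= !fct_sumE.
rewrite (_ : scalef _ 0 = 0) ?wedge0 ?subr0; last first.
  by apply/ffunP => T; rewrite !ffunE mulr0.
apply/ffunP => T; rewrite !ffunE; apply/funext => x; rewrite !fctE.
(* Where the residual vanishes its inverse is 0 by convention, and e' vanishes there by flatness. *)
have [rx|rx] := eqVneq (residual x) 0; last by rewrite mulVKf.
rewrite rx mul0r; have := flat0 (fe' T) rx; rewrite ffunE.
by move=> ->.
Qed.

End EvenCore.

(** * Reduction to even cycles *)

Section EvenReduction.
Context {R : realType} {m l : nat}.
Local Notation X := 'rV[R]_m.
Local Notation V := {ffun {set 'I_l} -> (X -> R)}.
Implicit Types (b c : 'I_m) (f g : X -> R) (u v : V).

Lemma coord_cancel b f g : continuous f -> continuous g ->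
  (forall x : X, x 0 b * f x = x 0 b * g x) -> f = g.
Proof.
move=> cf cg fg.
apply: (@shear_cancel R m 1 (fun=> b) (fun _ _ => 0) (fun _ _ _ _ => erefl) 0) => //.
by apply/funext => x; rewrite !fctE /shear subr0.
Qed.

Definition flip b f : X -> R := fun x => f (subst x b (- x 0 b)).

Lemma flipK b f : flip b (flip b f) = f.
Proof. by apply/funext => x; rewrite /flip subst_eq opprK substK subst_id. Qed.

Lemma flipC b c f : flip b (flip c f) = flip c (flip b f).
Proof.
have [->//|bc] := eqVneq b c; apply/funext => x; rewrite /flip.
by rewrite !subst_neq 1?[c == b]eq_sym // substC.
Qed.

Lemma even_flip b f : even_in b f <-> flip b f = f.
Proof. by split=> [ef|e x]; [apply/funext|rewrite -[in RHS]e]. Qed.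

Lemma Cinfty_flip b f : Cinfty f -> Cinfty (flip b f).
Proof.
move=> sf; apply: (@Cinfty_subst _ _ b f (fun x => - x 0 b)) => //.
rewrite (_ : (fun x => _) = cst 0 - (fun x : X => x 0 b)).
  by apply: CinftyB; [exact: Cinfty_cst|exact: Cinfty_coord].
by apply/funext => x; rewrite !fctE sub0r.
Qed.

(** The list [t] collects the coordinates in which cycles are assumed even; the empty list gives
    plain exactness. The primitive carries no degree condition, which [degree_part] restores
    later. *)
Definition exact_on (k : nat) (x : 'I_l -> X -> R) (t : seq 'I_m) := forall u : V,
  smoothV u -> koszul_deg k u -> (forall T b, b \in t -> even_in b (u T)) ->
  koszul_diff x u = 0 -> exists2 v : V, smoothV v & koszul_diff x v = u.

(** Reflection in x_b commutes with the differential because the x_i are even in b, so both halves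
    of a cycle are cycles. Dividing the odd half by x_b keeps degree, evenness and the cycle
    condition, since x_b can be cancelled. *)
Lemma exact_on_step k x b t : (forall i, Cinfty (x i)) ->
  (forall i, even_in b (x i)) ->
  exact_on k x (b :: t) -> exact_on k x t.
Proof.
move=> sx ex H u su du eu xu.
pose r u := map_ext (flip b) u : V.
have xr v : r (koszul_diff x v) = koszul_diff x (r v).
  rewrite /r (@map_koszul_diff _ _ _ (flip b) (fun _ _ => erefl) x (flip b \o x) v
    (fun _ _ => erefl)).
  congr (koszul_diff _ _).
  by apply/funext => i /=; apply/even_flip.
have sr : smoothV (r u) by move=> T; rewrite ffunE; exact: Cinfty_flip.
have xru : koszul_diff x (r u) = 0.
  by rewrite -xr xu; apply/ffunP => T; rewrite !ffunE; apply/funext.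
have dr : koszul_deg k (r u).
  move=> T; rewrite ffunE => nz; apply: du; apply: contra_neq nz => ->.
  by apply/funext.
pose ue := scalef (cst 2^-1) (u + r u); pose uo := scalef (cst 2^-1) (u - r u).
have s_half (v : V) : smoothV v -> smoothV (scalef (cst 2^-1) v).
  by move=> sv T; rewrite ffunE; apply: CinftyM => //; exact: Cinfty_cst.
have d_half (v : V) : koszul_deg k v -> koszul_deg k (scalef (cst 2^-1) v).
  move=> dv T; rewrite ffunE => nz; apply: dv; apply: contra_neq nz => ->.
  by rewrite mulr0.
have rc c T : c \in t -> flip c (u T) = u T.
  by move=> ct; apply/even_flip; exact: eu.
have [v1 sv1 Hv1] : exists2 v : V, smoothV v & koszul_diff x v = ue.
  apply: H.
  - by apply: s_half; exact: smoothVD.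
  - by apply: d_half; exact: koszul_degD.
  - move=> T c; have ueE : ue T = cst 2^-1 * (u T + flip b (u T)) by rewrite !ffunE.
    rewrite ueE in_cons => /orP[/eqP->|ct]; apply/even_flip.
      rewrite -[LHS]/(cst 2^-1 * (flip b (u T) + flip b (flip b (u T)))).
      by rewrite flipK addrC.
    rewrite -[LHS]/(cst 2^-1 * (flip c (u T) + flip c (flip b (u T)))).
    by rewrite flipC (rc c).
  - rewrite koszul_diff_scale koszul_diffD xu xru addr0.
    by apply/ffunP => T; rewrite !ffunE mulr0.
have suo : smoothV uo by apply: s_half; exact: smoothVB.
have uoE T : uo T = cst 2^-1 * (u T - flip b (u T)) by rewrite !ffunE.
have uo_odd T z : uo T (subst z b (- z 0 b)) = - uo T z.
  rewrite uoE -[LHS]/((cst 2^-1 * (flip b (u T) - flip b (flip b (u T)))) z).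
  by rewrite flipK !fctE -mulrN opprB.
have Hg T : exists2 g, Cinfty g & forall z, uo T z = z 0 b * g z.
  have [g sg Hg] := @hadamard _ _ b (uo T) (fun=> 0) (suo T) (Cinfty_cst 0)
    (fun _ _ => erefl).
  exists g => // z; rewrite -[z 0 b]subr0 -Hg.
  have := uo_odd T (subst z b 0); rewrite subst_eq oppr0 substK => /eqP.
  by rewrite -addr_eq0 -mulr2n mulrn_eq0 /= => /eqP ->; rewrite subr0.
pose g : V := [ffun T => sval (cid2 (Hg T))].
have sg : smoothV g by move=> T; rewrite ffunE; case: cid2.
have gE T z : uo T z = z 0 b * g T z by rewrite [g T]ffunE; case: cid2.
have gV : scalef (fun z : X => z 0 b) g = uo.
  by apply/ffunP => T; rewrite ffunE; apply/funext => z; rewrite gE.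
have cg T : continuous (g T) by exact: Cinfty_continuous.
have cgr c T : continuous (flip c (g T)).
  by apply: Cinfty_continuous; exact: Cinfty_flip.
have xuo : koszul_diff x uo = 0.
  rewrite koszul_diff_scale koszul_diffB xu xru subrr.
  by apply/ffunP => T; rewrite !ffunE mulr0.
have [v2 sv2 Hv2] : exists2 v : V, smoothV v & koszul_diff x v = g.
  apply: H => //.
  - move=> T; apply: contra_neq_eq => Tk; apply: (@coord_cancel b) => //.
      exact: cst_continuous.
    move=> z; rewrite -gE mulr0 uoE.
    have -> : u T = 0 by apply/eqP; apply: contraNT Tk => /du ->.
    by rewrite -[LHS]/(2^-1 * (0 - 0)) subrr mulr0.
  - move=> T c ct; apply/even_flip; apply: (@coord_cancel b) => // z.
    rewrite -gE; have [->|cb] := eqVneq c b.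
      by apply: oppr_inj; rewrite -uo_odd gE subst_eq mulNr.
    move: ct; rewrite in_cons (negbTE cb) /= => ct.
    have -> : uo T z = flip c (uo T) z.
      rewrite uoE -[RHS]/((cst 2^-1 * (flip c (u T) - flip c (flip b (u T)))) z).
      by rewrite flipC (rc c).
    by rewrite /flip gE subst_neq // eq_sym.
  - apply/ffunP => T; rewrite [RHS]ffunE; apply: (@coord_cancel b).
    + by apply: Cinfty_continuous; exact: smooth_koszul.
    + exact: cst_continuous.
    move=> z; rewrite mulr0.
    have /ffunP /(_ T) := koszul_diff_scale x (fun z : X => z 0 b) g.
    by rewrite gV xuo !ffunE => /(congr1 (fun F => F z)).
exists (v1 + scalef (fun z : X => z 0 b) v2).
  apply: smoothVD => // T; rewrite ffunE; apply: CinftyM => //.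
  exact: Cinfty_coord.
rewrite koszul_diffD koszul_diff_scale Hv1 Hv2 gV.
apply/ffunP => T; rewrite !ffunE; apply/funext => z; rewrite !fctE.
by field.
Qed.

Lemma exact_on_nil k x t : (forall i, Cinfty (x i)) ->
  (forall i b, b \in t -> even_in b (x i)) -> exact_on k x t -> exact_on k x [::].
Proof.
move=> sx; elim: t => // b t IH ex H; apply: IH.
  by move=> i c ct; apply: ex; rewrite in_cons ct orbT.
apply: exact_on_step H => // i; apply: ex; exact: mem_head.
Qed.

End EvenReduction.

(** * Application to moment maps *)

Section RealCoordinates.
Context {R : realType} {n : nat}.
Local Notation X := 'rV[R]_(n + n).

Definition to_real_coords (z : 'rV[R[i]]_n) : X :=
  row_mx (\row_j complex.Re (z 0 j)) (\row_j complex.Im (z 0 j)).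

Lemma to_real_coordsK z : of_real_coords (to_real_coords z) = z.
Proof.
by apply/rowP => j; rewrite mxE row_mxEl row_mxEr !mxE; case: (z 0 j).
Qed.

Lemma of_real_coordsK x : to_real_coords (of_real_coords x) = x.
Proof.
apply/rowP => j; rewrite mxE; case: splitP => k jk; rewrite !mxE /=.
  by congr (x _ _); apply/val_inj.
by congr (x _ _); apply/val_inj.
Qed.

Definition in_coords (f : smooth_fun R n) : X -> R := f \o of_real_coords.

Lemma Cinfty_in_coords f : Cinfty (in_coords f).
Proof. by have /asboolP := smooth_valP f. Qed.

Lemma in_coords_inj : injective in_coords.
Proof.
move=> f g fg; apply: val_inj; apply/funext => z; rewrite -(to_real_coordsK z).
exact: (congr1 (fun F => F (to_real_coords z)) fg).
Qed.

Lemma in_coords_surj (g : X -> R) : Cinfty g -> exists f, in_coords f = g.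
Proof.
move=> sg; have E : (g \o to_real_coords) \o of_real_coords = g.
  by apply/funext => x /=; rewrite of_real_coordsK.
have sf : smooth (g \o to_real_coords) by move=> k; rewrite E.
by exists (SmoothFun (introT (asboolP _) sf)).
Qed.

Lemma koszul_acyclic_in_coords l (J : 'I_l -> smooth_fun R n) :
  (forall k, exact_on k.+1 (in_coords \o J) [::]) -> koszul_acyclic J.
Proof.
move=> H [//|k] w _ dw Jw.
have jw v : map_ext in_coords (koszul_diff J v) =
    koszul_diff (in_coords \o J) (map_ext in_coords v).
  exact: (@map_koszul_diff _ _ _ in_coords (fun _ _ => erefl) J (in_coords \o J) v
    (fun _ _ => erefl)).
have [||//||v sv Hv] := H k (map_ext in_coords w).
- by move=> T; rewrite ffunE; exact: Cinfty_in_coords.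
- move=> T; rewrite ffunE => nz; apply: dw; apply: contra_neq nz => ->.
  by apply/funext.
- by rewrite -jw Jw; apply/ffunP => T; rewrite !ffunE; apply/funext.
have sT T := in_coords_surj (sv T).
pose u := [ffun T => sval (cid (sT T))].
have uv : map_ext in_coords u = v.
  by apply/ffunP => T; rewrite !ffunE; case: cid.
have Ju : koszul_diff J u = w.
  have : map_ext in_coords (koszul_diff J u) = map_ext in_coords w by rewrite jw uv.
  move/ffunP => E; apply/ffunP => T; have := E T; rewrite !ffunE.
  exact: in_coords_inj.
exists (degree_part k.+2 u); first exact: degree_part_deg.
exact: koszul_diff_degree_part.
Qed.

End RealCoordinates.

(** * Complex coefficients *)

Section Complexification.
Context {R : realType} {n l : nat}.

Lemma real_part_subproof (F : csmooth_fun R n) : (@complex.Re R \o F) \in smooth_pred.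
Proof. by have /asboolP[? _] := csmooth_valP F; apply/asboolP. Qed.

Lemma imag_part_subproof (F : csmooth_fun R n) : (@complex.Im R \o F) \in smooth_pred.
Proof. by have /asboolP[_ ?] := csmooth_valP F; apply/asboolP. Qed.

Definition real_part F := SmoothFun (real_part_subproof F).
Definition imag_part F := SmoothFun (imag_part_subproof F).

Lemma of_parts_subproof (f g : smooth_fun R n) :
  (fun z => (f z +i* g z)%C) \in @csmooth_pred R n.
Proof.
by apply/asboolP; split; [exact/asboolP/(smooth_valP f)|exact/asboolP/(smooth_valP g)].
Qed.

Definition of_parts f g := CsmoothFun (of_parts_subproof f g).

Lemma parts_inj F G : real_part F = real_part G -> imag_part F = imag_part G -> F = G.
Proof.
move=> /(congr1 (@smooth_val R n)) /= rFG /(congr1 (@smooth_val R n)) /= iFG.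
apply: val_inj; apply/funext => z /=.
have := congr1 (fun f => f z) rFG; have := congr1 (fun f => f z) iFG.
by rewrite /=; case: (F z) (G z) => [? ?] [? ?] /= -> ->.
Qed.

Lemma real_partD : {morph real_part : F G / F + G}.
Proof.
move=> F G; apply: val_inj; apply/funext => z /=; rewrite !fctE /=.
by case: (F z) (G z) => [? ?] [].
Qed.

Lemma imag_partD : {morph imag_part : F G / F + G}.
Proof.
move=> F G; apply: val_inj; apply/funext => z /=; rewrite !fctE /=.
by case: (F z) (G z) => [? ?] [].
Qed.

Lemma real_part_complexify f F : real_part (complexify f * F) = f * real_part F.
Proof.
apply: val_inj; apply/funext => z /=; rewrite !fctE /=.
by case: (F z) => [? ?] /=; rewrite mul0r subr0.
Qed.

Lemma imag_part_complexify f F : imag_part (complexify f * F) = f * imag_part F.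
Proof.
apply: val_inj; apply/funext => z /=; rewrite !fctE /=.
by case: (F z) => [? ?] /=; rewrite mul0r addr0.
Qed.

(** As J is real, the real and imaginary parts of a complex cycle are separately cycles. *)
Lemma koszul_acyclic_complexify (J : 'I_l -> smooth_fun R n) :
  koszul_acyclic J -> koszul_acyclic (fun i => complexify (J i)).
Proof.
move=> H k w k0 dw Jw.
have rJ v := @map_koszul_diff _ _ l real_part real_partD (fun i => complexify (J i)) J v
  (fun i => real_part_complexify (J i)).
have iJ v := @map_koszul_diff _ _ l imag_part imag_partD (fun i => complexify (J i)) J v
  (fun i => imag_part_complexify (J i)).
have r0 : real_part 0 = 0 by apply: val_inj.
have i0 : imag_part 0 = 0 by apply: val_inj.
have [||v1 dv1 Hv1] := H k (map_ext real_part w) k0.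
- by move=> T; rewrite ffunE => nz; apply: dw; apply: contra_neq nz => ->.
- by rewrite -rJ Jw; apply/ffunP => T; rewrite !ffunE.
have [||v2 dv2 Hv2] := H k (map_ext imag_part w) k0.
- by move=> T; rewrite ffunE => nz; apply: dw; apply: contra_neq nz => ->.
- by rewrite -iJ Jw; apply/ffunP => T; rewrite !ffunE.
pose v := [ffun T => of_parts (v1 T) (v2 T)].
have rv : map_ext real_part v = v1.
  by apply/ffunP => T; rewrite !ffunE; apply: val_inj; apply/funext.
have iv : map_ext imag_part v = v2.
  by apply/ffunP => T; rewrite !ffunE; apply: val_inj; apply/funext.
have Jv : koszul_diff (fun i => complexify (J i)) v = w.
  have /ffunP rE := rJ v; have /ffunP iE := iJ v.
  apply/ffunP => T; apply: parts_inj.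
    by have := rE T; rewrite rv Hv1 !ffunE.
  by have := iE T; rewrite iv Hv2 !ffunE.
exists (degree_part k.+1 v); first exact: degree_part_deg.
exact: koszul_diff_degree_part.
Qed.

End Complexification.

(** A nonzero vector xi of the real left kernel of A spans a one-parameter subgroup all of whose
    phases are 1. *)
Lemma effective_row_free (R : realType) (l n : nat) (A : 'M[int]_(l, n)) :
  effective (R := R) A -> row_free (map_mx intr A : 'M[R]_(l, n)).
Proof.
move=> effA; rewrite -kermx_eq0; apply/eqP/row_matrixP => i; rewrite row0.
apply/eqP; apply: contraPT (effA (row i (kermx (map_mx intr A)))).
move=> xi0 /(_ xi0); apply=> t z.
rewrite torus_act_exp; apply/rowP => j; rewrite mxE.
set xi := row i _.
have : (xi *m map_mx intr A) 0 j = 0 by rewrite -row_mul mulmx_ker !mxE.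
rewrite mxE => e.
rewrite (eq_bigr (fun k => t * (xi 0 k * map_mx intr A k j))).
  by rewrite -mulr_sumr e !mulr0 oppr0 expi0 mul1r.
by move=> k _; rewrite !mxE; ring.
Qed.

Theorem proposition2p1 (R : realType) (l n : nat) (A : 'M[int]_(l, n))
    (J : 'I_l -> smooth_fun R n) (c : 'I_l -> R)
    (J_moment : forall (i : 'I_l) (z : 'rV[R[i]]_n),
       (J i z)%:C%C =
         \sum_(j < n) (A i j)%:~R * (z 0 j * (z 0 j)^*) + (c i)%:C%C)
    (A_effective : effective (R := R) A) :
  koszul_acyclic J /\ koszul_acyclic (fun i => complexify (J i)).
Proof.
suff JR : koszul_acyclic J by split => //; exact: koszul_acyclic_complexify.
apply: koszul_acyclic_in_coords => k.
pose M : 'M[R]_(l, n) := map_mx intr A.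
have JE i x : in_coords (J i) x =
    \sum_j M i j * (x 0 (lshift n j) ^+ 2 + x 0 (rshift n j) ^+ 2) + c i.
  apply: (@complexI R); rewrite /in_coords /= J_moment rmorphD rmorph_sum /=.
  congr (_ + _); apply: eq_bigr => j _; rewrite !mxE rmorphM rmorph_int.
  congr (_ * _); apply/eqP.
  by rewrite eq_complex /=; apply/andP; split; apply/eqP; ring.
have fullM : row_full M^T by rewrite /row_full mxrank_tr; exact: effective_row_free.
(* The l columns of A forming an invertible minor. *)
pose p := fullrankfun fullM.
have p_inj : injective p by exact: fullrankfun_inj.
pose alpha : 'M[R]_l := \matrix_(i, j) M i (p j).
have alpha_unit : alpha \in unitmx.
  rewrite -unitmx_tr (_ : alpha^T = rowsub p M^T) ?fullrowsub_unit //.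
  by apply/matrixP => i j; rewrite !mxE.
pose beta := invmx alpha.
have ba : beta *m alpha = 1%:M by exact: mulVmx.
have ab : alpha *m beta = 1%:M by exact: mulmxV.
pose a (i : 'I_l) : 'I_(n + n) := lshift n (p i).
have a_inj : injective a by move=> i j /lshift_inj /p_inj.
(* Solved from x_(a i)^2 - h_i = (beta J)_i; the constants [c] and the imaginary parts end up in
   [h]. *)
pose h (i : 'I_l) (x : 'rV[R]_(n + n)) : R :=
  x 0 (a i) ^+ 2 - \sum_k beta i k * in_coords (J k) x.
have J_subst i j x v : in_coords (J i) (subst x (a j) v) =
    in_coords (J i) x + alpha i j * (v ^+ 2 - x 0 (a j) ^+ 2).
  have r_neq q : rshift n q != a j by rewrite eq_rlshift.
  have l_neq q : q != p j -> lshift n q != a j.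
    by move=> qp; apply: contra_neq qp => /lshift_inj.
  rewrite !JE (bigD1 (p j)) //= [in RHS](bigD1 (p j)) //= mxE subst_eq subst_neq //.
  have -> : \sum_(q < n | q != p j) M i q * (subst x (a j) v 0 (lshift n q) ^+ 2 +
        subst x (a j) v 0 (rshift n q) ^+ 2) =
      \sum_(q < n | q != p j) M i q * (x 0 (lshift n q) ^+ 2 + x 0 (rshift n q) ^+ 2).
    by apply: eq_bigr => q qp; rewrite !subst_neq // l_neq.
  by rewrite mxE -/(a j) /M mxE; ring.
have sh i : Cinfty (h i).
  have -> : h i = (fun x : 'rV[R]_(n + n) => x 0 (a i)) * (fun x => x 0 (a i)) -
      \sum_k cst (beta i k) * in_coords (J k).
    by apply/funext => x; rewrite /h !fctE fct_sumE expr2.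
  apply: CinftyB; first by apply: CinftyM; exact: Cinfty_coord.
  apply: Cinfty_sum => q _; apply: CinftyM; first exact: Cinfty_cst.
  exact: Cinfty_in_coords.
(* In J_k the square of x_(a j) has coefficient alpha_kj, hence delta_ij in (beta J)_i, where the
   term x_(a i)^2 of h_i removes it. *)
have h_indep i j x v : h i (subst x (a j) v) = h i x.
  rewrite /h; under eq_bigr => q _ do rewrite J_subst mulrDr mulrA.
  rewrite big_split /= -mulr_suml.
  have /matrixP /(_ i j) := ba; rewrite !mxE => ->.
  by rewrite (inj_eq a_inj); have [->|_] := eqVneq i j;
    rewrite /= ?mulr1n ?mulr0n; ring.
(* After squaring the selected coordinates, alpha applied to beta J returns J. *)
have pullJ : in_coords \o J = pull a \o mixed_shear a h alpha.
  apply/funext => q /=; apply/funext => x.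
  rewrite /pull /= /mixed_shear fct_sumE.
  rewrite (eq_bigr (fun i => alpha q i * (\sum_k beta i k * in_coords (J k) x))); last first.
    move=> i _; congr (_ * _); have := pull_shear a_inj h_indep i x.
    by rewrite /pull /= => ->; rewrite /h; ring.
  under eq_bigr => i _ do rewrite mulr_sumr.
  rewrite exchange_big /= (bigD1 q) //= [X in _ + X]big1 ?addr0.
    under eq_bigr => i _ do rewrite mulrA.
    rewrite -mulr_suml; have /matrixP /(_ q q) := ab.
    by rewrite !mxE eqxx => ->; rewrite mul1r.
  move=> r rq; under eq_bigr => i _ do rewrite mulrA.
  rewrite -mulr_suml; have /matrixP /(_ q r) := ab.
  by rewrite !mxE eq_sym (negbTE rq) => ->; rewrite mul0r.
apply: (@exact_on_nil _ _ _ _ _ [seq a i | i <- enum 'I_l]).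
- by move=> i; exact: Cinfty_in_coords.
- move=> i b /mapP[j _ ->] x /=; rewrite J_subst; ring.
move=> u su du eu; rewrite pullJ => Ju.
apply: (even_koszul_exact a_inj sh h_indep ba su du) => // T i.
by apply: eu; apply: map_f; rewrite mem_enum.
Qed.
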